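(* Let $X$ and $B$ be compact connected complex manifolds and let $\pi: X \to B$ be an elliptic principal bundle with fiber an elliptic curve $E$. If the two Chern classes $c_1'(X), c_1''(X)$ of the bundle $\pi: X\to B$ are linearly independent in $H^2(B,\mathbb{R})$, then $X$ carries no locally conformally Kähler metric.
   Context: An elliptic principal bundle is a holomorphic principal bundle $\pi: X\to B$ between complex manifolds whose structure group (and fiber) is an elliptic curve $E$, viewed as a complex $1$-dimensional Lie group. Chern classes: Let $B$ be a differentiable manifold and $E$ a $2$-dimensional real torus, written $E=\mathbb{C}/\Lambda$ with $\Lambda$ a lattice with a fixed $\mathbb{Z}$-basis, so $\Lambda\simeq\mathbb{Z}^{\oplus 2}$. Smooth principal $E$-bundles over $B$ are classified up to isomorphism by $H^1(B,\mathcal{C}_B(E))$, where $\mathcal{C}_B(E)$ is the sheaf of germs of smooth $E$-valued functions on $B$. Since the sheaf $\mathcal{C}_B(\mathbb{C})$ of smooth complex-valued functions is fine, the exact sequence $0\to \mathbb{Z}_B^{\oplus 2}\to\mathcal{C}_B(\mathbb{C})\to\mathcal{C}_B(E)\to 0$ induces an isomorphism $H^1(B,\mathcal{C}_B(E))\simeq H^2(B,\mathbb{Z})^{\oplus 2}$. The image of a principal bundle $X\to B$ is denoted $(c_1'(X),c_1''(X))$ and its components are the Chern classes of the bundle. (Changing the basis of $\Lambda$ changes the pair by an invertible integral linear transformation.) The Chern classes of an elliptic principal bundle are those of the underlying smooth principal bundle; they are viewed in $H^2(B,\mathbb{R})$ via the natural map $H^2(B,\mathbb{Z})\to H^2(B,\mathbb{R})$.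 Locally conformally Kähler (LCK) metric: a hermitian metric $g$ on a complex manifold $X$ such that $X$ is covered by open sets $U_i$, each carrying a Kähler metric $g_i$ and a smooth real-valued function $f_i$ with $g|_{U_i}=e^{f_i}g_i$. Equivalently, the fundamental form $\Omega$ of $g$ satisfies $d\Omega=\theta\wedge\Omega$ for some closed real $1$-form $\theta$ on $X$. The case where $\theta$ is exact (globally conformally Kähler, in particular Kähler) is included. *)

(* Defs.v *)
From HB Require Import structures.
From mathcomp Require Import all_boot all_order all_algebra.
From mathcomp Require Import all_classical all_reals all_analysis.
From mathcomp Require Import complex ring.

Set Implicit Arguments.
Unset Strict Implicit.
Unset Printing Implicit Defensive.

Import Order.TTheory GRing.Theory Num.Theory numFieldNormedType.Exports.

Local Open Scope classical_set_scope.
Local Open Scope ring_scope.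
Local Open Scope quotient_scope.

(* [R[i]] packaged as a numClosedFieldType: the norm and the topology of
   MathComp-Analysis are attached to that structure, not to the bare [R[i]]. *)
Definition Cx (R : realType) : numClosedFieldType := R[i]%C.

(* Real smoothness of a function on an open subset [D] of a complex normed
   space: derivatives are taken along the real lines [t |-> z + t v]. *)
Section RealSmoothness.
Variables (R : realType) (V : normedModType (Cx R)).
Implicit Types (D : set V) (f : V -> R) (v z : V).

Definition real_line z v : R -> V := fun t => z + ((t%:C)%C : Cx R) *: v.

Definition dirderiv f v z : R := derive1 (f \o real_line z v) 0.

Fixpoint Ck (k : nat) D f : Prop :=
  (forall z, D z -> {for z, continuous f}) /\
  (if k is k'.+1 then
     forall v, (forall z, D z -> derivable (f \o real_line z v) 0 1) /\
               Ck k' D (dirderiv f v)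
   else True).

Definition smooth D f : Prop := forall k, Ck k D f.

End RealSmoothness.

(* [chart_map] (resp. [chart_inv]) is only meaningful on [chart_dom]
   (resp. [chart_img]). *)
Record chart (R : realType) (M : topologicalType) (V : normedModType (Cx R)) :=
  Chart {
    chart_dom : set M;
    chart_map : M -> V;
    chart_inv : V -> M }.

Definition chart_img R M V (a : @chart R M V) : set V :=
  chart_map a @` chart_dom a.

Definition transition R M V (a b : @chart R M V) : V -> V :=
  chart_map b \o chart_inv a.

(* [differentiable] is over the field [Cx R]; on open sets it is holomorphy. *)
Record complex_structure (R : realType) (M : topologicalType)
    (V : normedModType (Cx R)) := ComplexStructure {
  atlas :> set (chart M V);
  cs_hausdorff : hausdorff_space M;
  cs_second_countable : @second_countable M;
  cs_cover : forall x, exists2 a, atlas a & chart_dom a x;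
  cs_open_dom : forall a, atlas a -> open (chart_dom a);
  cs_open_img : forall a, atlas a -> open (chart_img a);
  cs_mapK : forall a, atlas a ->
    forall x, chart_dom a x -> chart_inv a (chart_map a x) = x;
  cs_continuous_map : forall a, atlas a ->
    forall x, chart_dom a x -> {for x, continuous (chart_map a)};
  cs_continuous_inv : forall a, atlas a ->
    forall z, chart_img a z -> {for z, continuous (chart_inv a)};
  cs_transition : forall a b, atlas a -> atlas b ->
    forall x, chart_dom a x -> chart_dom b x ->
      differentiable (transition a b) (chart_map a x) }.

Definition model_atlas (R : realType) (V : normedModType (Cx R)) :
  set (chart V V) := [set Chart setT id id].

Definition prod_chart (R : realType) (M N : topologicalType)
    (V W : normedModType (Cx R)) (a : chart M V) (b : chart N W) :
    chart (M * N)%type (V * W)%type :=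
  Chart (chart_dom a `*` chart_dom b)
        (fun x => (chart_map a x.1, chart_map b x.2))
        (fun z => (chart_inv a z.1, chart_inv b z.2)).

Definition prod_atlas (R : realType) (M N : topologicalType)
    (V W : normedModType (Cx R)) (A : set (chart M V)) (A' : set (chart N W)) :
    set (chart (M * N)%type (V * W)%type) :=
  [set c | exists a b, [/\ A a, A' b & c = prod_chart a b]].

(* For [D] open. *)
Definition holomorphic (R : realType) (M N : topologicalType)
    (V W : normedModType (Cx R)) (A : set (chart M V)) (A' : set (chart N W))
    (D : set M) (f : M -> N) : Prop :=
  forall x, D x -> {for x, continuous f} /\
    forall a b, A a -> A' b -> chart_dom a x -> chart_dom b (f x) ->
      differentiable (chart_map b \o f \o chart_inv a) (chart_map a x).

(* For [D] open. *)
Definition smooth_fun (R : realType) (M : topologicalType)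
    (V : normedModType (Cx R)) (A : set (chart M V))
    (D : set M) (f : M -> R) : Prop :=
  forall a, A a ->
    smooth (chart_map a @` (D `&` chart_dom a)) (f \o chart_inv a).

Definition smooth_Cfun (R : realType) (M : topologicalType)
    (V : normedModType (Cx R)) (A : set (chart M V))
    (D : set M) (f : M -> Cx R) : Prop :=
  smooth_fun A D (fun x => complex.Re (f x)) /\
  smooth_fun A D (fun x => complex.Im (f x)).

Definition smooth_map (R : realType) (M N : topologicalType)
    (V : normedModType (Cx R)) (m : nat)
    (A : set (chart M V)) (A' : set (chart N 'rV[Cx R]_m))
    (D : set M) (f : M -> N) : Prop :=
  (forall x, D x -> {for x, continuous f}) /\
  forall b, A' b -> forall j : 'I_m,
    smooth_Cfun A (D `&` f @^-1` chart_dom b)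
      (fun x => chart_map b (f x) 0 j).

Section Metrics.
Variables (R : realType) (m : nat) (X : topologicalType).
Local Notation V := 'rV[Cx R]_m.
Variable SX : complex_structure X V.

(* [g a x u v] is the value at [x] of the Riemannian metric on the tangent
   vectors with coordinates [u] and [v] in the chart [a]; it is only
   meaningful for [a] in the atlas and [x] in its domain. *)
Definition metric := chart X V -> X -> V -> V -> R.

Record hermitian_on (U : set X) (g : metric) : Prop := HermitianOn {
  herm_sym : forall a x, atlas SX a -> U x -> chart_dom a x ->
    forall u v, g a x u v = g a x v u;
  herm_linear : forall a x, atlas SX a -> U x -> chart_dom a x ->
    forall (k : R) u v w,
      g a x (((k%:C)%C : Cx R) *: u + v) w = k * g a x u w + g a x v w;
  herm_J : forall a x, atlas SX a -> U x -> chart_dom a x ->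
    forall u v, g a x (('i : Cx R) *: u) (('i : Cx R) *: v) = g a x u v;
  herm_pos : forall a x, atlas SX a -> U x -> chart_dom a x ->
    forall u, u != 0 -> 0 < g a x u u;
  herm_change : forall a b x, atlas SX a -> atlas SX b -> U x ->
    chart_dom a x -> chart_dom b x ->
    forall u v,
      g a x u v = g b x ('d (transition a b) (chart_map a x) u)
                        ('d (transition a b) (chart_map a x) v);
  herm_smooth : forall a, atlas SX a -> forall u v,
    smooth (chart_map a @` (U `&` chart_dom a))
           (fun z => g a (chart_inv a z) u v) }.

(* Local expression, in the chart [a], of Omega(u, v) = g(J u, v). *)
Definition fundamental_form (g : metric) (a : chart X V) (u v : V) (z : V) : R :=
  g a (chart_inv a z) (('i : Cx R) *: u) v.

(* The equation is d Omega (u, v, w) = 0 for u, v, w constant in the chart. *)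
Definition kahler_on (U : set X) (g : metric) : Prop :=
  hermitian_on U g /\
  forall a x, atlas SX a -> U x -> chart_dom a x -> forall u v w,
    dirderiv (fundamental_form g a v w) u (chart_map a x)
    + dirderiv (fundamental_form g a w u) v (chart_map a x)
    + dirderiv (fundamental_form g a u v) w (chart_map a x) = 0.

Definition lck_metric (g : metric) : Prop :=
  hermitian_on setT g /\
  forall x, exists (U : set X) (gU : metric) (f : X -> R),
    [/\ open U, U x, kahler_on U gU, smooth_fun SX U f &
        forall a y, atlas SX a -> U y -> chart_dom a y ->
          forall u v, g a y u v = expR (f y) * gU a y u v].

End Metrics.

(* A 1-dimensional complex Lie group E together with an identification of
   complex Lie groups E = C / Lambda, given by the projection [ec_proj] from C
   ([ec_local_inv]: E carries the quotient complex structure), and a Z-basis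
   [ec_w1], [ec_w2] of the lattice Lambda. *)
Record elliptic_curve (R : realType) := EllipticCurve {
  ec_sort :> topologicalZmodType;
  ec_str : complex_structure ec_sort (Cx R);
  ec_add_holo : holomorphic (prod_atlas ec_str ec_str) ec_str setT
                  (fun p : ec_sort * ec_sort => p.1 + p.2);
  ec_opp_holo : holomorphic ec_str ec_str setT (fun e : ec_sort => - e);
  ec_w1 : Cx R;
  ec_w2 : Cx R;
  ec_lattice : forall a b : R,
    ((a%:C)%C : Cx R) * ec_w1 + ((b%:C)%C : Cx R) * ec_w2 = 0 -> a = 0 /\ b = 0;
  ec_proj : Cx R -> ec_sort;
  ec_projD : forall z w, ec_proj (z + w) = ec_proj z + ec_proj w;
  ec_proj_surj : forall e, exists z, ec_proj z = e;
  ec_proj_ker : forall z, ec_proj z = 0 <->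
    exists p q : int, z = p%:~R * ec_w1 + q%:~R * ec_w2;
  ec_proj_holo : holomorphic (@model_atlas R (Cx R)) ec_str setT ec_proj;
  ec_local_inv : forall z, exists (W : set (Cx R)) (s : ec_sort -> Cx R),
    [/\ open W, W z, open (ec_proj @` W),
        forall w, W w -> s (ec_proj w) = w &
        holomorphic ec_str (@model_atlas R (Cx R)) (ec_proj @` W) s] }.

(* Local triviality: [t] is an E-equivariant biholomorphism from U x E onto
   the preimage of U, over U, with inverse [t']. *)
Record elliptic_bundle (R : realType) (m n : nat) (X B : topologicalType)
    (SX : complex_structure X 'rV[Cx R]_m)
    (SB : complex_structure B 'rV[Cx R]_n)
    (E : elliptic_curve R) := EllipticBundle {
  eb_proj : X -> B;
  eb_act : E -> X -> X;
  eb_proj_holo : holomorphic SX SB setT eb_proj;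
  eb_act_holo : holomorphic (prod_atlas (ec_str E) SX) SX setT
                  (fun p : E * X => eb_act p.1 p.2);
  eb_act0 : forall x, eb_act 0 x = x;
  eb_actD : forall e e' x, eb_act (e + e') x = eb_act e (eb_act e' x);
  eb_proj_act : forall e x, eb_proj (eb_act e x) = eb_proj x;
  eb_locally_trivial : forall b0, exists (U : set B) (t : B * E -> X)
      (t' : X -> B * E),
    [/\ open U /\ U b0,
        holomorphic (prod_atlas SB (ec_str E)) SX (U `*` setT) t,
        holomorphic SX (prod_atlas SB (ec_str E)) (eb_proj @^-1` U) t',
        (forall b e, U b -> eb_proj (t (b, e)) = b /\ t' (t (b, e)) = (b, e)) /\
        (forall x, U (eb_proj x) -> t (t' x) = x) &
        forall b e e', U b -> t (b, e + e') = eb_act e (t (b, e'))] }.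

Section SubQuotient.
Variables (K : nzRingType) (V : lmodType K) (Z S : submodClosed V).

Record submodule := Submodule {
  submodule_val :> V;
  submoduleP : submodule_val \in Z }.

HB.instance Definition _ := [isSub for submodule_val].
HB.instance Definition _ := [Choice of submodule by <:].
HB.instance Definition _ := [SubChoice_isSubLmodule of submodule by <:].

Definition submodule_pred : {pred submodule} := fun c => (c : V) \in S.

Lemma submodule_pred_closed : submod_closed submodule_pred.
Proof.
split; first exact: rpred0.
move=> a c c' hc hc'; rewrite unfold_in /=.
by rewrite rpredD // rpredZ.
Qed.

HB.instance Definition _ :=
  GRing.isSubmodClosed.Build K submodule submodule_pred submodule_pred_closed.

Definition subquot := Quotient.quot submodule_pred.
HB.instance Definition _ := Choice.on subquot.
HB.instance Definition _ := GRing.Zmodule.on subquot.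

Definition quot_class (c : submodule) : subquot := \pi_(Quotient.quot submodule_pred) c.

Definition quot_scale (a : K) (x : subquot) : subquot := quot_class (a *: repr x).

Lemma quot_classP c c' :
  (quot_class c == quot_class c') = ((c : V) - (c' : V) \in S).
Proof. by rewrite -Quotient.idealrBE. Qed.

Lemma quot_classK x : quot_class (repr x) = x.
Proof. exact: reprK. Qed.

Lemma quot_classD c c' : quot_class (c + c') = quot_class c + quot_class c'.
Proof. by rewrite /quot_class !piE. Qed.

Lemma quot_classZ a c : quot_class (a *: c) = quot_scale a (quot_class c).
Proof.
apply/eqP; rewrite quot_classP /= -scalerBr rpredZ //.
by rewrite -quot_classP quot_classK.
Qed.

Fact quot_scaleA a b x : quot_scale a (quot_scale b x) = quot_scale (a * b) x.
Proof. by rewrite -[x]quot_classK -!quot_classZ scalerA. Qed.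

Fact quot_scale1 : left_id 1 quot_scale.
Proof. by move=> x; rewrite -[x]quot_classK -!quot_classZ scale1r. Qed.

Fact quot_scaleDr : right_distributive quot_scale +%R.
Proof.
move=> a x y; rewrite -[x]quot_classK -[y]quot_classK.
by rewrite -quot_classD -!quot_classZ -quot_classD scalerDr.
Qed.

Fact quot_scaleDl x : {morph quot_scale^~ x : a b / a + b}.
Proof.
move=> a b; rewrite -[x]quot_classK.
by rewrite -!quot_classZ -quot_classD scalerDl.
Qed.

HB.instance Definition _ := GRing.Zmodule_isLmodule.Build K subquot
  quot_scaleA quot_scale1 quot_scaleDr quot_scaleDl.

End SubQuotient.

(* H^2(B, K) as Čech cohomology of the constant sheaf: the direct limit over
   open covers may be taken over the covers [(U x)_(x : B)] indexed by the
   points of B, with [x] in [U x], which are cofinal and whose refinement maps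
   are the identity on indices (Godement's construction).  A cochain is a
   family of functions [c i j k : B -> K], only meaningful on
   [U i `&` U j `&` U k] for a small enough cover [U]; the limit is the group
   of families that are cocycles for some cover modulo those that are
   coboundaries for some cover. *)

Definition point_cover (B : topologicalType) (U : B -> set B) : Prop :=
  forall x, open (U x) /\ U x x.

Definition locally_constant_on (B : topologicalType) (T : Type)
    (D : set B) (f : B -> T) : Prop :=
  forall y, D y -> \forall y' \near y, f y' = f y.

Section CechH2.
Variables (B : topologicalType) (K : comNzRingType).

Definition cochain2 : lmodType K := (B -> B -> B -> B -> K^o).

Definition cocycle_on (U : B -> set B) (c : cochain2) : Prop :=
  (forall i j k, locally_constant_on (U i `&` U j `&` U k) (c i j k)) /\
  (forall i j k l y, U i y -> U j y -> U k y -> U l y ->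
     c j k l y - c i k l y + c i j l y - c i j k y = 0).

Definition coboundary_on (U : B -> set B) (c : cochain2) : Prop :=
  exists h : B -> B -> B -> K,
    (forall i j, locally_constant_on (U i `&` U j) (h i j)) /\
    (forall i j k y, U i y -> U j y -> U k y ->
       c i j k y = h j k y - h i k y + h i j y).

Definition is_cocycle2 : {pred cochain2} :=
  fun c => `[< exists2 U, point_cover U & cocycle_on U c >].

Definition is_coboundary2 : {pred cochain2} :=
  fun c => `[< exists2 U, point_cover U & coboundary_on U c >].

Lemma point_coverI (U U' : B -> set B) : point_cover U -> point_cover U' ->
  point_cover (fun x => U x `&` U' x).
Proof.
move=> hU hU' x; have [oU Ux] := hU x; have [oU' U'x] := hU' x.
by split; [exact: openI | split].
Qed.

Fact cocycle_comb (a x1 x2 x3 x4 y1 y2 y3 y4 : K) :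
  x1 - x2 + x3 - x4 = 0 -> y1 - y2 + y3 - y4 = 0 ->
  (a * x1 + y1) - (a * x2 + y2) + (a * x3 + y3) - (a * x4 + y4) = 0.
Proof.
move=> ex ey; transitivity
  (a * (x1 - x2 + x3 - x4) + (y1 - y2 + y3 - y4)); first by ring.
by rewrite ex ey mulr0 addr0.
Qed.

Fact coboundary_comb (a x x1 x2 x3 y y1 y2 y3 : K) :
  x = x1 - x2 + x3 -> y = y1 - y2 + y3 ->
  a * x + y = (a * x1 + y1) - (a * x2 + y2) + (a * x3 + y3).
Proof. by move=> -> ->; ring. Qed.

Lemma is_cocycle2_submod : submod_closed is_cocycle2.
Proof.
split.
  apply/asboolP; exists (fun=> setT); first by move=> x; split; [exact: openT|].
  split; first by move=> i j k y _; exact: nearW.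
  by move=> i j k l y _ _ _ _; rewrite !subr0 addr0.
move=> a c c' /asboolP[U hU [lc dc]] /asboolP[U' hU' [lc' dc']].
apply/asboolP; exists (fun x => U x `&` U' x); first exact: point_coverI.
split=> [i j k y [[[Ui Ui'] [Uj Uj']] [Uk Uk']]|
         i j k l y [Ui Ui'] [Uj Uj'] [Uk Uk'] [Ul Ul']].
  have h1 := lc i j k y (conj (conj Ui Uj) Uk).
  have h2 := lc' i j k y (conj (conj Ui' Uj') Uk').
  apply: filterS2 h1 h2 => y' e1 e2.
  change (a * c i j k y' + c' i j k y' = a * c i j k y + c' i j k y).
  by rewrite e1 e2.
have e1 := dc i j k l y Ui Uj Uk Ul.
have e2 := dc' i j k l y Ui' Uj' Uk' Ul'.
exact: (cocycle_comb a e1 e2).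
Qed.

Lemma is_coboundary2_submod : submod_closed is_coboundary2.
Proof.
split.
  apply/asboolP; exists (fun=> setT); first by move=> x; split; [exact: openT|].
  exists (fun=> fun=> cst 0); split; first by move=> i j y _; exact: nearW.
  by move=> i j k y _ _ _; rewrite /= subrr addr0.
move=> a c c' /asboolP[U hU [h [lh dh]]] /asboolP[U' hU' [h' [lh' dh']]].
apply/asboolP; exists (fun x => U x `&` U' x); first exact: point_coverI.
exists (fun i j y => a * h i j y + h' i j y).
split=> [i j y [[Ui Ui'] [Uj Uj']]|i j k y [Ui Ui'] [Uj Uj'] [Uk Uk']].
  have h1 := lh i j y (conj Ui Uj); have h2 := lh' i j y (conj Ui' Uj').
  by apply: filterS2 h1 h2 => y' -> ->.
exact: (coboundary_comb a (dh i j k y Ui Uj Uk) (dh' i j k y Ui' Uj' Uk')).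
Qed.

HB.instance Definition _ :=
  GRing.isSubmodClosed.Build K cochain2 is_cocycle2 is_cocycle2_submod.
HB.instance Definition _ :=
  GRing.isSubmodClosed.Build K cochain2 is_coboundary2 is_coboundary2_submod.

Definition cocycle2 := submodule is_cocycle2.

Definition H2 : lmodType K := subquot is_cocycle2 is_coboundary2.

Definition H2_class (c : cocycle2) : H2 := quot_class is_coboundary2 c.

End CechH2.

Section Realification.
Variables (R : realType) (B : topologicalType).

Definition cochain2_real (c : cochain2 B int) : cochain2 B R :=
  fun i j k y => (c i j k y)%:~R.

Lemma cochain2_realP (c : cocycle2 B int) :
  cochain2_real (submodule_val c) \in @is_cocycle2 B R.
Proof.
have /asboolP[U hU [lc dc]] := submoduleP c.
apply/asboolP; exists U => //; split=> [i j k y Uy|i j k l y Ui Uj Uk Ul].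
  by apply: filterS (lc i j k y Uy) => y' e; rewrite /cochain2_real e.
have := congr1 (fun z : int => z%:~R : R) (dc i j k l y Ui Uj Uk Ul).
by rewrite rmorphB rmorphD rmorphB.
Qed.

Fact intr_coboundary (x x' x1 x2 x3 : int) : x - x' = x1 - x2 + x3 ->
  x%:~R - x'%:~R = x1%:~R - x2%:~R + x3%:~R :> R.
Proof. by move=> e; rewrite -!rmorphB -rmorphD e. Qed.

Definition cocycle2_real (c : cocycle2 B int) : cocycle2 B R :=
  Submodule (cochain2_realP c).

Definition H2_real (x : H2 B int) : H2 B R := H2_class (cocycle2_real (repr x)).

Lemma H2_real_class (c : cocycle2 B int) :
  H2_real (H2_class c) = H2_class (cocycle2_real c).
Proof.
apply/eqP; rewrite quot_classP.
have /eqP := quot_classK (H2_class c); rewrite quot_classP.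
move=> /asboolP[U hU [h [lh dh]]].
apply/asboolP; exists U => //; exists (fun i j y => (h i j y)%:~R).
split=> [i j y Uy|i j k y Ui Uj Uk].
  by apply: filterS (lh i j y Uy) => y' ->.
exact: (intr_coboundary (dh i j k y Ui Uj Uk)).
Qed.

End Realification.

Section ChernClasses.
Variables (R : realType) (m n : nat) (X B : topologicalType)
  (SX : complex_structure X 'rV[Cx R]_m)
  (SB : complex_structure B 'rV[Cx R]_n)
  (E : elliptic_curve R) (P : elliptic_bundle SX SB E).

(* The smooth local sections [s i] over [U i] trivialize the underlying smooth
   principal bundle; its class in H^1(B, C_B(E)) is that of the cocycle
   [g i j] defined by [s j = g i j . s i].  The maps [h i j] are smooth lifts
   to C of the [g i j], and the connecting homomorphism sends this class to
   that of the Čech coboundary of [h], which has values in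
   Lambda = Z w1 + Z w2; [c1] and [c2] are its two components. *)
Definition chern_classes (c1 c2 : H2 B int) : Prop :=
  exists (U : B -> set B) (s : B -> B -> X) (h : B -> B -> B -> Cx R)
    (z1 z2 : cocycle2 B int),
    [/\ point_cover U,
        (forall i, smooth_map SB SX (U i) (s i) /\
           forall b, U i b -> eb_proj P (s i b) = b),
        (forall i j, smooth_Cfun SB (U i `&` U j) (h i j) /\
           forall b, U i b -> U j b ->
             s j b = eb_act P (ec_proj E (h i j b)) (s i b)),
        (forall i j k b, U i b -> U j b -> U k b ->
           h j k b - h i k b + h i j b =
             (submodule_val z1 i j k b)%:~R * ec_w1 E
             + (submodule_val z2 i j k b)%:~R * ec_w2 E) &
        c1 = H2_class z1 /\ c2 = H2_class z2].

End ChernClasses.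

Definition linearly_independent2 (K : nzRingType) (V : lmodType K) (x y : V) :
  Prop := forall a b : K, a *: x + b *: y = 0 -> a = 0 /\ b = 0.

(* Main.v *)
(** Let phi_i : D_i * C -> X be (w, z) |-> z . s_i(w), where s_i is a smooth
    section over a ball D_i of B and C acts through E = C / (Z w1 + Z w2).  On the
    simply connected D_i * C the LCK structure has a global potential F_i, so that
    e^(-F_i) phi_i^* Omega is closed.  Potentials are unique up to constants (this
    needs dim X >= 2), so F_i(w, z + w_k) = F_i(w, z) + a_k with a_k independent of
    i and w, as B is connected.  The bounded functions F_i - lambda, where
    lambda : C -> R is real linear with lambda(w_k) = a_k, have fibrewise suprema
    u_i on B, and their transition rule exhibits a_1 c_1' + a_2 c_1'' as a Cech
    coboundary: hence a_1 = a_2 = 0, i.e. the Lee form is exact on the fibres.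
    Integrating the now biperiodic closed form e^(-F_i) phi_i^* Omega over the
    w1-cycle of the fibre gives a closed 1-form dA_i, where A_i has periods 0 along
    w1 and C_i <> 0 along w2, by positivity of Omega on complex lines.  The same
    argument applied to A_i / C_i shows c_1'' = 0. *)

Require Import Defs.
From mathcomp Require Import all_boot all_order all_algebra.
From mathcomp Require Import all_classical all_reals all_analysis.
From mathcomp Require Import complex ring lra zify.
Import Order.TTheory GRing.Theory Num.Theory numFieldNormedType.Exports.
Local Open Scope classical_set_scope.
Local Open Scope ring_scope.

Set Implicit Arguments.
Unset Strict Implicit.
Unset Printing Implicit Defensive.

(** The suprema u_i have no known regularity on B. They cancel pointwise in the alternating sum, so
    the coboundary is carried by the locally constant functions K_ij = F_j(w, z) - F_i(w, z + h_ij);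
    a supremum over the fibre thus does the work of fibre averages and partitions of unity. In the
    second half the forms change by the factor e^(-K_ij) from patch to patch, and dividing A_i by
    its own period C_i removes that factor. Two obstacles shape the analysis. The sections are
    merely smooth, so phi_i is holomorphic only along the fibres: uniqueness of potentials has to be
    proved in the charts of X and pulled back. And holomorphy is given as bare complex
    differentiability, while the pullback of closed forms takes two continuous real derivatives;
    hence Goursat and Cauchy. Positivity on the fibres requires immersed orbits. A stationary orbit
    is constant, and Liouville's theorem shows that the fixed points of the action form an open set,
    which connectedness of X then excludes. The second tangent direction of X comes from B, so a
    base of dimension 0 is treated apart. *)

Lemma for_continuous_pair (T U V : topologicalType) (f : T -> U) (g : T -> V) (x : T) :
  {for x, continuous f} -> {for x, continuous g} ->
  {for x, continuous (fun t => (f t, g t))}.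
Proof. by move=> cf cg; exact: cvg_pair cf cg. Qed.

Lemma for_continuous_comp (T U V : topologicalType) (f : T -> U) (g : U -> V) (x : T) :
  {for x, continuous f} -> {for f x, continuous g} ->
  {for x, continuous (fun t => g (f t))}.
Proof. exact: continuous_comp. Qed.

(** * Integrals over the unit interval *)

Section UnitIntervalIntegral.
Context {R : realType}.
Implicit Types (f g F : R -> R) (a b t : R).

Local Notation mu := (@lebesgue_measure R).

Definition I01 f : R := \int[mu]_(t in `[0, 1]) f t.

(** Continuity is two-sided even at 0 and 1, so that no subspace topology intervenes in
    compositions; the integrands below are continuous across the end points. *)
Definition cont01 f := forall t, 0 <= t <= 1 -> {for t, continuous f}.

Lemma within_continuous_itv f a b :
  (forall t, a <= t <= b -> {for t, continuous f}) ->
  {within `[a, b], continuous f}.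
Proof.
move=> cf; apply: continuous_in_subspaceT => t.
by rewrite inE /= in_itv /= => /cf.
Qed.

Lemma cont01_integrable f : cont01 f -> mu.-integrable `[0, 1] (EFin \o f).
Proof.
move=> cf; apply: continuous_compact_integrable; first exact: segment_compact.
exact: within_continuous_itv.
Qed.

Let m01 : measurable (`[0, 1] : set R). Proof. exact: measurable_itv. Qed.

Lemma eq_I01 f g : (forall t, 0 <= t <= 1 -> f t = g t) -> I01 f = I01 g.
Proof. by move=> fg; apply: eq_Rintegral => t; rewrite inE /= in_itv /= => /fg. Qed.

Lemma I01D f g : cont01 f -> cont01 g -> I01 (fun t => f t + g t) = I01 f + I01 g.
Proof.
by move=> cf cg; rewrite /I01 RintegralD//; apply: cont01_integrable.
Qed.

Lemma I01Z k f : cont01 f -> I01 (fun t => k * f t) = k * I01 f.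
Proof. by move=> cf; rewrite /I01 RintegralZl//; apply: cont01_integrable. Qed.

Lemma I01B f g : cont01 f -> cont01 g -> I01 (fun t => f t - g t) = I01 f - I01 g.
Proof.
by move=> cf cg; rewrite /I01 RintegralB//; apply: cont01_integrable.
Qed.

Lemma cont01_cst k : cont01 (fun=> k).
Proof. by move=> t _; exact: cvg_cst. Qed.

Lemma is_derive_continuous f df t : is_derive t (1 : R) f df -> {for t, continuous f}.
Proof.
move=> h; apply/differentiable_continuous/derivable1_diffP.
exact: (@ex_derive _ _ _ _ _ _ _ h).
Qed.

Lemma I01_FTC f F : cont01 f -> (forall t, 0 <= t <= 1 -> is_derive t (1 : R) F (f t)) ->
  I01 f = F 1 - F 0.
Proof.
move=> cf dF; rewrite /I01 /Rintegral.
have := @continuous_FTC2 R f F 0 1 ltr01 (within_continuous_itv cf).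
move=> -> //.
- have cF t : 0 <= t <= 1 -> {for t, continuous F}.
    by move=> t01; apply: is_derive_continuous (dF t t01).
  split.
  + move=> t; rewrite in_itv /= => /andP[t0 t1].
    have /dF h : 0 <= t <= 1 by rewrite !ltW.
    exact: ex_derive.
  + apply: cvg_at_right_filter; apply: cF; lra.
  + apply: cvg_at_left_filter; apply: cF; lra.
- move=> t; rewrite in_itv /= => /andP[t0 t1].
  have /dF h : 0 <= t <= 1 by rewrite !ltW.
  by rewrite derive1E derive_val.
Qed.

Lemma I01_cst k : I01 (fun=> k) = k.
Proof.
have dF t : 0 <= t <= 1 -> is_derive t (1 : R) (fun t => k * t) k.
  by move=> _; apply: is_derive_eq; rewrite /GRing.scale /= mulr1 ?mulr0 ?addr0.
by rewrite (I01_FTC (@cont01_cst k) dF) mulr1 mulr0 subr0.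
Qed.

Lemma I01_le f g : cont01 f -> cont01 g ->
  (forall t, 0 <= t <= 1 -> f t <= g t) -> I01 f <= I01 g.
Proof.
move=> cf cg fg; apply: le_Rintegral => //; try exact: cont01_integrable.
Qed.

Lemma I01_norm f M : cont01 f -> (forall t, 0 <= t <= 1 -> `|f t| <= M) ->
  `|I01 f| <= M.
Proof.
move=> cf fM; rewrite ler_norml -[in X in X && _](I01_cst M) -[in X in _ && X](I01_cst M).
apply/andP; split; last first.
  apply: I01_le => //; first exact: cont01_cst.
  by move=> t t01; have := fM t t01; rewrite ler_norml => /andP[].
rewrite -[leLHS]mulN1r -I01Z; last exact: cont01_cst.
apply: I01_le => //; first exact: cont01_cst.
by move=> t t01; have := fM t t01; rewrite ler_norml mulN1r => /andP[].
Qed.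

Lemma I01_gt0 f : cont01 f -> (forall t, 0 <= t <= 1 -> 0 < f t) -> 0 < I01 f.
Proof.
move=> cf f0.
have [c c01 cm] := EVT_min ler01 (within_continuous_itv cf).
have c01' : 0 <= c <= 1 by move: c01; rewrite in_itv.
apply: (lt_le_trans (f0 c c01')).
rewrite -[leLHS]I01_cst; by apply: I01_le => //; exact: cont01_cst.
Qed.

(** Extending f by constants outside [a, b] and integrating from a - 1 makes the derivative
    two-sided at a and b as well. *)
Lemma antiderivative f a b : a < b ->
  (forall t, a <= t <= b -> {for t, continuous f}) ->
  exists F, forall t, a <= t <= b -> is_derive t (1 : R) F (f t).
Proof.
move=> ab cf; pose g t := f (Num.max a (Num.min b t)).
have cg t : {for t, continuous g}.
  have m : a <= Num.max a (Num.min b t) <= b.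
    by rewrite le_max lexx /= ge_max (ltW ab) ge_min lexx.
  apply: (@continuous_comp _ _ _ (fun t => Num.max a (Num.min b t)) f); last exact: cf.
  apply: (@continuous_max _ R^o (cst a) (fun t => Num.min b t)) => //.
    exact: cvg_cst.
  apply: (@continuous_min _ R^o (cst b) id) => //.
  exact: cvg_cst.
have ig : mu.-integrable `[a - 1, b + 1] (EFin \o g).
  apply: continuous_compact_integrable; first exact: segment_compact.
  by apply: within_continuous_itv => t _; exact: cg.
exists (fun x => \int[mu]_(t in [set` `[a - 1, x]]) (g t)) => t /andP[at_ tb].
have tb1 : t < b + 1 by rewrite (le_lt_trans tb)// ltrDl.
have ta1 : a - 1 < t by rewrite (lt_le_trans _ at_)// gtrDl ltrN10.
have [d e] := @continuous_FTC1_closed R g (a - 1) t (b + 1) tb1 ig ta1 (cg t).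
have -> : f t = g t by rewrite /g; congr f; rewrite (min_idPr tb) (max_idPr at_).
by apply: DeriveDef; [exact: d|rewrite -derive1E; exact: e].
Qed.

(** Joint continuity along the compact segment over p becomes uniform in t; this replaces uniform
    continuity and dominated convergence below. *)
Lemma I01_tube (T : topologicalType) (h : T -> R -> R) (p : T) (e : R) : 0 < e ->
  (forall t, 0 <= t <= 1 -> {for (p, t), continuous (fun z : T * R => h z.1 z.2)}) ->
  \forall q \near p, forall t, 0 <= t <= 1 -> `|h q t - h p t| <= e.
Proof.
move=> e0 hc.
have /compact_near_coveringP/(_ T (nbhs p) (fun q t => `|h q t - h p t| <= e) _) :=
  @segment_compact R 0 1.
move=> H; have {H} : \forall q \near p, `[0, 1] `<=` (fun t => `|h q t - h p t| <= e).
  apply: H => t; rewrite /= in_itv /= => t01.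
  have e20 : 0 < e / 2 by rewrite divr_gt0.
  have /cvgrPdist_lt /(_ _ e20) [[A B] /= [Ap Bt] AB] := hc t t01.
  exists (B, A) => //= -[t' q] /= [Bt' Aq].
  have h1 := AB (q, t') (conj Aq Bt').
  have h2 := AB (p, t') (conj (nbhs_singleton Ap) Bt').
  rewrite /= in h1 h2.
  have -> : h q t' - h p t' = (h p t - h p t') - (h p t - h q t') by ring.
  by rewrite (le_trans (ler_normB _ _))// [e]splitr lerD// ltW.
by apply: filterS => q H t t01; apply: H; rewrite /= in_itv.
Qed.

Lemma I01_continuous (T : topologicalType) (h : T -> R -> R) (p : T) :
  (\forall q \near p, cont01 (h q)) ->
  (forall t, 0 <= t <= 1 -> {for (p, t), continuous (fun z : T * R => h z.1 z.2)}) ->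
  {for p, continuous (fun q => I01 (h q))}.
Proof.
move=> hq hc; apply/cvgrPdist_le => e e0.
have hp := nbhs_singleton hq.
apply: filterS2 hq (I01_tube e0 hc) => q cq Hq.
rewrite -I01B//; apply: I01_norm.
  by move=> t t01; apply: cvgB; [exact: hp|exact: cq].
by move=> t t01; rewrite distrC; exact: Hq.
Qed.

(** Clearing the denominator makes h = 0 harmless: derivatives are then handled with full
    neighbourhoods of 0, and estimates can be transported by plain rewriting. *)
Lemma is_derive_quotP (f : R -> R) (x l : R) :
  is_derive x (1 : R) f l <->
  (forall e, 0 < e -> \forall h \near (0 : R), `|f (x + h) - f x - h * l| <= e * `|h|).
Proof.
split=> [[df fl] e e0|H].
  have := df; rewrite /derivable -/(derive f x 1) fl => /cvgrPdist_le/(_ e e0).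
  move=> W; have {}W : \forall h \near 0^', `|l - h^-1 *: (f (h *: 1 + x) - f x)| <= e by [].
  move: W; rewrite near_withinE; apply: filterS => h H.
  have [->|h0] := eqVneq h 0; first by rewrite addr0 subrr mul0r subr0 normr0 mulr0.
  have := H h0; rewrite /= -[h *: 1]/(h * 1) mulr1 => H1.
  rewrite -ler_pdivrMr ?normr_gt0// -normfV -normrM -normrN.
  suff -> : - ((f (x + h) - f x - h * l) / h) = l - h^-1 *: (f (h + x) - f x) by [].
  by rewrite -[_ *: _]/(_ * _) [h + x]addrC; field.
have cv : h^-1 *: ((f \o shift x) (h *: 1) - f x) @[h --> 0^'] --> l.
  apply/cvgrPdist_le => e e0.
  near=> h; have h0 : h != 0 by near: h; exact: nbhs_dnbhs_neq.
  rewrite /= -[h *: 1]/(h * 1) mulr1.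
  have -> : l - h^-1 *: (f (h + x) - f x) = - ((f (x + h) - f x - h * l) / h).
    by rewrite -[_ *: _]/(_ * _) [h + x]addrC; field.
  rewrite normrN normrM normfV ler_pdivrMr ?normr_gt0//.
  by near: h; apply: nbhs_dnbhs; exact: H.
split; first by apply/cvg_ex; exists l.
exact: cvg_lim cv.
Unshelve. all: by end_near. Qed.

Lemma MVT_between (f df : R -> R) (x h : R) :
  (forall y, `|y - x| <= `|h| -> is_derive y (1 : R) f (df y)) ->
  exists2 c, `|c - x| <= `|h| & f (x + h) - f x = df c * h.
Proof.
move=> dF; have [h0|h0] := leP 0 h.
  have xh : x <= x + h by rewrite lerDl.
  have B y : x <= y <= x + h -> `|y - x| <= `|h|.
    by move=> ?; rewrite (ger0_norm h0) ger0_norm; lra.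
  have [||c] := @MVT_segment R f df x (x + h) xh.
  - by move=> y; rewrite in_itv /= => ?; apply: dF; apply: B; lra.
  - by apply: within_continuous_itv => y ?; apply: is_derive_continuous (dF y _); apply: B.
  rewrite in_itv /= => cx e; exists c; first exact: B.
  by rewrite e; congr (_ * _); ring.
have xh : x + h <= x by rewrite gerDl ltW.
have B y : x + h <= y <= x -> `|y - x| <= `|h|.
  by move=> ?; rewrite (ltr0_norm h0) ler0_norm; lra.
have [||c] := @MVT_segment R f df (x + h) x xh.
- by move=> y; rewrite in_itv /= => ?; apply: dF; apply: B; lra.
- by apply: within_continuous_itv => y ?; apply: is_derive_continuous (dF y _); apply: B.
rewrite in_itv /= => cx e; exists c; first exact: B.
by rewrite -opprB e; ring.
Qed.

(** The mean value theorem turns the increment in s into a value of f1 at an intermediate parameter,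
    which the tube estimate compares with f1 s0 uniformly in t. *)
Lemma I01_derive (f f1 : R -> R -> R) (s0 : R) :
  (\forall s \near s0, cont01 (f s)) ->
  (\forall s \near s0, forall t, 0 <= t <= 1 -> is_derive s (1 : R) (fun s => f s t) (f1 s t)) ->
  (forall t, 0 <= t <= 1 -> {for (s0, t), continuous (fun z : R * R => f1 z.1 z.2)}) ->
  is_derive s0 (1 : R) (fun s => I01 (f s)) (I01 (f1 s0)).
Proof.
move=> cf df cf1; apply/is_derive_quotP => e e0.
have cf1s0 : cont01 (f1 s0).
  move=> t t01; have h := cf1 t t01.
  apply: (@continuous_comp _ _ _ (fun t => (s0, t)) (fun z : R * R => f1 z.1 z.2)) => //.
  by apply: for_continuous_pair; [exact: cvg_cst|exact: cvg_id].
have cfs0 := nbhs_singleton cf.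
have := filterI (filterI cf df) (I01_tube e0 cf1).
move=> /(_ _ _)/nbhs_ballP[d /= d0 dH].
apply/nbhs_ballP; exists d => //= h; rewrite /ball /= sub0r normrN => hd.
have Bd s : `|s - s0| <= `|h| -> ball s0 d s.
  by move=> sh; rewrite /ball /= distrC (le_lt_trans sh).
have /dH [[cfh _] _] : ball s0 d (s0 + h) by apply: Bd; rewrite addrAC subrr add0r.
have -> : I01 (f (s0 + h)) - I01 (f s0) - h * I01 (f1 s0) =
    I01 (fun t => f (s0 + h) t - f s0 t - h * f1 s0 t).
  rewrite I01B ?I01B ?I01Z//.
    by move=> t t01; apply: cvgB; [exact: cfh|exact: cfs0].
  by move=> t t01; apply: cvgM; [exact: cvg_cst|exact: cf1s0].
apply: I01_norm.
  move=> t t01; apply: cvgB; last by apply: cvgM; [exact: cvg_cst|exact: cf1s0].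
  by apply: cvgB; [exact: cfh|exact: cfs0].
move=> t t01.
have [|c cs ->] := @MVT_between (fun s => f s t) (fun s => f1 s t) s0 h.
  by move=> y /Bd /dH [[_ +] _]; exact.
rewrite mulrC -mulrBr normrM mulrC ler_wpM2r//.
by have /dH [_] := Bd c cs; exact.
Qed.

End UnitIntervalIntegral.

(** * Real scalars, real parts and imaginary parts in [Cx R] *)

Section ComplexScalars.
Context {R : realType}.
Implicit Types (z w : Cx R) (t : R).

Definition rc t : Cx R := (t%:C)%C.
Definition cre z : R := complex.Re z.
Definition cim z : R := complex.Im z.
Definition mkC (x y : R) : Cx R := (x +i* y)%C.

Lemma rcD s t : rc (s + t) = rc s + rc t.
Proof. exact: rmorphD. Qed.
Lemma rcN t : rc (- t) = - rc t.
Proof. exact: rmorphN. Qed.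
Lemma rcM s t : rc (s * t) = rc s * rc t.
Proof. exact: rmorphM. Qed.
Lemma rc0 : rc 0 = 0. Proof. by []. Qed.
Lemma rc1 : rc 1 = 1. Proof. by []. Qed.

Lemma creD z w : cre (z + w) = cre z + cre w. Proof. by case: z; case: w. Qed.
Lemma cimD z w : cim (z + w) = cim z + cim w. Proof. by case: z; case: w. Qed.
Lemma creN z : cre (- z) = - cre z. Proof. by case: z. Qed.
Lemma cimN z : cim (- z) = - cim z. Proof. by case: z. Qed.
Lemma creM z w : cre (z * w) = cre z * cre w - cim z * cim w.
Proof. by case: z; case: w. Qed.
Lemma cimM z w : cim (z * w) = cre z * cim w + cim z * cre w.
Proof. by case: z => a b; case: w => c d; rewrite /= addrC [b * c]mulrC addrC mulrC. Qed.
Lemma cre_rc t : cre (rc t) = t. Proof. by []. Qed.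
Lemma cim_rc t : cim (rc t) = 0. Proof. by []. Qed.
Lemma creZ t z : cre (rc t * z) = t * cre z.
Proof. by rewrite creM cim_rc mul0r subr0. Qed.
Lemma cimZ t z : cim (rc t * z) = t * cim z.
Proof. by rewrite cimM cim_rc mul0r addr0. Qed.
Lemma Cx_eqP z w : cre z = cre w -> cim z = cim w -> z = w.
Proof. by case: z; case: w => a b c d /= -> ->. Qed.
Lemma cre_i : cre 'i = 0.
Proof. by []. Qed.
Lemma cim_i : cim 'i = 1.
Proof. by []. Qed.
Lemma CxE z : z = rc (cre z) + rc (cim z) * 'i.
Proof.
by apply: Cx_eqP; rewrite ?creD ?cimD ?creZ ?cimZ ?cre_i ?cim_i ?cre_rc ?cim_rc; ring.
Qed.

Lemma norm_rc t : `|rc t| = rc `|t|.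
Proof. by rewrite /rc normc_def /= expr0n addr0 sqrtr_sqr. Qed.

Lemma le_rc s t : (rc s <= rc t) = (s <= t).
Proof. exact: lecR. Qed.
Lemma lt_rc s t : (rc s < rc t) = (s < t).
Proof. exact: ltcR. Qed.

Lemma norm_cre z : rc `|cre z| <= `|z|.
Proof. exact: normc_ge_Re. Qed.
Lemma norm_cim z : rc `|cim z| <= `|z|.
Proof.
have -> : cim z = - cre ('i * z) by rewrite creM cre_i cim_i; ring.
rewrite normrN (le_trans (norm_cre _))// normrM.
by rewrite -[leRHS]mul1r ler_wpM2r// normCi.
Qed.

Lemma gt0_rc (e : Cx R) : 0 < e -> exists2 d, 0 < d & e = rc d.
Proof.
by case: e => a b; rewrite ltcE /= => /andP[/eqP -> a0]; exists a.
Qed.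

Lemma rc_continuous : continuous (rc : R -> Cx R).
Proof.
move=> t; apply/cvgrPdist_lt => e /gt0_rc[d d0 ->].
have : \forall s \near t, `|t - s| < d.
  by apply/nbhs_ballP; exists d.
by apply: filterS => s h; rewrite -rcN -rcD norm_rc lt_rc.
Qed.

Lemma cre_continuous : continuous (cre : Cx R -> R).
Proof.
move=> z; have FF : Filter (nbhs (z : Cx R)) := nbhs_filter z.
apply/(@cvgrPdist_lt R R^o _ _ FF) => e e0.
have : \forall w \near z, `|z - w| < rc e.
  by apply/nbhs_ballP; exists (rc e) => //=; rewrite -rc0 lt_rc.
apply: filterS => w h; rewrite -creN -creD -lt_rc.
exact: le_lt_trans (norm_cre _) h.
Qed.

Lemma cim_continuous : continuous (cim : Cx R -> R).
Proof.
move=> z; have FF : Filter (nbhs (z : Cx R)) := nbhs_filter z.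
apply/(@cvgrPdist_lt R R^o _ _ FF) => e e0.
have : \forall w \near z, `|z - w| < rc e.
  by apply/nbhs_ballP; exists (rc e) => //=; rewrite -rc0 lt_rc.
apply: filterS => w h; rewrite -cimN -cimD -lt_rc.
exact: le_lt_trans (norm_cim _) h.
Qed.

End ComplexScalars.

(** * Real calculus on complex normed spaces *)

Section Frames.
Context {R : realType}.

(* Real coordinates of a complex normed space; they turn the chain rule and the
   pullback of forms into finite sums. *)
Record frame (V : normedModType (Cx R)) := Frame {
  fr_I : finType;
  fr_E : fr_I -> V;
  fr_e : fr_I -> V -> R;
  fr_eD : forall k u v, fr_e k (u + v) = fr_e k u + fr_e k v;
  fr_eZ : forall k (t : R) v, fr_e k (rc t *: v) = t * fr_e k v;
  fr_ec : forall k, continuous (fr_e k);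
  fr_sum : forall v, v = \sum_k rc (fr_e k v) *: fr_E k }.

(** Transparent, like the two frames below: later proofs compute with the indices and coordinates,
    [true] standing for the real part. *)
Definition Cx_frame : frame (Cx R).
Proof.
refine (@Frame (Cx R) bool (fun b => if b then 1 else 'i)
  (fun b => if b then cre else cim) _ _ _ _).
- by move=> [] u v; [exact: creD|exact: cimD].
- by move=> [] t v; [exact: creZ|exact: cimZ].
- by move=> []; [exact: cre_continuous|exact: cim_continuous].
- by move=> v; rewrite big_bool /= [LHS]CxE -[X in _ = X + _]/(rc (cre v) * 1) mulr1.
Defined.

Definition prod_frame (V W : normedModType (Cx R)) (a : frame V) (b : frame W) :
  frame (V * W)%type.
Proof.
refine (@Frame (V * W)%type (fr_I a + fr_I b)%type
  (fun k => match k with inl i => (fr_E i, 0) | inr j => (0, fr_E j) end)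
  (fun k v => match k with inl i => fr_e i v.1 | inr j => fr_e j v.2 end) _ _ _ _).
- by move=> [i|j] u v; rewrite fr_eD.
- by move=> [i|j] t v; rewrite fr_eZ.
- move=> [i|j] v.
    by apply: (@for_continuous_comp _ _ _ fst (@fr_e _ a i)); [exact: cvg_fst|exact: fr_ec].
  by apply: (@for_continuous_comp _ _ _ snd (@fr_e _ b j)); [exact: cvg_snd|exact: fr_ec].
- move=> [u v]; rewrite big_sumType /=.
  rewrite [LHS](_ : _ = (u, 0) + (0, v)); last by rewrite -pairD addr0 add0r || (congr pair; rewrite ?addr0 ?add0r).
  congr (_ + _).
    rewrite {1}(fr_sum a u); elim/big_ind2 : _ => // [x y z t <- <-|i _].
      by congr pair; rewrite /= addr0.
    by congr pair; rewrite /= scaler0.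
  rewrite {1}(fr_sum b v); elim/big_ind2 : _ => // [x y z t <- <-|i _].
    by congr pair; rewrite /= addr0.
  by congr pair; rewrite /= scaler0.
Defined.

Lemma rV_coord_continuous (m : nat) (j : 'I_m) : continuous (fun v : 'rV[Cx R]_m => v 0 j).
Proof. by move=> v; exact: coord_continuous. Qed.

Definition rV_frame (m : nat) : frame 'rV[Cx R]_m.
Proof.
refine (@Frame 'rV[Cx R]_m ('I_m * bool)%type
  (fun k => (if k.2 then 1 else 'i) *: delta_mx 0 k.1)
  (fun k v => (if k.2 then cre else cim) (v 0 k.1)) _ _ _ _).
- by move=> [j []] u v; rewrite /= mxE ?creD ?cimD.
- by move=> [j []] t v; rewrite /= mxE ?creZ ?cimZ.
- move=> [j []] v /=.
    by apply: (@for_continuous_comp _ _ _ (fun v : 'rV[Cx R]_m => v 0 j) cre);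
      [exact: rV_coord_continuous|exact: cre_continuous].
  by apply: (@for_continuous_comp _ _ _ (fun v : 'rV[Cx R]_m => v 0 j) cim);
      [exact: rV_coord_continuous|exact: cim_continuous].
- move=> v; rewrite {1}(row_sum_delta v).
  rewrite -(pair_bigA _ (fun j b => rc ((if b then cre else cim) (v 0 j)) *:
     ((if b then 1 else 'i) *: delta_mx 0 j))) /=.
  apply: eq_bigr => j _; rewrite big_bool /= !scalerA mulr1 -scalerDl.
  by rewrite -CxE.
Defined.

End Frames.

Section Continuity.
Context {R : realType} {V : normedModType (Cx R)} {T : topologicalType}.
Implicit Types (x : T).

Lemma for_continuousD (f g : T -> V) x : {for x, continuous f} ->
  {for x, continuous g} -> {for x, continuous (fun t => f t + g t)}.
Proof. by move=> cf cg; exact: cvgD. Qed.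

Lemma for_continuous_rcZ (f : T -> R) (g : T -> V) x : {for x, continuous f} ->
  {for x, continuous g} -> {for x, continuous (fun t => rc (f t) *: g t)}.
Proof.
move=> cf cg; apply: (@cvgZ _ _ _ _ _ (fun t => rc (f t)) g) => //.
by apply: (@for_continuous_comp _ _ _ f rc) => //; exact: rc_continuous.
Qed.

Lemma for_continuous_cst (U : topologicalType) (v : U) x : {for x, continuous (fun _ : T => v)}.
Proof. exact: cvg_cst. Qed.

Lemma for_continuous_sum (I : Type) (r : seq I) (F : I -> T -> V) x :
  (forall k, {for x, continuous (F k)}) ->
  {for x, continuous (fun t => \sum_(k <- r) F k t)}.
Proof.
move=> cF; elim: r => [|k r IH].
  rewrite (_ : (fun t => _) = fun=> 0); first exact: for_continuous_cst.
  by apply/funext => t; rewrite big_nil.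
rewrite (_ : (fun t => _) = fun t => F k t + \sum_(j <- r) F j t).
  exact: for_continuousD.
by apply/funext => t; rewrite big_cons.
Qed.

Lemma for_continuousDR (f g : T -> R) x : {for x, continuous f} ->
  {for x, continuous g} -> {for x, continuous (fun t => f t + g t)}.
Proof. by move=> cf cg; exact: cvgD. Qed.

Lemma for_continuousMR (f g : T -> R) x : {for x, continuous f} ->
  {for x, continuous g} -> {for x, continuous (fun t => f t * g t)}.
Proof. by move=> cf cg; exact: cvgM. Qed.

Lemma for_continuousNR (f : T -> R) x : {for x, continuous f} ->
  {for x, continuous (fun t => - f t)}.
Proof. by move=> cf; exact: cvgN. Qed.

Lemma for_continuous_sumR (I : Type) (r : seq I) (F : I -> T -> R) x :
  (forall k, {for x, continuous (F k)}) ->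
  {for x, continuous (fun t => \sum_(k <- r) F k t)}.
Proof.
move=> cF; elim: r => [|k r IH].
  rewrite (_ : (fun t => _) = fun=> 0); first exact: for_continuous_cst.
  by apply/funext => t; rewrite big_nil.
rewrite (_ : (fun t => _) = fun t => F k t + \sum_(j <- r) F j t).
  exact: for_continuousDR.
by apply/funext => t; rewrite big_cons.
Qed.

Lemma for_continuous_fst (U W : topologicalType) (p : U * W) : {for p, continuous fst}.
Proof. exact: cvg_fst. Qed.

Lemma for_continuous_snd (U W : topologicalType) (p : U * W) : {for p, continuous snd}.
Proof. exact: cvg_snd. Qed.

End Continuity.

Lemma fr_e0 (R : realType) (V : normedModType (Cx R)) (fr : frame V) k : fr_e (f:=fr) k 0 = 0.
Proof. by rewrite -(scale0r 0) -rc0 fr_eZ mul0r. Qed.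

Lemma fr_eN (R : realType) (V : normedModType (Cx R)) (fr : frame V) k v :
  fr_e (f:=fr) k (- v) = - fr_e k v.
Proof. by rewrite -scaleN1r -rc1 -rcN fr_eZ mulN1r. Qed.

Lemma fr_eB (R : realType) (V : normedModType (Cx R)) (fr : frame V) k u v :
  fr_e (f:=fr) k (u - v) = fr_e k u - fr_e k v.
Proof. by rewrite fr_eD fr_eN. Qed.

Section Calculus.
Context {R : realType} {V : normedModType (Cx R)}.
Implicit Types (f g : V -> R) (p q u v w : V) (s t h : R).

Lemma line_continuous p v : continuous (fun t : R => p + rc t *: v).
Proof.
move=> t; apply: cvgD; first exact: cvg_cst.
by apply: cvgZ; [exact: rc_continuous|exact: cvg_cst].
Qed.

(** [dirderiv] has a value even where no derivative exists; this predicate records existence and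
    value together. *)
Definition has_dir f v p (l : R) := is_derive (0 : R) (1 : R) (f \o real_line p v) l.

Lemma real_line0 p v : real_line p v 0 = p.
Proof. by rewrite /real_line -/(rc 0) rc0 scale0r addr0. Qed.

Lemma has_dirP f v p l : has_dir f v p l <->
  (forall e, 0 < e -> \forall h \near (0 : R),
     `|f (p + rc h *: v) - f p - h * l| <= e * `|h|).
Proof.
split.
  move=> /is_derive_quotP H e e0; move: (H e e0); apply: filterS => h.
  by rewrite add0r /= real_line0.
move=> H; apply/is_derive_quotP => e e0; move: (H e e0); apply: filterS => h.
by rewrite add0r /= real_line0.
Qed.

Lemma has_dirE f v p l : has_dir f v p l -> dirderiv f v p = l.
Proof. by move=> [_ <-]; rewrite /dirderiv derive1E. Qed.

Lemma derivable_has_dir f v p : derivable (f \o real_line p v) 0 1 ->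
  has_dir f v p (dirderiv f v p).
Proof. by move=> d; apply: DeriveDef => //; rewrite /dirderiv derive1E. Qed.

Lemma has_dir_derivable f v p l : has_dir f v p l -> derivable (f \o real_line p v) 0 1.
Proof. by case. Qed.

Lemma has_dir_line f v p t l :
  has_dir f v (p + rc t *: v) l <-> is_derive t (1 : R) (fun s => f (p + rc s *: v)) l.
Proof.
split=> H.
  apply/is_derive_quotP => e e0; move/has_dirP: H => /(_ e e0).
  by apply: filterS => h; rewrite rcD scalerDl addrA.
apply/has_dirP => e e0; move/is_derive_quotP: H => /(_ e e0).
by apply: filterS => h; rewrite rcD scalerDl addrA.
Qed.

Lemma near_line (P : V -> Prop) p v :
  (\forall q \near p, P q) -> \forall h \near (0 : R), P (p + rc h *: v).
Proof.
move=> H; have := @line_continuous p v 0; rewrite /continuous_at rc0 scale0r addr0; exact.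
Qed.

Lemma has_dir_near f g v p l : (\forall q \near p, f q = g q) ->
  has_dir f v p l -> has_dir g v p l.
Proof.
move=> fg /has_dirP H; apply/has_dirP => e e0.
apply: filterS2 (near_line v fg) (H e e0) => h <-.
by rewrite (nbhs_singleton fg).
Qed.

Lemma has_dirD f g v p a b : has_dir f v p a -> has_dir g v p b ->
  has_dir (fun q => f q + g q) v p (a + b).
Proof. by move=> ha hb; exact: (is_deriveD ha hb). Qed.

Lemma has_dirM f g v p a b : has_dir f v p a -> has_dir g v p b ->
  has_dir (fun q => f q * g q) v p (f p * b + g p * a).
Proof.
by move=> ha hb; have := is_deriveM ha hb; rewrite /= real_line0.
Qed.

Lemma has_dir_cst v p k : has_dir (fun=> k) v p 0.
Proof. exact: (@is_derive_cst R R^o R^o k 0 1). Qed.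

Lemma has_dirZ f v p a k : has_dir f v p a -> has_dir (fun q => k * f q) v p (k * a).
Proof.
move=> h; have := has_dirM (has_dir_cst v p k) h.
by rewrite mulr0 addr0.
Qed.

Lemma has_dirN f v p a : has_dir f v p a -> has_dir (fun q => - f q) v p (- a).
Proof. by move=> ha; exact: (is_deriveN ha). Qed.

Lemma has_dirB f g v p a b : has_dir f v p a -> has_dir g v p b ->
  has_dir (fun q => f q - g q) v p (a - b).
Proof. by move=> ha /has_dirN hb; exact: has_dirD. Qed.

Lemma has_dir_sum (I : Type) (r : seq I) (F : I -> V -> R) (a : I -> R) v p :
  (forall i, has_dir (F i) v p (a i)) ->
  has_dir (fun q => \sum_(i <- r) F i q) v p (\sum_(i <- r) a i).
Proof.
move=> H; elim: r => [|i r IH].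
  rewrite big_nil; apply: has_dir_near (has_dir_cst v p 0).
  by near=> q; rewrite big_nil.
rewrite big_cons; apply: has_dir_near (has_dirD (H i) IH).
by near=> q; rewrite big_cons.
Unshelve. all: by end_near. Qed.

Lemma has_dir_comp1 f (g : R -> R) v p a b : has_dir f v p a ->
  is_derive (f p) (1 : R) g b -> has_dir (fun q => g (f q)) v p (b * a).
Proof.
move=> ha hb.
have hb' : is_derive ((f \o real_line p v) 0) (1 : R) g b by rewrite /= real_line0.
have := @is_derive1_comp R g (f \o real_line p v) 0 b a hb' ha.
by [].
Qed.

(** [C1] and [C2] are germ versions of [Ck]: neighbourhood filters replace the open set that would
    have to be carried along. *)
Definition D1 f q := {for q, continuous f} /\
  forall v, derivable (f \o real_line q v) 0 1 /\ {for q, continuous (dirderiv f v)}.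

Definition C1 f p := \forall q \near p, D1 f q.

Definition C2 f p := (C1 f p) /\ forall v, C1 (dirderiv f v) p.

Lemma C1_D1 f p : C1 f p -> D1 f p. Proof. exact: nbhs_singleton. Qed.

Lemma D1_dir f q v : D1 f q -> has_dir f v q (dirderiv f v q).
Proof. by move=> [_ /(_ v)[? _]]; exact: derivable_has_dir. Qed.

Lemma C1_dir f q v : C1 f q -> has_dir f v q (dirderiv f v q).
Proof. by move/C1_D1; exact: D1_dir. Qed.

Lemma C1_cont f q : C1 f q -> {for q, continuous f}.
Proof. by move/C1_D1 => []. Qed.

Lemma C1_dcont f q v : C1 f q -> {for q, continuous (dirderiv f v)}.
Proof. by move/C1_D1 => [_ /(_ v)[]]. Qed.

Lemma near_near (P : V -> Prop) p :
  (\forall q \near p, P q) -> \forall q \near p, \forall q' \near q, P q'.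
Proof. by move/nbhs_interior. Qed.

Lemma C1_C1 f p : C1 f p -> \forall q \near p, C1 f q.
Proof. exact: near_near. Qed.

Lemma near_continuous (T : topologicalType) (U : topologicalType) (f g : T -> U) (p : T) :
  (\forall q \near p, f q = g q) -> {for p, continuous f} -> {for p, continuous g}.
Proof.
move=> fg cf; have e : f p = g p := nbhs_singleton fg.
suff : g x @[x --> p] --> g p by []; rewrite -e.
exact: cvg_trans (near_eq_cvg fg) cf.
Qed.

Lemma C1_intro f p (df : V -> V -> R) :
  (\forall q \near p, {for q, continuous f} /\
     forall v, has_dir f v q (df v q) /\ {for q, continuous (df v)}) -> C1 f p.
Proof.
move=> /near_near; apply: filterS => q H; have [cf Hv] := nbhs_singleton H.
split=> // v; have [hd cdf] := Hv v; split; first exact: has_dir_derivable hd.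
apply: near_continuous cdf; apply: filterS H => q' [_ /(_ v)[hd' _]].
by rewrite (has_dirE hd').
Qed.

Lemma C1_near f g p : (\forall q \near p, f q = g q) -> C1 f p -> C1 g p.
Proof.
move=> /near_near fg cf; apply: (@C1_intro _ _ (dirderiv f)).
apply: filterS2 fg cf => q fg cf; split.
  by apply: near_continuous fg _; case: cf.
by move=> v; split; [apply: has_dir_near fg _; exact: D1_dir|case: cf => _ /(_ v)[]].
Qed.

Lemma C1_cst k p : C1 (fun=> k) p.
Proof.
apply: (@C1_intro _ _ (fun _ _ => 0)); near=> q; split; first exact: cvg_cst.
by move=> v; split; [exact: has_dir_cst|exact: cvg_cst].
Unshelve. all: by end_near. Qed.

Lemma C1D f g p : C1 f p -> C1 g p -> C1 (fun q => f q + g q) p.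
Proof.
move=> cf cg; apply: (@C1_intro _ _ (fun v q => dirderiv f v q + dirderiv g v q)).
apply: filterS2 cf cg => q cf cg; split.
  by case: cf => cf _; case: cg => cg _; exact: cvgD.
move=> v; split; first by apply: has_dirD; exact: D1_dir.
by case: cf => _ /(_ v)[_ cf]; case: cg => _ /(_ v)[_ cg]; exact: cvgD.
Qed.

Lemma C1M f g p : C1 f p -> C1 g p -> C1 (fun q => f q * g q) p.
Proof.
move=> cf cg.
apply: (@C1_intro _ _ (fun v q => f q * dirderiv g v q + g q * dirderiv f v q)).
apply: filterS2 cf cg => q cf cg; split.
  by case: cf => cf _; case: cg => cg _; exact: cvgM.
move=> v; split; first by apply: has_dirM; exact: D1_dir.
case: cf => cf /(_ v)[_ cf']; case: cg => cg /(_ v)[_ cg'].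
by apply: cvgD; exact: cvgM.
Qed.

Lemma C1Z k f p : C1 f p -> C1 (fun q => k * f q) p.
Proof. by move=> cf; exact: C1M (C1_cst _ _) cf. Qed.

Lemma C1N f p : C1 f p -> C1 (fun q => - f q) p.
Proof.
move=> cf; apply: C1_near (C1Z (-1) cf).
by near=> q; rewrite mulN1r.
Unshelve. all: by end_near. Qed.

Lemma C1_sum (I : Type) (r : seq I) (F : I -> V -> R) p :
  (forall i, C1 (F i) p) -> C1 (fun q => \sum_(i <- r) F i q) p.
Proof.
move=> H; elim: r => [|i r IH].
  by apply: C1_near (C1_cst 0 p); near=> q; rewrite big_nil.
by apply: C1_near (C1D (H i) IH); near=> q; rewrite big_cons.
Unshelve. all: by end_near. Qed.

Lemma seg_MVT f (df : R -> R) p v :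
  (forall t, 0 <= t <= 1 -> has_dir f v (p + rc t *: v) (df t)) ->
  exists2 c, 0 <= c <= 1 & f (p + v) - f p = df c.
Proof.
move=> H; have D t : 0 <= t <= 1 -> is_derive t (1 : R) (fun s => f (p + rc s *: v)) (df t).
  by move=> /H /has_dir_line.
have [||c] := @MVT_segment R (fun s => f (p + rc s *: v)) df 0 1 ler01.
- by move=> t; rewrite in_itv /= => ?; apply: D; lra.
- by apply: within_continuous_itv => t ?; apply: is_derive_continuous (D t _).
rewrite in_itv /= rc0 rc1 scale0r scale1r addr0 subr0 mulr1 => ? ?.
by exists c.
Qed.

Lemma segment_const f p v :
  (forall t, 0 <= t <= 1 -> has_dir f v (p + rc t *: v) 0) -> f (p + v) = f p.
Proof. by move=> /(@seg_MVT _ (fun=> 0))[_ _ /eqP]; rewrite subr_eq0 => /eqP. Qed.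

Lemma near_segment (P : V -> Prop) p : (\forall q \near p, P q) ->
  \forall q \near p, forall t, 0 <= t <= 1 -> P (p + rc t *: (q - p)).
Proof.
move=> /nbhs_ballP[e /= e0 eP]; apply/nbhs_ballP; exists e => // q.
rewrite /= -ball_normE /= => pq t /andP[t0 t1]; apply: eP.
rewrite -ball_normE /= opprD addrA subrr add0r normrN normrZ norm_rc ger0_norm//.
rewrite distrC in pq; apply: le_lt_trans pq.
by rewrite -[leRHS]mul1r ler_wpM2r// -rc1 le_rc.
Qed.

Lemma near_const f p : (\forall q \near p, forall v, has_dir f v q 0) ->
  \forall q \near p, f q = f p.
Proof.
move=> /near_segment; apply: filterS => q H.
by rewrite -{1}(subrK p q) addrC; apply: segment_const => t t01; exact: H.
Qed.

End Calculus.

(** * The chain rule and the symmetry of second derivatives *)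

Section ChainRule.
Context {R : realType} {V : normedModType (Cx R)}.
Implicit Types (f g : V -> R) (p q u v w z E : V) (s t h : R).

(** The estimate is uniform in the base point q near z. This is what allows coordinates to be
    changed one after the other, each time at a displaced point. *)
Lemma partial_increment f z E :
  (\forall q \near z, derivable (f \o real_line q E) 0 1) ->
  {for z, continuous (dirderiv f E)} ->
  forall e, 0 < e -> \forall q \near z & x \near (0 : R),
    `|f (q + rc x *: E) - f q - x * dirderiv f E z| <= e * `|x|.
Proof.
move=> df cdf e e0.
have cm : {for (z, 0 : R), continuous (fun m : V * R => m.1 + rc m.2 *: E)}.
  apply: for_continuousD; first exact: for_continuous_fst.
  by apply: for_continuous_rcZ; [exact: for_continuous_snd|exact: for_continuous_cst].
have H : \forall q \near z, derivable (f \o real_line q E) 0 1 /\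
    `|dirderiv f E z - dirderiv f E q| <= e.
  by move: cdf => /cvgrPdist_le/(_ e e0) cdf; apply: filterS2 df cdf.
have z0 : (z, 0 : R).1 + rc (z, 0 : R).2 *: E = z by rewrite /= rc0 scale0r addr0.
rewrite -{1}z0 in H.
have [[A B] /= [Az B0] AB] := cm _ H.
move/nbhs_ballP : B0 => [d /= d0 dB].
exists (A, ball (0 : R) d); first by split=> //; apply/nbhs_ballP; exists d.
move=> [q x] /= [Aq Bx].
have Hy y : `|y - 0| <= `|x| -> derivable (f \o real_line (q + rc y *: E) E) 0 1 /\
    `|dirderiv f E z - dirderiv f E (q + rc y *: E)| <= e.
  rewrite subr0 => yx; apply: (AB (q, y)); split=> //; apply: dB.
  by move: Bx; rewrite /ball /= !sub0r !normrN; exact: le_lt_trans.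
have [y /Hy[/derivable_has_dir/has_dir_line dy _]|c cx] :=
    @MVT_between R (fun s => f (q + rc s *: E))
      (fun s => dirderiv f E (q + rc s *: E)) 0 x.
  exact: dy.
rewrite add0r rc0 scale0r addr0 => ->.
rewrite mulrC -mulrBr normrM mulrC ler_wpM2r// distrC.
by case: (Hy c cx).
Qed.

Lemma sum_curve_continuous (T : topologicalType) (I : Type) (r : seq I) (E : I -> V)
    (c : I -> T -> R) (t0 : T) z :
  (forall k, {for t0, continuous (c k)}) ->
  {for t0, continuous (fun t : T => z + \sum_(k <- r) rc (c k t) *: E k)}.
Proof.
move=> cc; apply: for_continuousD; first exact: for_continuous_cst.
by apply: for_continuous_sum => k; apply: for_continuous_rcZ => //; exact: for_continuous_cst.
Qed.

Lemma sum_curve0 (T : Type) (I : Type) (r : seq I) (E : I -> V) (c : I -> T -> R) (t0 : T) z :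
  (forall k, c k t0 = 0) -> z + \sum_(k <- r) rc (c k t0) *: E k = z.
Proof. by move=> c0; rewrite big1 ?addr0// => k _; rewrite c0 rc0 scale0r. Qed.

Lemma partials_continuous (T : topologicalType) (I : Type) (r : seq I) (E : I -> V) f z
    (c : I -> T -> R) (t0 : T) :
  (forall k, \forall q \near z, derivable (f \o real_line q (E k)) 0 1) ->
  (forall k, {for z, continuous (dirderiv f (E k))}) ->
  (forall k, c k t0 = 0) -> (forall k, {for t0, continuous (c k)}) ->
  {for t0, continuous (fun t : T => f (z + \sum_(k <- r) rc (c k t) *: E k))}.
Proof.
move=> df cdf c0 cc; elim: r => [|k r IH].
  rewrite (_ : (fun t : T => _) = fun=> f z); first exact: for_continuous_cst.
  by apply/funext => t; rewrite big_nil addr0.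
have [[A B] /= [Az B0] AB] := partial_increment (df k) (cdf k) ltr01.
have HA : \forall t \near t0, A (z + \sum_(k <- r) rc (c k t) *: E k).
  by have := @sum_curve_continuous T I r E c t0 z cc A; rewrite sum_curve0//; apply.
have HB : \forall t \near t0, B (c k t) by have := cc k B; rewrite /= c0; apply.
pose S (t : T) := z + \sum_(k <- r) rc (c k t) *: E k.
pose D := dirderiv f (E k) z.
apply: (@near_continuous _ _ (fun t : T => f (S t) + (f (S t + rc (c k t) *: E k) - f (S t)))).
  near=> t; rewrite /S big_cons [rc _ *: _ + _]addrC addrA.
  by rewrite [RHS](_ : _ = f (z + (\sum_(j <- r) rc (c j t) *: E j + rc (c k t) *: E k)))// !addrA; ring.
apply: for_continuousDR => //.
suff H : (fun t : T => f (S t + rc (c k t) *: E k) - f (S t)) @ t0 --> (0 : R).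
  have e0 : f (S t0 + rc (c k t0) *: E k) - f (S t0) = 0 by rewrite c0 rc0 scale0r addr0 subrr.
  by rewrite -[X in _ --> X]e0 in H.
apply/cvgrPdist_le => e e0.
have D1 : 0 < `|D| + 1 by rewrite ltr_wpDl.
have e20 : 0 < e / (`|D| + 1) by rewrite divr_gt0.
have HC : \forall t \near t0, `|c k t| <= e / (`|D| + 1).
  have /cvgrPdist_le/(_ _ e20) := cc k; rewrite c0.
  by apply: filterS => t; rewrite sub0r normrN.
apply: filterS2 (filterI HA HB) HC => t [h3 h4] h6.
have h5 := AB (_, _) (conj h3 h4); rewrite /= -/(S t) -/D mul1r in h5.
rewrite sub0r normrN -(subrK (c k t * D) (f _ - f _)) (le_trans (ler_normD _ _))//.
rewrite (le_trans (lerD h5 (lexx _)))// normrM -[X in X + _ <= _]mulr1 -mulrDr [1 + _]addrC.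
by rewrite -ler_pdivlMr.
Unshelve. all: by end_near. Qed.

(** Induction on the list of directions: only one coordinate moves at each stage, and
    [partial_increment] applies at the point reached so far. *)
Lemma chain_sum (I : Type) (r : seq I) (E : I -> V) f z (c : I -> R -> R) (dc : I -> R) :
  (forall k, \forall q \near z, derivable (f \o real_line q (E k)) 0 1) ->
  (forall k, {for z, continuous (dirderiv f (E k))}) ->
  (forall k, c k 0 = 0) -> (forall k, is_derive (0 : R) (1 : R) (c k) (dc k)) ->
  is_derive (0 : R) (1 : R) (fun t => f (z + \sum_(k <- r) rc (c k t) *: E k))
    (\sum_(k <- r) dc k * dirderiv f (E k) z).
Proof.
move=> df cdf c0 dcc.
have cc k : {for (0 : R), continuous (c k)} by exact: is_derive_continuous (dcc k).
elim: r => [|k r IH].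
  rewrite big_nil; apply/is_derive_quotP => e e0; near=> h.
  by rewrite !big_nil subrr mulr0 subr0 normr0 mulr_ge0// ltW.
apply/is_derive_quotP => e e0.
pose D := dirderiv f (E k) z.
(* Error budget: e / 2 for the directions already treated, e / 4 for replacing c k h by h * dc k (an
   error multiplied by D), and e / 4 for the increment of f, where c k h is at most M times h. *)
pose e2 := e / (4 * (`|D| + 1)).
have D1 : 0 < `|D| + 1 by rewrite ltr_wpDl.
have e20 : 0 < e2 by rewrite divr_gt0// mulr_gt0.
pose M := `|dc k| + e2 + 1.
have M0 : 0 < M by rewrite /M ltr_wpDl// addr_ge0// ltW.
pose e1 := e / (4 * M).
have e10 : 0 < e1 by rewrite divr_gt0// mulr_gt0.
have eh : 0 < e / 2 by rewrite divr_gt0.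
have /is_derive_quotP/(_ _ eh) H1 := IH.
have /is_derive_quotP/(_ _ e20) H2 := dcc k.
have [[A B] /= [Az B0] AB] := partial_increment (df k) (cdf k) e10.
have H3 : \forall h \near (0 : R), A (z + \sum_(k <- r) rc (c k h) *: E k).
  by have := @sum_curve_continuous R I r E c 0 z cc A; rewrite sum_curve0//; apply.
have H4 : \forall h \near (0 : R), B (c k h).
  by have := cc k B; rewrite /= c0; apply.
apply: filterS2 (filterI H1 H2) (filterI H3 H4) => h [h1 h2] [h3 h4].
have h5 := AB (_, _) (conj h3 h4); rewrite /= in h5.
rewrite !add0r in h1 h2 *; rewrite c0 subr0 in h2.
have S0 r' : z + \sum_(k <- r') rc (c k 0) *: E k = z by exact: sum_curve0.
rewrite S0 in h1; rewrite S0 !big_cons.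
rewrite [rc _ *: _ + _]addrC addrA mulrDr.
set S := z + _ in h1 h5 *; set SD := \sum_(k <- r) _ in h1 *; rewrite -/D in h5 *.
set X := f (S + _) in h5 *.
have -> : X - f z - (h * (dc k * D) + h * SD) =
  (X - f S - c k h * D) + ((c k h - h * dc k) * D + (f S - f z - h * SD)) by ring.
rewrite (le_trans (ler_normD _ _))// (le_trans (lerD h5 (ler_normD _ _)))//.
rewrite normrM.
have h6 : `|c k h| <= (`|dc k| + e2) * `|h|.
  rewrite -(subrK (h * dc k) (c k h)) (le_trans (ler_normD _ _))//.
  by rewrite normrM [_ * `|dc k|]mulrC mulrDl addrC lerD2l.
have h7 : e1 * `|c k h| <= e / 4 * `|h|.
  apply: (le_trans (ler_wpM2l (ltW e10) h6)); rewrite mulrA ler_wpM2r//.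
  apply: (@le_trans _ _ (e1 * M)); first by rewrite ler_wpM2l ?(ltW e10)// /M lerDl.
  suff -> : e1 * M = e / 4 by [].
  by rewrite /e1; field; rewrite gt_eqF.
have h8 : `|c k h - h * dc k| * `|D| <= e / 4 * `|h|.
  apply: (le_trans (ler_wpM2r (normr_ge0 D) h2)).
  rewrite [leLHS]mulrAC ler_wpM2r//.
  apply: (@le_trans _ _ (e2 * (`|D| + 1))); first by rewrite ler_wpM2l ?(ltW e20)// lerDl.
  suff -> : e2 * (`|D| + 1) = e / 4 by [].
  by rewrite /e2; field; rewrite gt_eqF.
have -> : e * `|h| = e / 4 * `|h| + (e / 4 * `|h| + e / 2 * `|h|) by field.
by rewrite lerD// lerD.
Unshelve. all: by end_near. Qed.

Section WithFrame.
Variable fr : frame V.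

Lemma frame_expand z q : q = z + \sum_k rc (fr_e (f:=fr) k (q - z)) *: fr_E k.
Proof. by rewrite -fr_sum addrC subrK. Qed.

Let C1_partials f z k : C1 f z -> (\forall q \near z, derivable (f \o real_line q (fr_E (f:=fr) k)) 0 1) /\
  {for z, continuous (dirderiv f (fr_E (f:=fr) k))}.
Proof.
move=> cf; split; last exact: C1_dcont.
by apply: filterS cf => q [_ /(_ (fr_E k))[]].
Qed.

Let chain0 f (c : R -> V) w : C1 f (c 0) ->
  (forall k, is_derive (0 : R) (1 : R) (fun t => fr_e (f:=fr) k (c t)) (fr_e (f:=fr) k w)) ->
  is_derive (0 : R) (1 : R) (fun t => f (c t)) (\sum_k fr_e (f:=fr) k w * dirderiv f (fr_E k) (c 0)).
Proof.
move=> cf dc.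
have -> : (fun t => f (c t)) =
    (fun t => f (c 0 + \sum_k rc (fr_e (f:=fr) k (c t) - fr_e (f:=fr) k (c 0)) *: fr_E k)).
  by apply/funext => t; rewrite {1}(frame_expand (c 0) (c t)); under eq_bigr do rewrite fr_eB.
apply: chain_sum => [k|k|k|k].
- by case: (C1_partials k cf).
- by case: (C1_partials k cf).
- by rewrite subrr.
- have /is_derive_quotP H := dc k; apply/is_derive_quotP => e e0.
  by move: (H e e0); apply: filterS => h; rewrite opprB addrA subrK.
Qed.

Let fr_line k p w : is_derive (0 : R) (1 : R) (fun t => fr_e (f:=fr) k (real_line p w t)) (fr_e (f:=fr) k w).
Proof.
apply/is_derive_quotP => e e0; near=> h.
rewrite add0r real_line0 /real_line fr_eD -/(rc h) fr_eZ.
have -> (a b : R) : a + b - a - b = 0 by ring.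
rewrite normr0.
by rewrite mulr_ge0// ltW.
Unshelve. all: by end_near. Qed.

Lemma dirderiv_frame f p w : C1 f p ->
  dirderiv f w p = \sum_k fr_e (f:=fr) k w * dirderiv f (fr_E k) p.
Proof.
move=> cf; apply: has_dirE.
have := @chain0 f (real_line p w) w; rewrite real_line0; apply=> // k.
Qed.

Lemma C1_chain f (c : R -> V) w : C1 f (c 0) ->
  (forall k, is_derive (0 : R) (1 : R) (fun t => fr_e (f:=fr) k (c t)) (fr_e (f:=fr) k w)) ->
  is_derive (0 : R) (1 : R) (fun t => f (c t)) (dirderiv f w (c 0)).
Proof. by move=> cf dc; rewrite (dirderiv_frame w cf); exact: chain0. Qed.

Lemma dirderivD f p u w : C1 f p -> dirderiv f (u + w) p = dirderiv f u p + dirderiv f w p.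
Proof.
move=> cf; rewrite !(dirderiv_frame _ cf) -big_split /=.
by apply: eq_bigr => k _; rewrite fr_eD mulrDl.
Qed.

Lemma dirderivZ f p t u : C1 f p -> dirderiv f (rc t *: u) p = t * dirderiv f u p.
Proof.
move=> cf; rewrite !(dirderiv_frame _ cf) mulr_sumr.
by apply: eq_bigr => k _; rewrite fr_eZ mulrA.
Qed.

(** Primitives are known only through their coordinate derivatives; continuity and the remaining
    directions follow by expanding the displacement in the frame. *)
Lemma C1_of_partials f p (df : fr_I fr -> V -> R) :
  (\forall q \near p, forall k, has_dir f (fr_E (f:=fr) k) q (df k q) /\
     {for q, continuous (df k)}) -> C1 f p.
Proof.
move=> /near_near H.
apply: (@C1_intro _ _ _ _ (fun v q => \sum_k fr_e (f:=fr) k v * df k q)).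
apply: filterS H => q H.
have dq k : \forall q' \near q, derivable (f \o real_line q' (fr_E (f:=fr) k)) 0 1.
  by apply: filterS H => q' /(_ k)[+ _]; exact: has_dir_derivable.
have eq k : \forall q' \near q, df k q' = dirderiv f (fr_E k) q'.
  by apply: filterS H => q' /(_ k)[/has_dirE -> _].
have cq k : {for q, continuous (dirderiv f (fr_E (f:=fr) k))}.
  by apply: near_continuous (eq k) _; case: (nbhs_singleton H k).
split.
  have -> : f = (fun q' => f (q + \sum_k rc (fr_e (f:=fr) k (q' - q)) *: fr_E k)).
    by apply/funext => q'; rewrite -frame_expand.
  apply: partials_continuous => // k; first by rewrite subrr fr_e0.
  apply: (@for_continuous_comp _ _ _ (fun q' => q' - q) (fr_e (f:=fr) k)); last exact: fr_ec.
  by apply: for_continuousD; [exact: cvg_id|exact: for_continuous_cst].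
move=> v; split; last first.
  apply: for_continuous_sumR => k; apply: for_continuousMR; first exact: for_continuous_cst.
  by case: (nbhs_singleton H k).
rewrite /has_dir.
have -> : f \o real_line q v = fun t => f (q + \sum_k rc (t * fr_e (f:=fr) k v) *: fr_E k).
  apply/funext => t /=; rewrite /real_line -/(rc t) {1}(fr_sum fr v) scaler_sumr.
  by congr (f (_ + _)); apply: eq_bigr => k _; rewrite scalerA -rcM.
under eq_bigr do rewrite (nbhs_singleton (eq _)).
apply: chain_sum => // k; first by rewrite mul0r.
apply/is_derive_quotP => e e0; near=> h.
by rewrite add0r mul0r subr0 subrr normr0 mulr_ge0// ltW.
Unshelve. all: by end_near. Qed.

End WithFrame.

(** The mean value theorem is used twice: in direction u for f(. + h v) - f, then in direction v for
    the derivative along u. *)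
Lemma second_difference f (N : set V) p u v h : 0 < h ->
  (forall s t, 0 <= s <= h -> 0 <= t <= h -> N (p + rc s *: u + rc t *: v)) ->
  (forall q, N q -> C1 f q /\ C1 (dirderiv f u) q) ->
  exists2 q, N q & f (p + rc h *: u + rc h *: v) - f (p + rc h *: u) - f (p + rc h *: v) + f p =
    h * h * dirderiv (dirderiv f u) v q.
Proof.
move=> h0 HN Hf; have h00 : 0 <= h <= h by rewrite lexx ltW.
have h0' : 0 <= (0 : R) <= h by apply/andP; split; [exact: lexx|exact: ltW].
have N1 s : 0 <= s <= h -> N (p + rc s *: u) by move=> hs; have := HN s 0 hs h0'; rewrite rc0 scale0r addr0.
have tr (F : R -> R) (dF : R -> R) : (forall s, 0 <= s <= h -> is_derive s (1 : R) F (dF s)) ->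
    exists2 s, 0 <= s <= h & F h - F 0 = dF s * h.
  move=> dd; have [||s] := @MVT_segment R F dF 0 h (ltW h0).
  - by move=> s; rewrite in_itv /= => hs; apply: dd; lra.
  - by apply: within_continuous_itv => s hs; apply: is_derive_continuous (dd s hs).
  by rewrite in_itv /= subr0 => hs e; exists s.
have [|s hs] := tr (fun s => f (p + rc h *: v + rc s *: u) - f (p + rc s *: u))
    (fun s => dirderiv f u (p + rc h *: v + rc s *: u) - dirderiv f u (p + rc s *: u)).
  move=> s hs; apply: is_deriveB.
    apply/has_dir_line/C1_dir; case: (Hf (p + rc h *: v + rc s *: u)) => //.
    by rewrite addrAC; apply: HN.
  by apply/has_dir_line/C1_dir; case: (Hf _ (N1 s hs)).
rewrite rc0 !scale0r !addr0 => E.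
have [|t ht] := tr (fun t => dirderiv f u (p + rc s *: u + rc t *: v))
    (fun t => dirderiv (dirderiv f u) v (p + rc s *: u + rc t *: v)).
  by move=> t ht; apply/has_dir_line/C1_dir; case: (Hf _ (HN s t hs ht)).
rewrite rc0 !scale0r !addr0 => E2.
exists (p + rc s *: u + rc t *: v); first exact: HN.
rewrite [p + rc s *: u + rc h *: v]addrAC in E2.
rewrite E2 in E; rewrite [p + rc h *: u + rc h *: v]addrAC.
transitivity (f (p + rc h *: v + rc h *: u) - f (p + rc h *: u) - (f (p + rc h *: v) - f p)).
  by ring.
by rewrite E; ring.
Qed.

(** The second difference is symmetric in u and v, so both mixed derivatives take a common value at
    points of one small parallelogram, where continuity keeps each within e / 2 of its value at
    p. *)
Lemma schwarz f p u v : C2 f p ->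
  dirderiv (dirderiv f u) v p = dirderiv (dirderiv f v) u p.
Proof.
move=> [cf c2].
apply/eqP; rewrite eq_sym -subr_eq0 -normr_le0; apply/ler_addgt0Pr => e e0; rewrite add0r.
have e20 : 0 < e / 2 by rewrite divr_gt0.
have /cvgrPdist_le/(_ _ e20) Huv := C1_dcont (v := v) (c2 u).
have /cvgrPdist_le/(_ _ e20) Hvu := C1_dcont (v := u) (c2 v).
pose N : set V := fun q => (`|dirderiv (dirderiv f u) v p - dirderiv (dirderiv f u) v q| <= e / 2 /\
  `|dirderiv (dirderiv f v) u p - dirderiv (dirderiv f v) u q| <= e / 2) /\
  (C1 f q /\ (C1 (dirderiv f u) q /\ C1 (dirderiv f v) q)).
have HN : \forall q \near p, N q.
  apply: filterI; first exact: (filterI Huv Hvu).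
  exact: filterI (C1_C1 cf) (filterI (C1_C1 (c2 u)) (C1_C1 (c2 v))).
have cm : {for ((0 : R), (0 : R)), continuous (fun m : R * R => p + rc m.1 *: u + rc m.2 *: v)}.
  apply: for_continuousD; last by apply: for_continuous_rcZ; [exact: for_continuous_snd|exact: for_continuous_cst].
  apply: for_continuousD; first exact: for_continuous_cst.
  by apply: for_continuous_rcZ; [exact: for_continuous_fst|exact: for_continuous_cst].
have p0 : p + rc ((0 : R), (0 : R)).1 *: u + rc ((0 : R), (0 : R)).2 *: v = p.
  by rewrite /= rc0 !scale0r !addr0.
rewrite -{1}p0 in HN.
have [[A B] /= [/nbhs_ballP[a /= a0 aA] /nbhs_ballP[b /= b0 bB]] AB] := cm _ HN.
pose h := Num.min a b / 2.
have ab0 : 0 < Num.min a b by rewrite lt_min a0 b0.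
have h0 : 0 < h by rewrite divr_gt0.
have [ha hb] : h < a /\ h < b.
  have : h < Num.min a b by rewrite ltr_pdivrMr// ltr_pMr// ltr1n.
  by rewrite lt_min => /andP.
have HN1 s t : 0 <= s <= h -> 0 <= t <= h -> N (p + rc s *: u + rc t *: v).
  move=> /andP[s0 s1] /andP[t0 t1]; apply: (AB (s, t)); split.
    by apply: aA; rewrite /ball /= sub0r normrN ger0_norm// (le_lt_trans s1).
  by apply: bB; rewrite /ball /= sub0r normrN ger0_norm// (le_lt_trans t1).
have [q [[Hq _] _] E1] := second_difference h0 HN1 (fun q Nq => conj Nq.2.1 Nq.2.2.1).
have HN2 s t : 0 <= s <= h -> 0 <= t <= h -> N (p + rc s *: v + rc t *: u).
  by move=> hs ht; rewrite addrAC; exact: HN1.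
have [q' [[_ Hq'] _] E2] := second_difference h0 HN2 (fun q Nq => conj Nq.2.1 Nq.2.2.2).
have E : dirderiv (dirderiv f u) v q = dirderiv (dirderiv f v) u q'.
  apply: (@mulfI _ (h * h)); first by rewrite mulf_neq0 ?gt_eqF.
  have sw : p + rc h *: u + rc h *: v = p + rc h *: v + rc h *: u := addrAC _ _ _.
  rewrite sw in E1.
  exact: etrans (esym E1) (etrans (congr1 (fun x => x + f p) (addrAC _ _ _)) E2).
set a' := dirderiv (dirderiv f v) u p in Hq' *; set b' := dirderiv (dirderiv f u) v p in Hq *.
have -> : a' - b' = (a' - dirderiv (dirderiv f v) u q') - (b' - dirderiv (dirderiv f u) v q).
  by rewrite E; ring.
apply: (le_trans (ler_normB _ _)); rewrite [e]splitr.
exact: lerD Hq' Hq.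
Qed.

End ChainRule.

(** * The theorems of Goursat and Cauchy *)

Section Goursat.
Context {R : realType}.
Implicit Types (f g : R -> R) (M N : R -> R -> R) (x y l m a b c d s t e : R).

Lemma affine_continuous a l : continuous (fun s : R => a + s * l).
Proof.
move=> s; suff : {for s, continuous (fun s : R => a + s * l)} by [].
apply: for_continuousDR; first exact: for_continuous_cst.
by apply: for_continuousMR; [exact: cvg_id|exact: for_continuous_cst].
Qed.

Lemma affine_derive a l s : is_derive s (1 : R) (fun s : R => a + s * l) l.
Proof.
apply/is_derive_quotP => e e0; near=> h.
have -> : a + (s + h) * l - (a + s * l) - h * l = 0 by ring.
by rewrite normr0 mulr_ge0// ltW.
Unshelve. all: by end_near. Qed.

Lemma affine_itv a l s : 0 <= l -> 0 <= s <= 1 -> a <= a + s * l <= a + l.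
Proof.
move=> l0 /andP[s0 s1]; rewrite lerDl mulr_ge0//= lerD2l.
by rewrite -[leRHS]mul1r ler_wpM2r.
Qed.

Lemma cont01_affine f a l : 0 <= l -> (forall t, a <= t <= a + l -> {for t, continuous f}) ->
  cont01 (fun s => f (a + s * l)).
Proof.
move=> l0 cf s s01; apply: (@for_continuous_comp _ _ _ (fun s : R => a + s * l) f).
  exact: affine_continuous.
by apply: cf; exact: affine_itv.
Qed.

(** The integral of f over [a, a + l], transported to the unit interval. *)
Definition segint f a l := l * I01 (fun s => f (a + s * l)).

Lemma segint_FTC f F a l : 0 <= l ->
  (forall t, a <= t <= a + l -> {for t, continuous f}) ->
  (forall t, a <= t <= a + l -> is_derive t (1 : R) F (f t)) ->
  segint f a l = F (a + l) - F a.
Proof.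
move=> l0 cf dF; rewrite /segint -I01Z; last exact: cont01_affine.
have H1 : cont01 (fun s => l * f (a + s * l)).
  move=> t t01; apply: for_continuousMR; first exact: for_continuous_cst.
  exact: (cont01_affine l0 cf).
have H2 s : 0 <= s <= 1 -> is_derive s (1 : R) (fun s => F (a + s * l)) (l * f (a + s * l)).
  move=> s01; rewrite mulrC.
  exact: (@is_derive1_comp R F (fun s => a + s * l) s _ _ (dF _ (affine_itv a l0 s01)) (affine_derive a l s)).
by rewrite (I01_FTC H1 H2) mul1r mul0r addr0.
Qed.

Lemma segint_split f a l m : 0 <= l -> 0 < m ->
  (forall t, a <= t <= a + (l + m) -> {for t, continuous f}) ->
  segint f a (l + m) = segint f a l + segint f (a + l) m.
Proof.
move=> l0 m0 cf.
have [F dF] : exists F, forall t, a <= t <= a + (l + m) -> is_derive t (1 : R) F (f t).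
  by apply: antiderivative => //; rewrite ltrDl ltr_wpDl.
have S a' l' : a <= a' -> 0 <= l' -> a' + l' <= a + (l + m) -> segint f a' l' = F (a' + l') - F a'.
  by move=> h1 h2 h3; apply: segint_FTC => // t ?; [apply: cf|apply: dF]; lra.
rewrite !S; try lra.
by rewrite addrA; ring.
Qed.

Lemma segint_derive f a b x : a < x < b ->
  (forall t, a <= t <= b -> {for t, continuous f}) ->
  is_derive x (1 : R) (fun x => segint f a (x - a)) (f x).
Proof.
move=> /andP[ax xb] cf.
have [F dF] := antiderivative (lt_trans ax xb) cf.
have /is_derive_quotP H : is_derive x (1 : R) F (f x) by apply: dF; rewrite !ltW.
apply/is_derive_quotP => e e0.
have near_itv : \forall h \near (0 : R), a < x + h < b.
  pose r := Num.min (x - a) (b - x).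
  have r0 : 0 < r by rewrite lt_min !subr_gt0 ax.
  apply/nbhs_ballP; exists r => //= h.
  rewrite /ball /= sub0r normrN /r lt_min => /andP[].
  by rewrite !ltr_norml => ? ?; lra.
apply: filterS2 near_itv (H e e0) => h xh.
have S l' : 0 <= l' -> a + l' <= b -> segint f a l' = F (a + l') - F a.
  by move=> h1 h2; apply: segint_FTC => // t ?; [apply: cf|apply: dF]; lra.
rewrite !S; try lra.
have -> : a + (x + h - a) = x + h by ring.
have -> : a + (x - a) = x by ring.
by rewrite opprB addrA subrK.
Qed.

Lemma I01_affine_approx f A B e : cont01 f ->
  (forall s, 0 <= s <= 1 -> `|f s - (A + s * B)| <= e) -> `|I01 f - (A + B / 2)| <= e.
Proof.
move=> cf H.
have cA : cont01 (fun s => A + s * B) by move=> s _; exact: affine_continuous.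
have -> : A + B / 2 = I01 (fun s => A + s * B).
  have dF s : 0 <= s <= 1 -> is_derive s (1 : R) (fun s => A * s + s * s * (B / 2)) (A + s * B).
    move=> _; apply/is_derive_quotP => r r0.
    have : \forall h \near (0 : R), `|h * (B / 2)| <= r.
      have : {for (0 : R), continuous (fun h : R => 0 + h * (B / 2))} by exact: affine_continuous.
      move=> /cvgrPdist_le/(_ r r0); apply: filterS => h.
      by rewrite mul0r addr0 !add0r normrN.
    apply: filterS => h hr.
    have -> : A * (s + h) + (s + h) * (s + h) * (B / 2) - (A * s + s * s * (B / 2)) - h * (A + s * B)
      = (h * (B / 2)) * h by field.
    by rewrite normrM ler_wpM2r.
  by rewrite (I01_FTC cA dF); ring.
rewrite -I01B//; apply: I01_norm => // s s01.
by apply: for_continuousDR; [exact: cf|apply: for_continuousNR; exact: cA].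
Qed.

(** Real differentiability at a single point, without continuity of the derivative: this is what
    complex differentiability provides and what Goursat's argument consumes. *)
Definition frechet2 M x y a b := forall e, 0 < e -> exists2 d, 0 < d &
  forall h k, `|h| <= d -> `|k| <= d -> `|M (x + h) (y + k) - M x y - (h * a + k * b)| <= e * (`|h| + `|k|).

Lemma frechet2_derive1 M x y a b : frechet2 M x y a b -> is_derive x (1 : R) (M^~ y) a.
Proof.
move=> H; apply/is_derive_quotP => e /H[d d0 {}H].
apply/nbhs_ballP; exists d => //= h; rewrite /ball /= sub0r normrN => hd.
have := H h 0 (ltW hd); rewrite normr0 !addr0 mul0r addr0; apply; exact: ltW.
Qed.

Lemma frechet2_derive2 M x y a b : frechet2 M x y a b -> is_derive y (1 : R) (M x) b.
Proof.
move=> H; apply/is_derive_quotP => e /H[d d0 {}H].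
apply/nbhs_ballP; exists d => //= h; rewrite /ball /= sub0r normrN => hd.
have := H 0 h; rewrite normr0 !add0r mul0r addr0 add0r; apply; exact: ltW.
Qed.

(** Counterclockwise circulation of the form M dx + N dy along the boundary of a rectangle. *)
Definition contour M N x y l m :=
  segint (M^~ y) x l + segint (N (x + l)) y m - segint (M^~ (y + m)) x l - segint (N x) y m.

Section Square.
Variables (M N : R -> R -> R) (xa xb ya yb : R).
(** The shared coefficient b expresses closedness of M dx + N dy, pointwise. *)
Hypothesis MN : forall x y, xa < x < xb -> ya < y < yb ->
  exists a b c, frechet2 M x y a b /\ frechet2 N x y b c.

Let inside x y l m := [/\ xa < x, x + l < xb, ya < y, y + m < yb & 0 < l /\ 0 < m].

Let cM y : ya < y < yb -> forall x, xa < x < xb -> {for x, continuous (M^~ y)}.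
Proof.
move=> hy x hx; have [a [b [c [H _]]]] := MN hx hy.
exact: is_derive_continuous (frechet2_derive1 H).
Qed.

Let cN x : xa < x < xb -> forall y, ya < y < yb -> {for y, continuous (N x)}.
Proof.
move=> hx y hy; have [a [b [c [_ H]]]] := MN hx hy.
exact: is_derive_continuous (frechet2_derive2 H).
Qed.

Lemma contour_quarter x y l m : inside x y (l + l) (m + m) ->
  contour M N x y (l + l) (m + m) =
  (contour M N x y l m + contour M N (x + l) y l m) +
  (contour M N x (y + m) l m + contour M N (x + l) (y + m) l m).
Proof.
move=> [x1 x2 y1 y2 [l0 m0]]; rewrite /contour.
have l1 : 0 < l by lra.
have m1 : 0 < m by lra.
rewrite !segint_split; try lra.
- by rewrite !addrA; ring.
- by move=> t ?; apply: cN; lra.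
- by move=> t ?; apply: cM; lra.
- by move=> t ?; apply: cN; lra.
- by move=> t ?; apply: cM; lra.
Qed.

(* [z] is the rectangle with corner [z.1] and sides [z.2]; Goursat bisection keeps
   a rectangle whose contour integral is too large for its size. *)
Let bad e (z : R * R * (R * R)) :=
  inside z.1.1 z.1.2 z.2.1 z.2.2 /\ e * (z.2.1 + z.2.2) ^+ 2 < `|contour M N z.1.1 z.1.2 z.2.1 z.2.2|.

Let step e (z : R * R * (R * R)) : exists z', bad e z -> bad e z' /\
  [/\ z'.2 = (z.2.1 / 2, z.2.2 / 2),
      z.1.1 <= z'.1.1 <= z.1.1 + z.2.1 / 2 & z.1.2 <= z'.1.2 <= z.1.2 + z.2.2 / 2].
Proof.
case: (pselect (bad e z)) => [b|]; last by exists z.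
case: z b => [[x y] [l' m']] [ins]; rewrite /= in ins *.
pose l := l' / 2; pose m := m' / 2.
have El : l' = l + l by rewrite /l; field.
have Em : m' = m + m by rewrite /m; field.
rewrite El Em in ins *.
have E1 : (l + l) / 2 = l by field.
have E2 : (m + m) / 2 = m by field.
rewrite contour_quarter// => B.
have [x1 x2 y1 y2 [l0 m0]] := ins.
(* The square of the half perimeter is four times that of a quarter: if all four quarters were good,
   the whole rectangle would be good. *)
have four a b c d : e * (l + l + (m + m)) ^+ 2 < `|a + b + (c + d)| ->
  [\/ e * (l + m) ^+ 2 < `|a|, e * (l + m) ^+ 2 < `|b|, e * (l + m) ^+ 2 < `|c| |
      e * (l + m) ^+ 2 < `|d|].
  move=> H.
  have [?|a1] := ltP (e * (l + m) ^+ 2) `|a|; first by constructor 1.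
  have [?|b1] := ltP (e * (l + m) ^+ 2) `|b|; first by constructor 2.
  have [?|c1] := ltP (e * (l + m) ^+ 2) `|c|; first by constructor 3.
  have [?|d1] := ltP (e * (l + m) ^+ 2) `|d|; first by constructor 4.
  have h0 : e * (l + l + (m + m)) ^+ 2 = 4 * (e * (l + m) ^+ 2) by ring.
  have h1 := ler_normD (a + b) (c + d); have h2 := ler_normD a b; have h3 := ler_normD c d.
  by exfalso; lra.
case: (four _ _ _ _ B) => {}B.
- exists (x, y, (l, m)); move=> _; split=> /=; last by rewrite E1 E2; split=> //; lra.
  by split=> //=; split; try lra; split; lra.
- exists (x + l, y, (l, m)); move=> _; split=> /=; last by rewrite E1 E2; split=> //; lra.
  by split=> //=; split; try lra; split; lra.
- exists (x, y + m, (l, m)); move=> _; split=> /=; last by rewrite E1 E2; split=> //; lra.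
  by split=> //=; split; try lra; split; lra.
- exists (x + l, y + m, (l, m)); move=> _; split=> /=; last by rewrite E1 E2; split=> //; lra.
  by split=> //=; split; try lra; split; lra.
Qed.

(** Around (xs, ys) the form is affine up to the error K. The circulation of the affine part
    vanishes because b is shared, and the errors on the four sides add up to 2 (l + m) K. *)
Let bad_limit e x y l m xs ys : 0 < e -> xa < xs < xb -> ya < ys < yb ->
  exists2 d, 0 < d & forall x y l m, inside x y l m -> l <= d -> m <= d ->
    x <= xs <= x + l -> y <= ys <= y + m ->
    `|contour M N x y l m| <= e * (l + m) ^+ 2.
Proof.
move=> e0 hx hy; have [a [b [c [HM HN]]]] := MN hx hy.
have e20 : 0 < e / 2 by rewrite divr_gt0.
have [d1 d10 {}HM] := HM _ e20; have [d2 d20 {}HN] := HN _ e20.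
exists (Num.min d1 d2); first by rewrite lt_min d10.
move=> {x y l m}x y l m [x1 x2 y1 y2 [l0 m0]]; rewrite !le_min => /andP[ld1 ld2] /andP[md1 md2] xsx ysy.
pose K := e / 2 * (l + m).
have approx (F : R -> R -> R) u v d x' y' : (forall h k, `|h| <= d -> `|k| <= d ->
    `|F (xs + h) (ys + k) - F xs ys - (h * u + k * v)| <= e / 2 * (`|h| + `|k|)) ->
    l <= d -> m <= d -> x <= x' <= x + l -> y <= y' <= y + m ->
    `|F x' y' - (F xs ys + (x' - xs) * u + (y' - ys) * v)| <= K.
  move=> HF ld md hx' hy'.
  have h1 : `|x' - xs| <= l by rewrite ler_norml; lra.
  have h2 : `|y' - ys| <= m by rewrite ler_norml; lra.
  have := HF (x' - xs) (y' - ys) (le_trans h1 ld) (le_trans h2 md).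
  have -> : xs + (x' - xs) = x' by ring.
  have -> : ys + (y' - ys) = y' by ring.
  have -> : F x' y' - F xs ys - ((x' - xs) * u + (y' - ys) * v) =
    F x' y' - (F xs ys + (x' - xs) * u + (y' - ys) * v) by ring.
  move=> /le_trans; apply; rewrite /K ler_pM2l//; exact: lerD.
have HM1 x' y' := approx M a b d1 x' y' HM ld1 md1.
have HN1 x' y' := approx N b c d2 x' y' HN ld2 md2.
have l0' := ltW l0; have m0' := ltW m0.
have Sx y' : y <= y' <= y + m ->
    `|segint (M^~ y') x l - l * (M xs ys + (x - xs) * a + (y' - ys) * b + l * a / 2)| <= l * K.
  move=> hy'; rewrite /segint -mulrBr normrM (ger0_norm l0') ler_wpM2l//.
  apply: I01_affine_approx.
    by apply: (cont01_affine (f := M^~ y')) => // t ?; apply: cM; lra.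
  move=> s s01; have := HM1 (x + s * l) y' (affine_itv x l0' s01) hy'.
  congr (`| _ | <= _); ring.
have Sy x' : x <= x' <= x + l ->
    `|segint (N x') y m - m * (N xs ys + (x' - xs) * b + (y - ys) * c + m * c / 2)| <= m * K.
  move=> hx'; rewrite /segint -mulrBr normrM (ger0_norm m0') ler_wpM2l//.
  apply: I01_affine_approx.
    by apply: (cont01_affine (f := N x')) => // t ?; apply: cN; lra.
  move=> s s01; have := HN1 x' (y + s * m) hx' (affine_itv y m0' s01).
  congr (`| _ | <= _); ring.
have y00 : y <= y <= y + m by lra.
have y01 : y <= y + m <= y + m by lra.
have x00 : x <= x <= x + l by lra.
have x01 : x <= x + l <= x + l by lra.
have -> : e * (l + m) ^+ 2 = l * K + m * K + (l * K + m * K) by rewrite /K; field.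
have := lerD (lerD (Sx _ y00) (Sy _ x01)) (lerD (Sx _ y01) (Sy _ x00)).
apply: le_trans.
rewrite /contour.
set A1 := segint _ x l; set A2 := segint _ y m; set A3 := segint _ x l; set A4 := segint _ y m.
set B1 := l * _; set B2 := m * _; set B3 := l * _; set B4 := m * _.
(* The identity contains B1 + B2 = B3 + B4, the vanishing circulation of the affine part. *)
have -> : A1 + A2 - A3 - A4 = (A1 - B1) + (A2 - B2) - ((A3 - B3) + (A4 - B4)).
  by rewrite /B1 /B2 /B3 /B4; field.
apply: (le_trans (ler_normB _ _)); apply: lerD; exact: ler_normD.
Qed.

Lemma contour_eq0 x y l m : inside x y l m -> contour M N x y l m = 0.
Proof.
move=> ins; apply/eqP; rewrite -normr_le0; apply/ler_addgt0Pr => r r0; rewrite add0r.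
have lm0 : 0 < l + m by case: ins => _ _ _ _ [? ?]; exact: addr_gt0.
(* A circulation larger than r makes the rectangle bad for this e, and bisection then keeps
   producing bad rectangles. *)
pose e := r / (l + m) ^+ 2.
have e0 : 0 < e by rewrite divr_gt0// exprn_gt0.
have -> : r = e * (l + m) ^+ 2 by rewrite /e; field; rewrite gt_eqF.
rewrite leNgt; apply/negP => B.
have [F HF] := choice (step e).
pose z k := iter k F (x, y, (l, m)).
have zb k : bad e (z k).
  elim: k => [|k IH]; first by [].
  by rewrite /z iterS; case: (HF _ IH).
have z2 k : (z k).2 = (l / 2 ^+ k, m / 2 ^+ k).
  elim: k => [|k IH]; first by rewrite /= expr0 !divr1.
  have [_ [+ _ _]] := HF _ (zb k); rewrite /z iterS -/(z k) => ->.
  by rewrite IH /= exprSr !invfM !mulrA.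
have z0 k : 0 < (z k).2.1 /\ 0 < (z k).2.2 by have [[_ _ _ _ ?] _] := zb k.
have mono k n : (z k).1.1 <= (z (k + n)%N).1.1 /\
    (z (k + n)%N).1.1 + (z (k + n)%N).2.1 <= (z k).1.1 + (z k).2.1 /\
    ((z k).1.2 <= (z (k + n)%N).1.2 /\
    (z (k + n)%N).1.2 + (z (k + n)%N).2.2 <= (z k).1.2 + (z k).2.2).
  elim: n => [|n IH]; first by rewrite addn0.
  have [_ [h1 h2 h3]] := HF _ (zb (k + n)%N).
  rewrite addnS [z _.+1]/z iterS -/(z (k + n)%N).
  have [? ?] := z0 (k + n)%N.
  by rewrite h1 /=; lra.
(* Nested intervals: the supremum of the left ends lies in all of them. *)
have lim (p : R * R * (R * R) -> R) (q : R * R * (R * R) -> R) :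
    (forall k, 0 < q (z k)) ->
    (forall k n, p (z k) <= p (z (k + n)%N) /\ p (z (k + n)%N) + q (z (k + n)%N) <= p (z k) + q (z k)) ->
    exists ps, forall k, p (z k) <= ps <= p (z k) + q (z k).
  move=> q0 H; pose A := range (fun k => p (z k)).
  have ub k : ubound A (p (z k) + q (z k)).
    move=> _ [n _ <-]; have [h1 _] := H n k; have [_ h2] := H k n.
    by rewrite addnC in h2; have := q0 (n + k)%N; lra.
  exists (sup A) => k; apply/andP; split.
    by apply: ub_le_sup; [exists (p (z 0%N) + q (z 0%N)); exact: ub|exists k].
  by apply: ge_sup; [exists (p (z k)), k|exact: ub].
have [|k n|xs hxs] := lim (fun z => z.1.1) (fun z => z.2.1).
- by move=> k; case: (z0 k).
- by have [? [? _]] := mono k n.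
have [|k n|ys hys] := lim (fun z => z.1.2) (fun z => z.2.2).
- by move=> k; case: (z0 k).
- by have [_ [_ ?]] := mono k n.
have [x1 x2 y1 y2 _] := ins.
have hx : xa < xs < xb by have := hxs 0%N; rewrite /=; lra.
have hy : ya < ys < yb by have := hys 0%N; rewrite /=; lra.
have [d d0 Hd] := bad_limit x y l m e0 hx hy.
have [k kd] : exists k, (l + m) / 2 ^+ k <= d.
  have [k hk] : exists k, (l + m) / d <= k%:R by exists (Num.bound ((l + m) / d)); apply/ltW/archi_boundP; rewrite ltW// divr_gt0.
  exists k; rewrite ler_pdivrMr ?exprn_gt0// mulrC -ler_pdivrMr//.
  by rewrite (le_trans hk)// -natrX ler_nat ltnW// ltn_expl.
have [zi zB] := zb k.
have h2 : 0 < (2 ^+ k : R)^-1 by rewrite invr_gt0 exprn_gt0.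
have [l0 m0] : 0 < l /\ 0 < m by case: ins.
have lk : l / 2 ^+ k <= d by apply: le_trans kd; rewrite ler_pM2r// lerDl ltW.
have mk : m / 2 ^+ k <= d by apply: le_trans kd; rewrite ler_pM2r// lerDr ltW.
have := Hd _ _ _ _ zi; rewrite [X in X.1]z2 [X in X.2]z2 => /(_ lk mk).
by have := hxs k; have := hys k; move: zB; rewrite z2 /= => zB -> -> /(_ isT isT); rewrite leNgt zB.
Qed.

(** Phi integrates to the right and then upwards, which shows its y-derivative; by Goursat the path
    going upwards first gives the same value and shows the x-derivative. Only the quadrant beyond
    (x0, y0) is covered, because the segments have nonnegative length. *)
Lemma closed_form_primitive x0 y0 : xa < x0 < xb -> ya < y0 < yb ->
  exists Phi : R -> R -> R, forall x y, x0 < x < xb -> y0 < y < yb ->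
    is_derive x (1 : R) (Phi^~ y) (M x y) /\ is_derive y (1 : R) (Phi x) (N x y).
Proof.
move=> hx0 hy0.
exists (fun x y => segint (M^~ y0) x0 (x - x0) + segint (N x) y0 (y - y0)) => x y hx hy.
have D (f : R -> R) a b t : a < t < b -> (forall s, a <= s < b -> {for s, continuous f}) ->
    is_derive t (1 : R) (fun t => segint f a (t - a)) (f t).
  move=> abt cf; apply: (@segint_derive f a ((t + b) / 2)); first lra.
  by move=> s ?; apply: cf; lra.
have E x' : x0 < x' < xb -> segint (M^~ y0) x0 (x' - x0) + segint (N x') y0 (y - y0) =
    segint (M^~ y) x0 (x' - x0) + segint (N x0) y0 (y - y0).
  move=> hx'; have /contour_eq0 : inside x0 y0 (x' - x0) (y - y0) by split; try lra; split; lra.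
  rewrite /contour.
  have -> : x0 + (x' - x0) = x' by ring.
  have -> : y0 + (y - y0) = y by ring.
  by move=> ?; lra.
split.
- have H : is_derive x (1 : R) (fun x' => segint (M^~ y) x0 (x' - x0)) (M x y).
    apply: (D (M^~ y) x0 xb) => // s ?; apply: (@cM y); lra.
  move/is_derive_quotP: H => H; apply/is_derive_quotP => e e0.
  have ni : \forall h \near (0 : R), x0 < x + h < xb.
    pose r := Num.min (x - x0) (xb - x).
    have r0 : 0 < r by rewrite lt_min !subr_gt0.
    apply/nbhs_ballP; exists r => //= h.
    rewrite /ball /= sub0r normrN /r lt_min => /andP[].
    by rewrite !ltr_norml => ? ?; lra.
  apply: filterS2 ni (H e e0) => h xh.
  rewrite !E//; congr (`|_ - _| <= _); ring.
- have H : is_derive y (1 : R) (fun y' => segint (N x) y0 (y' - y0)) (N x y).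
    apply: (D (N x) y0 yb) => // s ?; apply: (@cN x); lra.
  move/is_derive_quotP: H => H; apply/is_derive_quotP => e e0.
  apply: filterS (H e e0) => h; congr (`|_ - _| <= _); ring.
Qed.

End Square.
End Goursat.

Lemma near_tube (R : realType) (T : topologicalType) (P : T -> R -> Prop) (p : T) :
  (forall t : R, 0 <= t <= 1 -> \forall q \near p & t' \near t, P q t') ->
  \forall q \near p, forall t : R, 0 <= t <= 1 -> P q t.
Proof.
move=> hc.
have /compact_near_coveringP/(_ T (nbhs p) P _) := @segment_compact R 0 1.
move=> H; have {H} : \forall q \near p, `[0, 1] `<=` P q.
  apply: H => t; rewrite /= in_itv /= => t01.
  have [[A B] /= [Ap Bt] AB] := hc t t01.
  by exists (B, A) => //= -[t' q] /= [Bt' Aq]; exact: (AB (q, t')).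
by apply: filterS => q H t t01; apply: H; rewrite /= in_itv.
Qed.

Lemma is_derive_shift (R : realType) (F : R -> R) (s l : R) :
  is_derive (0 : R) (1 : R) (fun t => F (s + t)) l -> is_derive s (1 : R) F l.
Proof.
move=> /is_derive_quotP H; apply/is_derive_quotP => e e0; move: (H e e0).
by apply: filterS => h; rewrite add0r addr0.
Qed.

(** * Circle averages and Cauchy's formula *)

Section Circle.
Context {R : realType}.
Implicit Types (s t r : R).

Definition cc s : R := cos (2 * pi * s).
Definition ss s : R := sin (2 * pi * s).
Definition ee s : Cx R := mkC (cc s) (ss s).

Lemma cc_derive s : is_derive s (1 : R) cc (- (2 * pi * ss s)).
Proof.
have := @is_derive1_comp R cos (fun s => 0 + s * (2 * pi)) s _ _ (is_derive_cos _) (affine_derive 0 (2 * pi) s).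
rewrite add0r [s * _]mulrC mulNr [sin _ * _]mulrC; congr is_derive.
by apply/funext => t; rewrite /= add0r mulrC.
Qed.

Lemma ss_derive s : is_derive s (1 : R) ss (2 * pi * cc s).
Proof.
have := @is_derive1_comp R sin (fun s => 0 + s * (2 * pi)) s _ _ (is_derive_sin _) (affine_derive 0 (2 * pi) s).
rewrite add0r [s * _]mulrC [cos _ * _]mulrC; congr is_derive.
by apply/funext => t; rewrite /= add0r mulrC.
Qed.

Lemma cc_continuous : continuous cc.
Proof. by move=> s; exact: is_derive_continuous (cc_derive s). Qed.

Lemma ss_continuous : continuous ss.
Proof. by move=> s; exact: is_derive_continuous (ss_derive s). Qed.

Lemma eeE s : ee s = rc (cc s) + rc (ss s) * 'i.
Proof. by rewrite [LHS]CxE. Qed.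

Lemma ee_continuous : continuous ee.
Proof.
move=> s; rewrite (_ : ee = fun s => rc (cc s) *: (1 : Cx R) + rc (ss s) *: ('i : Cx R)).
  suff : {for s, continuous (fun s : R => rc (cc s) *: (1 : Cx R) + rc (ss s) *: ('i : Cx R))} by [].
  apply: for_continuousD; apply: for_continuous_rcZ.
  - exact: cc_continuous.
  - exact: for_continuous_cst.
  - exact: ss_continuous.
  - exact: for_continuous_cst.
by apply/funext => t; rewrite eeE; congr (_ + _); rewrite -[RHS]/(rc (cc t) * 1) mulr1.
Qed.

Lemma cc2ss2 s : cc s * cc s + ss s * ss s = 1.
Proof. by rewrite -!expr2 cos2Dsin2. Qed.

Lemma norm_ee s : `|ee s| = 1.
Proof. by rewrite normc_def /= cos2Dsin2 sqrtr1. Qed.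

Lemma ccss01 : (cc 0 = 1 /\ ss 0 = 0) /\ (cc 1 = 1 /\ ss 1 = 0).
Proof.
rewrite /cc /ss mulr0 cos0 sin0 mulr1 mulrC -[pi * 2]/(pi * 2%:R) mulr_natr cos2pi.
by split=> //; split=> //; rewrite mulr2n sinD sinpi mul0r mulr0 addr0.
Qed.

Section WeightedAverage.
Variables (V : normedModType (Cx R)) (c : R -> V) (k1 k2 : R -> R).
Hypotheses (cc_ : continuous c) (ck1 : continuous k1) (ck2 : continuous k2).

(* Used both for circle averages (Cauchy formula) and for averages over a cycle
   of the elliptic curve (fibre integration). *)
Definition wavg (P Q : V -> R) (q : V) : R :=
  I01 (fun s => P (q + c s) * k1 s + Q (q + c s) * k2 s).

Let move_continuous (q : V) s : {for (q, s), continuous (fun z : V * R => z.1 + c z.2)}.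
Proof.
apply: for_continuousD; first exact: for_continuous_fst.
by apply: (@for_continuous_comp _ _ _ (@snd V R) c); [exact: for_continuous_snd|exact: cc_].
Qed.

Let integrand_continuous (P Q : V -> R) (q : V) s :
  {for (q + c s), continuous P} -> {for (q + c s), continuous Q} ->
  {for (q, s), continuous (fun z : V * R => P (z.1 + c z.2) * k1 z.2 + Q (z.1 + c z.2) * k2 z.2)}.
Proof.
move=> cP cQ; apply: for_continuousDR; apply: for_continuousMR.
- by apply: (@for_continuous_comp _ _ _ (fun z : V * R => z.1 + c z.2) P).
- by apply: (@for_continuous_comp _ _ _ (@snd V R) k1); [exact: for_continuous_snd|exact: ck1].
- by apply: (@for_continuous_comp _ _ _ (fun z : V * R => z.1 + c z.2) Q).
- by apply: (@for_continuous_comp _ _ _ (@snd V R) k2); [exact: for_continuous_snd|exact: ck2].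
Qed.

Let integrand_cont01 (P Q : V -> R) (q : V) :
  (forall s, 0 <= s <= 1 -> {for (q + c s), continuous P} /\ {for (q + c s), continuous Q}) ->
  cont01 (fun s => P (q + c s) * k1 s + Q (q + c s) * k2 s).
Proof.
move=> H s s01; have [cP cQ] := H s s01.
apply: (@for_continuous_comp _ _ _ (fun s => (q, s))
  (fun z : V * R => P (z.1 + c z.2) * k1 z.2 + Q (z.1 + c z.2) * k2 z.2)).
  by apply: for_continuous_pair; [exact: for_continuous_cst|exact: cvg_id].
exact: integrand_continuous.
Qed.

Lemma wavg_continuous (P Q : V -> R) (p : V) :
  (forall s, 0 <= s <= 1 -> \forall q \near p + c s, {for q, continuous P} /\ {for q, continuous Q}) ->
  {for p, continuous (wavg P Q)}.
Proof.
move=> H; apply: (@I01_continuous _ _ (fun q s => P (q + c s) * k1 s + Q (q + c s) * k2 s)).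
  have : \forall q \near p, forall s, 0 <= s <= 1 ->
      {for q + c s, continuous P} /\ {for q + c s, continuous Q}.
    by apply: near_tube => s /H; exact: move_continuous.
  by apply: filterS => q; exact: integrand_cont01.
move=> s /H/nbhs_singleton[cP cQ]; exact: integrand_continuous.
Qed.

Let near_C1 (P Q : V -> R) (p : V) :
  (forall s, 0 <= s <= 1 -> C1 P (p + c s) /\ C1 Q (p + c s)) ->
  \forall q \near p, forall s, 0 <= s <= 1 -> C1 P (q + c s) /\ C1 Q (q + c s).
Proof.
move=> H; apply: near_tube => s /H [cP cQ].
have HH : \forall q \near (p + c s), C1 P q /\ C1 Q q by apply: filterI; exact: C1_C1.
exact: move_continuous HH.
Qed.

Lemma wavg_dir (P Q : V -> R) (q u : V) :
  (forall s, 0 <= s <= 1 -> C1 P (q + c s) /\ C1 Q (q + c s)) ->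
  has_dir (wavg P Q) u q (wavg (dirderiv P u) (dirderiv Q u) q).
Proof.
move=> Hq0; have Hq := near_C1 Hq0.
pose F t s := P (q + rc t *: u + c s) * k1 s + Q (q + rc t *: u + c s) * k2 s.
pose F1 t s := dirderiv P u (q + rc t *: u + c s) * k1 s + dirderiv Q u (q + rc t *: u + c s) * k2 s.
have := @I01_derive R F F1 0.
have -> : I01 (F1 0) = wavg (dirderiv P u) (dirderiv Q u) q.
  by rewrite /wavg /F1 rc0 scale0r addr0.
have Hline := near_line u Hq.
apply.
- apply: filterS Hline => t Ht; apply: integrand_cont01 => s /Ht[cP cQ].
  by split; exact: C1_cont.
- apply: filterS Hline => t Ht s /Ht[cP cQ].
  have D (f : V -> R) : C1 f (q + rc t *: u + c s) -> is_derive t (1 : R)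
      (fun t => f (q + rc t *: u + c s)) (dirderiv f u (q + rc t *: u + c s)).
    move=> cf; have := has_dir_line f u (q + c s) t (dirderiv f u (q + rc t *: u + c s)).
    rewrite addrAC => -[+ _] => /(_ (C1_dir u cf)).
    by congr is_derive; apply/funext => t'; rewrite addrAC.
  have := is_deriveD (is_deriveM (D P cP) (is_derive_cst (k1 s) t 1))
     (is_deriveM (D Q cQ) (is_derive_cst (k2 s) t 1)).
  rewrite !scaler0 !add0r -![_ *: dirderiv _ _ _]/(_ * _) ![_ * dirderiv _ _ _]mulrC.
  exact.
- move=> s /Hq0[cP cQ].
  apply: (@for_continuous_comp _ _ _ (fun z : R * R => (q + rc z.1 *: u, z.2))
     (fun z : V * R => dirderiv P u (z.1 + c z.2) * k1 z.2 + dirderiv Q u (z.1 + c z.2) * k2 z.2)).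
    apply: for_continuous_pair; last exact: for_continuous_snd.
    apply: for_continuousD; first exact: for_continuous_cst.
    by apply: for_continuous_rcZ; [exact: for_continuous_fst|exact: for_continuous_cst].
  rewrite /= rc0 scale0r addr0.
  by apply: integrand_continuous; exact: C1_dcont.
Qed.

Lemma wavg_C1 (P Q : V -> R) (p : V) :
  (forall s, 0 <= s <= 1 -> C1 P (p + c s) /\ C1 Q (p + c s)) ->
  C1 (wavg P Q) p.
Proof.
move=> /near_C1 H1.
apply: (@C1_intro _ _ _ _ (fun u q => wavg (dirderiv P u) (dirderiv Q u) q)).
apply: filterS H1 => q Hq.
split.
  apply: wavg_continuous => s /Hq[cP cQ]; apply: filterS2 cP cQ => q' [cP _] [cQ _].
  by split.
move=> u; split; first exact: wavg_dir.
apply: wavg_continuous => s /Hq[cP cQ]; apply: filterS2 cP cQ => q' cP cQ.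
by split; [case: cP => _ /(_ u)[]|case: cQ => _ /(_ u)[]].
Qed.

End WeightedAverage.

(** With f = P + i Q the integrand is the real part of f(q + e(s) w) e(-s), e(s) being the point of
    angle 2 pi s: up to a factor 1 / r, this is Cauchy's integral for the derivative. *)
Definition circ (V : normedModType (Cx R)) (P Q : V -> R) (w q : V) : R :=
  wavg (fun s => ee s *: w) cc ss P Q q.

Let circ_curve (V : normedModType (Cx R)) (w : V) : continuous (fun s : R => ee s *: w).
Proof.
move=> s; apply: (@cvgZ _ _ _ _ _ ee (fun=> w)); last exact: cvg_cst.
exact: ee_continuous.
Qed.

Lemma circ_continuous (V : normedModType (Cx R)) (P Q : V -> R) (w p : V) :
  (forall s, 0 <= s <= 1 -> \forall q \near p + ee s *: w, {for q, continuous P} /\ {for q, continuous Q}) ->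
  {for p, continuous (circ P Q w)}.
Proof. exact: (@wavg_continuous V (fun s => ee s *: w) cc ss (@circ_curve V w) cc_continuous ss_continuous). Qed.

Lemma circ_C1 (V : normedModType (Cx R)) (P Q : V -> R) (w p : V) :
  (forall s, 0 <= s <= 1 -> C1 P (p + ee s *: w) /\ C1 Q (p + ee s *: w)) ->
  C1 (circ P Q w) p.
Proof. exact: (@wavg_C1 V (fun s => ee s *: w) cc ss (@circ_curve V w) cc_continuous ss_continuous). Qed.

Section CauchyFormula.
Variables (P Q : Cx R -> R) (w : Cx R) (rho : R).
Hypothesis PQ : forall z, `|z - w| < rc rho -> [/\ C1 P z, C1 Q z,
  dirderiv P 'i z = - dirderiv Q 1 z & dirderiv Q 'i z = dirderiv P 1 z].

Let inball (r s : R) : `|r| < rho -> `|w + ee s *: rc r - w| < rc rho.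
Proof.
move=> h; rewrite addrAC subrr add0r normrZ norm_ee mul1r norm_rc lt_rc.
exact: h.
Qed.

Let dirE (F : Cx R -> R) z (a b : R) : C1 F z ->
  dirderiv F (rc a + rc b * 'i) z = a * dirderiv F 1 z + b * dirderiv F 'i z.
Proof.
move=> cF; rewrite (dirderivD (Cx_frame) _ _ cF) -(dirderivZ Cx_frame _ _ cF) -(dirderivZ Cx_frame _ _ cF).
by rewrite -[rc a *: 1]/(rc a * 1) mulr1.
Qed.

Let dirEE (F : Cx R -> R) z s : C1 F z ->
  dirderiv F (ee s) z = cc s * dirderiv F 1 z + ss s * dirderiv F 'i z.
Proof. by move=> cF; rewrite eeE dirE. Qed.

(** K(r) / r is Cauchy's integral and m(r) the mean of dP/dx over the circle of radius r. From K' =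
    m and r m = K it follows that K(r) / r is constant, and its limit at 0 is m(0). *)
Let K (r : R) := circ P Q (rc r) w.
Let m (r : R) := I01 (fun s => dirderiv P 1 (w + ee s *: rc r)).

Let point_continuous (r s : R) :
  {for (r, s), continuous (fun z : R * R => w + ee z.2 *: rc z.1)}.
Proof.
apply: for_continuousD; first exact: for_continuous_cst.
apply: (@cvgZ _ _ _ _ _ (fun z : R * R => ee z.2) (fun z : R * R => rc z.1)).
  by apply: (@for_continuous_comp _ _ _ (@snd R R) ee); [exact: for_continuous_snd|exact: ee_continuous].
by apply: (@for_continuous_comp _ _ _ (@fst R R) rc); [exact: for_continuous_fst|exact: rc_continuous].
Qed.

Let cont_of (F : Cx R -> R) (r : R) : (forall s, {for (w + ee s *: rc r), continuous F}) ->
  forall s, {for s, continuous (fun s => F (w + ee s *: rc r))}.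
Proof.
move=> cF s; apply: (@for_continuous_comp _ _ _ (fun s => w + ee s *: rc r) F); last exact: cF.
apply: (@for_continuous_comp _ _ _ (fun s : R => (r, s)) (fun z : R * R => w + ee z.2 *: rc z.1)).
  by apply: for_continuous_pair; [exact: for_continuous_cst|exact: cvg_id].
exact: point_continuous.
Qed.

Let K_derive (r : R) : `|r| < rho -> is_derive r (1 : R) K (m r).
Proof.
move=> hr.
apply: (@I01_derive R (fun r s => P (w + ee s *: rc r) * cc s + Q (w + ee s *: rc r) * ss s)
  (fun r s => dirderiv P 1 (w + ee s *: rc r)) r).
- have : \forall r' \near r, `|r'| < rho.
    have : {for r, continuous (fun r : R => `|r|)} by exact: norm_continuous.
    move=> /cvgrPdist_lt/(_ (rho - `|r|)); rewrite subr_gt0 => /(_ hr).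
    apply: filterS => r' h; rewrite -(subrK `|r| `|r'|) -ltrBrDr.
    by apply: le_lt_trans h; rewrite distrC ler_norm.
  apply: filterS => r' hr' s _; apply: for_continuousDR; apply: for_continuousMR.
  + by apply: cont_of => s'; have [/C1_cont] := PQ (inball s' hr').
  + exact: cc_continuous.
  + by apply: cont_of => s'; have [_ /C1_cont] := PQ (inball s' hr').
  + exact: ss_continuous.
- have : \forall r' \near r, `|r'| < rho.
    have : {for r, continuous (fun r : R => `|r|)} by exact: norm_continuous.
    move=> /cvgrPdist_lt/(_ (rho - `|r|)); rewrite subr_gt0 => /(_ hr).
    apply: filterS => r' h; rewrite -(subrK `|r| `|r'|) -ltrBrDr.
    by apply: le_lt_trans h; rewrite distrC ler_norm.
  apply: filterS => r' hr' s _.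
  have [cP cQ PQ1 PQ2] := PQ (inball s hr').
  have D (f : Cx R -> R) : C1 f (w + ee s *: rc r') -> is_derive r' (1 : R)
      (fun t => f (w + ee s *: rc t)) (dirderiv f (ee s) (w + ee s *: rc r')).
    have sw (t : R) : ee s *: rc t = rc t *: ee s by exact: mulrC.
    move=> cf; rewrite (_ : (fun t => _) = fun t => f (w + rc t *: ee s)).
      by apply/has_dir_line; rewrite -sw; exact: C1_dir.
    by apply/funext => t; rewrite sw.
  have := is_deriveD (is_deriveM (D P cP) (is_derive_cst (cc s) r' 1))
     (is_deriveM (D Q cQ) (is_derive_cst (ss s) r' 1)).
  rewrite !scaler0 !add0r; congr is_derive.
  transitivity (cc s * dirderiv P (ee s) (w + ee s *: rc r') + ss s * dirderiv Q (ee s) (w + ee s *: rc r')).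
    by [].
  (* By the Cauchy-Riemann equations the radial derivative of the integrand reduces to dP/dx. *)
  rewrite (dirEE s cP) (dirEE s cQ) PQ1 PQ2.
  have -> (a b c d : R) : c * (c * a + d * - b) + d * (c * b + d * a) = (c * c + d * d) * a by ring.
  by rewrite cc2ss2 mul1r.
- move=> s _; apply: (@for_continuous_comp _ _ _ (fun z : R * R => w + ee z.2 *: rc z.1) (dirderiv P 1)).
    exact: point_continuous.
  by have [/C1_dcont] := PQ (inball s hr).
Qed.

Let rm_eq_K (r : R) : `|r| < rho -> r * m r = K r.
Proof.
move=> hr.
have cP1 : cont01 (fun s => dirderiv P 1 (w + ee s *: rc r)).
  by move=> s _; apply: cont_of => s'; have [/C1_dcont] := PQ (inball s' hr).
have ck : cont01 (fun s => P (w + ee s *: rc r) * cc s + Q (w + ee s *: rc r) * ss s).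
  move=> s _; apply: for_continuousDR; apply: for_continuousMR.
  - by apply: cont_of => s'; have [/C1_cont] := PQ (inball s' hr).
  - exact: cc_continuous.
  - by apply: cont_of => s'; have [_ /C1_cont] := PQ (inball s' hr).
  - exact: ss_continuous.
(* G is the imaginary part of f e(-s), whose real part is the integrand of K. It is periodic in s,
   so its derivative integrates to 0, and that derivative is 2 pi times the difference of the two
   integrands to be compared. *)
pose G s := Q (w + ee s *: rc r) * cc s - P (w + ee s *: rc r) * ss s.
pose dG s := (2 * pi) * (r * dirderiv P 1 (w + ee s *: rc r) -
   (P (w + ee s *: rc r) * cc s + Q (w + ee s *: rc r) * ss s)).
have cdG : cont01 dG.
  move=> s s01; apply: for_continuousMR; first exact: for_continuous_cst.
  apply: for_continuousDR; last by apply: for_continuousNR; exact: ck.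
  by apply: for_continuousMR; [exact: for_continuous_cst|exact: cP1].
have D (f : Cx R -> R) s : C1 f (w + ee s *: rc r) -> is_derive s (1 : R)
      (fun s => f (w + ee s *: rc r)) (2 * pi * r * dirderiv f (rc (- ss s) + rc (cc s) * 'i) (w + ee s *: rc r)).
  move=> cf; apply: is_derive_shift; rewrite -(dirderivZ Cx_frame _ _ cf).
  have := @C1_chain _ _ Cx_frame f (fun t => w + ee (s + t) *: rc r) (rc (2 * pi * r) *: (rc (- ss s) + rc (cc s) * 'i)).
  rewrite addr0; apply=> // -[].
    change (is_derive (0 : R) (1 : R) (fun t => cre (w + ee (s + t) *: rc r))
      (cre (rc (2 * pi * r) *: (rc (- ss s) + rc (cc s) * 'i)))).
    have -> : cre (rc (2 * pi * r) *: (rc (- ss s) + rc (cc s) * 'i)) = - (2 * pi * ss s) * r.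
      by rewrite -[_ *: _]/(_ * _) creZ creD creZ cre_i cre_rc; ring.
    have -> : (fun t => cre (w + ee (s + t) *: rc r)) = fun t => cre w + cc (s + t) * r.
      by apply/funext => t; rewrite creD -[ee _ *: _]/(ee _ * _) creM cre_rc cim_rc mulr0 subr0.
    have /is_derive_quotP H := @is_derive1_comp R (fun x => cre w + x * r) cc s _ _ (affine_derive _ _ _) (cc_derive s).
    apply/is_derive_quotP => e e0; move: (H e e0); apply: filterS => h /=.
    by rewrite add0r addr0 [r * _]mulrC.
  change (is_derive (0 : R) (1 : R) (fun t => cim (w + ee (s + t) *: rc r))
      (cim (rc (2 * pi * r) *: (rc (- ss s) + rc (cc s) * 'i)))).
  have -> : cim (rc (2 * pi * r) *: (rc (- ss s) + rc (cc s) * 'i)) = (2 * pi * cc s) * r.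
    by rewrite -[_ *: _]/(_ * _) cimZ cimD cimZ cim_i cim_rc; ring.
  have -> : (fun t => cim (w + ee (s + t) *: rc r)) = fun t => cim w + ss (s + t) * r.
    by apply/funext => t; rewrite cimD -[ee _ *: _]/(ee _ * _) cimM cre_rc cim_rc mulr0 add0r.
  have /is_derive_quotP H := @is_derive1_comp R (fun x => cim w + x * r) ss s _ _ (affine_derive _ _ _) (ss_derive s).
  apply/is_derive_quotP => e e0; move: (H e e0); apply: filterS => h /=.
  by rewrite add0r addr0 [r * _]mulrC.
have dGE s : 0 <= s <= 1 -> is_derive s (1 : R) G (dG s).
  move=> _; have [cP cQ PQ1 PQ2] := PQ (inball s hr).
  have := is_deriveB (is_deriveM (D Q s cQ) (cc_derive s)) (is_deriveM (D P s cP) (ss_derive s)).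
  congr is_derive; rewrite (dirE _ _ cP) (dirE _ _ cQ) PQ1 PQ2 /dG /GRing.scale /=.
  move: (P _) (Q _) (dirderiv P 1 _) (dirderiv Q 1 _) => p q dp dq.
  rewrite -[X in r * X](mul1r dp) -(cc2ss2 s); ring.
have := I01_FTC cdG dGE.
have [[c0 s0] [c1 s1]] := ccss01.
rewrite /G eeE c1 s1 eeE c0 s0 subrr.
rewrite I01Z; last first.
  move=> s s01; apply: for_continuousDR; last by apply: for_continuousNR; exact: ck.
  by apply: for_continuousMR; [exact: for_continuous_cst|exact: cP1].
rewrite I01B//; last first.
  by move=> s s01; apply: for_continuousMR; [exact: for_continuous_cst|exact: cP1].
have pp : 2 * pi != 0 :> R by rewrite mulf_neq0 ?pnatr_eq0// gt_eqF ?pi_gt0.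
rewrite I01Z// => /eqP; rewrite mulf_eq0 (negPf pp) /= subr_eq0 => /eqP.
by rewrite /K /circ /wavg /m.
Qed.

Lemma cauchy_formula (r : R) : 0 < r < rho ->
  dirderiv P 1 w = r^-1 * circ P Q (rc r) w.
Proof.
move=> /andP[r0 rrho]; rewrite -/(K r).
have rho0 : 0 < rho by exact: lt_trans rrho.
have K0 : K 0 = 0 by rewrite -rm_eq_K ?normr0// mul0r.
have m0 : m 0 = dirderiv P 1 w.
  by rewrite /m; under eq_fun do rewrite rc0 scaler0 addr0; rewrite I01_cst.
have Kc x : 0 < x <= r -> x^-1 * K x = r^-1 * K r.
  move=> /andP[x0 xr].
  have D y : x <= y <= r -> is_derive y (1 : R) (fun y => y^-1 * K y) 0.
    move=> hy; have y0 : 0 < y by lra.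
    have hy' : `|y| < rho by rewrite gtr0_norm; lra.
    have := is_deriveM (@is_deriveV R id y 1 1 (lt0r_neq0 y0) (is_derive_id y 1)) (K_derive hy').
    congr is_derive; rewrite -(rm_eq_K hy') /GRing.scale /=; field.
    exact: lt0r_neq0.
  have [||c] := @MVT_segment R (fun y => y^-1 * K y) (fun=> 0) x r xr.
  - by move=> y; rewrite in_itv /= => hy; apply: D; lra.
  - by apply: within_continuous_itv => y hy; apply: is_derive_continuous (D y hy).
  by move=> _ /eqP; rewrite mul0r subr_eq0 => /eqP.
apply/eqP; rewrite -subr_eq0 -normr_le0; apply/ler_addgt0Pr => e e0; rewrite add0r.
have := @K_derive 0; rewrite normr0 => /(_ rho0)/is_derive_quotP/(_ e e0).
move=> /nbhs_ballP[d /= d0 dH].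
(* A radius at most r, where K(x) / x equals K(r) / r, and less than d, where K(x) / x is within e
   of m(0). *)
pose x := Num.min (d / 2) r.
have x0 : 0 < x by rewrite lt_min r0 divr_gt0.
have xd : x < d by rewrite gt_min; apply/orP; left; lra.
have := dH x; rewrite /ball /= sub0r normrN (gtr0_norm x0) => /(_ xd).
rewrite add0r K0 subr0 m0 -(Kc x); last by rewrite x0 ge_min lexx orbT.
have -> : K x - x * dirderiv P 1 w = - (x * (dirderiv P 1 w - x^-1 * K x)).
  by field; exact: lt0r_neq0.
by rewrite normrN normrM (gtr0_norm x0) mulrC ler_pM2r.
Qed.

End CauchyFormula.
End Circle.

(** * Regularity of holomorphic functions *)

Section Holomorphic.
Context {R : realType}.

Lemma diff_quot (V : normedModType (Cx R)) (f : V -> Cx R) (q v : V) : differentiable f q ->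
  forall e : R, 0 < e -> exists2 d : R, 0 < d &
    forall h : Cx R, `|h| < rc d -> `|f (q + h *: v) - f q - h *: 'd f q v| <= rc e * `|h|.
Proof.
move=> df e e0; have := @diff_derivable _ _ _ f q v df.
rewrite /derivable -/(derive f q v) (deriveE v df) => /cvgrPdist_le/(_ (rc e)).
rewrite -rc0 lt_rc => /(_ e0) H.
have {}H : \forall h \near (0 : Cx R)^', `|'d f q v - h^-1 *: (f (h *: v + q) - f q)| <= rc e by [].
move: H; rewrite near_withinE => /nbhs_ballP[d' /= /gt0_rc[d d0 ->] H].
exists d => // h hd.
have [->|h0] := eqVneq h 0; first by rewrite !scale0r addr0 subrr subr0 normr0 mulr0.
have := H h; rewrite -ball_normE /= sub0r normrN => /(_ hd h0) {}H.
have -> : f (q + h *: v) - f q - h *: 'd f q v = - (h *: ('d f q v - h^-1 *: (f (h *: v + q) - f q))).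
  by rewrite scalerBr scalerA mulfV// scale1r opprB [q + _]addrC.
by rewrite normrN normrZ mulrC ler_wpM2r.
Qed.

Lemma diff_dir (V : normedModType (Cx R)) (f : V -> Cx R) (q v : V) : differentiable f q ->
  has_dir (fun z => cre (f z)) v q (cre ('d f q v)) /\
  has_dir (fun z => cim (f z)) v q (cim ('d f q v)).
Proof.
move=> df.
have H e : 0 < e -> \forall h \near (0 : R),
    `|f (q + rc h *: v) - f q - rc h *: 'd f q v| <= rc (e * `|h|).
  move=> e0; have [d d0 H] := diff_quot v df e0.
  apply/nbhs_ballP; exists d => // h; rewrite /ball /= sub0r normrN => hd.
  by rewrite rcM -norm_rc; apply: H; rewrite norm_rc lt_rc.
split; apply/has_dirP => e /H; apply: filterS => h; rewrite -le_rc; apply: le_trans.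
- apply: le_trans (norm_cre _); rewrite !creD !creN -[rc h *: 'd f q v]/(rc h * 'd f q v) creZ.
  by rewrite lexx.
- apply: le_trans (norm_cim _); rewrite !cimD !cimN -[rc h *: 'd f q v]/(rc h * 'd f q v) cimZ.
  by rewrite lexx.
Qed.

Lemma norm_mkC (x y : R) : `|mkC x y| <= rc (`|x| + `|y|).
Proof.
rewrite [mkC x y]CxE /cre /cim /= rcD (le_trans (ler_normD _ _))// normrM normCi mulr1.
by rewrite !norm_rc lexx.
Qed.

Lemma cre_mkC (x y : R) : cre (mkC x y) = x. Proof. by []. Qed.
Lemma cim_mkC (x y : R) : cim (mkC x y) = y. Proof. by []. Qed.
Lemma mkCD (x y x' y' : R) : mkC (x + x') (y + y') = mkC x y + mkC x' y'.
Proof. by []. Qed.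

Lemma diff_frechet2 (f : Cx R -> Cx R) (x y : R) : differentiable f (mkC x y) ->
  exists a b, frechet2 (fun x y => cre (f (mkC x y))) x y a (- b) /\
              frechet2 (fun x y => cim (f (mkC x y))) x y b a.
Proof.
move=> df; set l := 'd f (mkC x y) (1 : Cx R); exists (cre l), (cim l).
have H e : 0 < e -> exists2 d, 0 < d & forall h k : R, `|h| <= d -> `|k| <= d ->
    `|f (mkC (x + h) (y + k)) - f (mkC x y) - mkC h k * l| <= rc (e * (`|h| + `|k|)).
  move=> e0; have [d d0 H] := diff_quot (1 : Cx R) df e0.
  exists (d / 4); first by rewrite divr_gt0.
  move=> h k hd kd; rewrite mkCD.
  have hk : `|mkC h k| < rc d.
    by apply: le_lt_trans (norm_mkC h k) _; rewrite lt_rc; lra.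
  have := H _ hk; rewrite -[mkC h k *: 1]/(mkC h k * 1) mulr1 => /le_trans; apply.
  rewrite rcM; apply: ler_wpM2l; last exact: norm_mkC.
  by rewrite -rc0 le_rc ltW.
split=> e /H[d d0 {}H]; exists d => // h k hd kd; have := H h k hd kd;
  rewrite -le_rc; apply: le_trans.
- apply: le_trans (norm_cre _); rewrite !creD !creN creM cre_mkC cim_mkC.
  by have -> (a b c : R) : a * b + c * - cim l = a * b - c * cim l by move=> *; ring.
- apply: le_trans (norm_cim _); rewrite !cimD !cimN cimM cre_mkC cim_mkC.
  by [].
Qed.

Lemma holo_CR (g : Cx R -> Cx R) z : differentiable g z ->
  dirderiv (fun w => cre (g w)) 'i z = - dirderiv (fun w => cim (g w)) 1 z /\
  dirderiv (fun w => cim (g w)) 'i z = dirderiv (fun w => cre (g w)) 1 z.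
Proof.
move=> dg; have [/has_dirE -> /has_dirE ->] := diff_dir ('i : Cx R) dg.
have [/has_dirE -> /has_dirE ->] := diff_dir (1 : Cx R) dg.
have -> : 'd g z 'i = 'i * 'd g z 1.
  by rewrite -[in LHS](mulr1 ('i : Cx R)) -[_ * 1]/(_ *: (1 : Cx R)) linearZ.
by rewrite creM cimM cre_i cim_i; split; ring.
Qed.

(** Goursat yields a primitive F1 + i F2 of f. Its partial derivatives are those of a continuous f,
    so F1 and F2 are C1 and Cauchy's formula applies to them; it writes the real and imaginary parts
    of f as circle averages of C1 functions, which are C1. *)
Lemma holo_C1 (f : Cx R -> Cx R) w : (\forall z \near w, differentiable f z) ->
  C1 (fun z => cre (f z)) w /\ C1 (fun z => cim (f z)) w.
Proof.
move=> /nbhs_ballP[d' /= /gt0_rc[d d0 ->] fd].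
have {}fd z : `|z - w| < rc d -> differentiable f z.
  by move=> h; apply: fd; rewrite -ball_normE /= distrC.
pose x0 := cre w; pose y0 := cim w.
have near_w x y : `|x - x0| < d / 2 -> `|y - y0| < d / 2 -> `|mkC x y - w| < rc d.
  move=> hx hy; have -> : mkC x y - w = mkC (x - x0) (y - y0).
    by apply: Cx_eqP; rewrite ?creD ?cimD ?creN ?cimN.
  by apply: le_lt_trans (norm_mkC _ _) _; rewrite lt_rc; lra.
pose M x y := cre (f (mkC x y)); pose N x y := cim (f (mkC x y)).
have abs_itv (u v e : R) : u - e < v < u + e -> `|v - u| < e by move=> ?; rewrite ltr_norml; lra.
have fr x y : x0 - d / 2 < x < x0 + d / 2 -> y0 - d / 2 < y < y0 + d / 2 ->
    exists a b, frechet2 M x y a (- b) /\ frechet2 N x y b a.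
  by move=> hx hy; apply: diff_frechet2; apply: fd; apply: near_w; exact: abs_itv.
have frN (F : R -> R -> R) x y a b : frechet2 F x y a b -> frechet2 (fun x y => - F x y) x y (- a) (- b).
  move=> H e /H[r r0 {}H]; exists r => // h k hr kr; have := H h k hr kr.
  rewrite -normrN; congr (`|_| <= _); ring.
(* The primitive covers only points to the right of and above its base point, which is therefore
   placed at distance d / 4 to the left of and below w. *)
have hx1 : x0 - d / 2 < x0 - d / 4 < x0 + d / 2 by lra.
have hy1 : y0 - d / 2 < y0 - d / 4 < y0 + d / 2 by lra.
have [|Phi1 HPhi1] := @closed_form_primitive R M (fun x y => - N x y) (x0 - d / 2) (x0 + d / 2)
    (y0 - d / 2) (y0 + d / 2) _ _ _ hx1 hy1.
  move=> x y hx hy; have [a [b [H1 H2]]] := fr x y hx hy.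
  by exists a, (- b), (- a); split=> //; exact: frN.
have [|Phi2 HPhi2] := @closed_form_primitive R N M (x0 - d / 2) (x0 + d / 2)
    (y0 - d / 2) (y0 + d / 2) _ _ _ hx1 hy1.
  move=> x y hx hy; have [a [b [H1 H2]]] := fr x y hx hy.
  by exists b, a, (- b); split.
pose F1 (z : Cx R) := Phi1 (cre z) (cim z); pose F2 (z : Cx R) := Phi2 (cre z) (cim z).
have crew z e : `|z - w| < rc e -> `|cre z - x0| < e /\ `|cim z - y0| < e.
  move=> h; rewrite -!lt_rc; split.
    by apply: le_lt_trans h; apply: le_trans (norm_cre _); rewrite creD creN.
  by apply: le_lt_trans h; apply: le_trans (norm_cim _); rewrite cimD cimN.
have mkCE z : mkC (cre z) (cim z) = z by case: z.
have dirs (Phi : R -> R -> R) z (a b : R) :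
    is_derive (cre z) (1 : R) (Phi^~ (cim z)) a -> is_derive (cim z) (1 : R) (Phi (cre z)) b ->
    has_dir (fun z => Phi (cre z) (cim z)) 1 z a /\ has_dir (fun z => Phi (cre z) (cim z)) 'i z b.
  move=> /is_derive_quotP Ha /is_derive_quotP Hb; split; apply/has_dirP => e e0.
    move: (Ha e e0); apply: filterS => h.
    by rewrite creD cimD -[rc h *: 1]/(rc h * 1) mulr1 cre_rc cim_rc addr0.
  move: (Hb e e0); apply: filterS => h.
  by rewrite creD cimD -[rc h *: 'i]/(rc h * 'i) creZ cimZ cre_i cim_i mulr0 mulr1 addr0.
have FD z : `|z - w| < rc (d / 4) ->
   [/\ has_dir F1 1 z (cre (f z)), has_dir F1 'i z (- cim (f z)),
       has_dir F2 1 z (cim (f z)) & has_dir F2 'i z (cre (f z))].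
  move=> /crew[]; rewrite !ltr_norml => hx hy.
  have [||a1 a2] := HPhi1 (cre z) (cim z); [lra|lra|].
  have [||b1 b2] := HPhi2 (cre z) (cim z); [lra|lra|].
  have [c1 c2] := dirs Phi1 z _ _ a1 a2; have [d1 d2] := dirs Phi2 z _ _ b1 b2.
  by move: c1 c2 d1 d2; rewrite /M /N mkCE.
have near4 z e : `|z - w| < rc e -> \forall z' \near z, `|z' - w| < rc e.
  move=> h; apply/nbhs_ballP; exists (rc e - `|z - w|); first by rewrite /= subr_gt0.
  move=> z'; rewrite -ball_normE /= distrC => h'.
  rewrite -(subrK z z') -addrA (le_lt_trans (ler_normD _ _))//.
  by rewrite -ltrBrDr.
have cf z : `|z - w| < rc d -> {for z, continuous (fun z => cre (f z))} /\ {for z, continuous (fun z => cim (f z))}.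
  move=> /fd/differentiable_continuous cf; split.
    by apply: (@for_continuous_comp _ _ _ f cre) => //; exact: cre_continuous.
  by apply: (@for_continuous_comp _ _ _ f cim) => //; exact: cim_continuous.
have d4d z : `|z - w| < rc (d / 4) -> `|z - w| < rc d.
  by move=> /lt_trans; apply; rewrite lt_rc; lra.
have CF1 z : `|z - w| < rc (d / 4) -> C1 F1 z.
  move=> hz; apply: (@C1_of_partials _ _ Cx_frame _ _ (fun b z => if b then cre (f z) else - cim (f z))).
  apply: filterS (near4 _ _ hz) => q hq; have [H1 H2 _ _] := FD q hq.
  have [c1 c2] := cf q (d4d q hq).
  by case; split=> //; exact: for_continuousNR.
have CF2 z : `|z - w| < rc (d / 4) -> C1 F2 z.
  move=> hz; apply: (@C1_of_partials _ _ Cx_frame _ _ (fun b z => if b then cim (f z) else cre (f z))).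
  apply: filterS (near4 _ _ hz) => q hq; have [_ _ H1 H2] := FD q hq.
  have [c1 c2] := cf q (d4d q hq).
  by case; split.
have d8 z z' : `|z - w| < rc (d / 8) -> `|z' - z| < rc (d / 8) -> `|z' - w| < rc (d / 4).
  move=> h1 h2; rewrite -(subrK z z') -addrA (le_lt_trans (ler_normD _ _))//.
  have -> : d / 4 = d / 8 + d / 8 by field.
  by rewrite rcD ltrD.
(* With centres within d / 8 of w, circles of radius less than d / 8 stay in the disc of radius d /
   4 where F1 and F2 are primitives. *)
pose r := d / 16.
have r0 : 0 < r < d / 8 by rewrite /r; lra.
have cw s : `|w + ee s *: rc r - w| < rc (d / 4).
  rewrite addrAC subrr add0r normrZ norm_ee mul1r norm_rc lt_rc /r ger0_norm; lra.
have ww : `|w - w| < rc (d / 8) by rewrite subrr normr0 -rc0 lt_rc; lra.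
have zz (z : Cx R) : `|z - z| < rc (d / 8) by rewrite subrr normr0 -rc0 lt_rc; lra.
split.
- have H : \forall z \near w, r^-1 * circ F1 F2 (rc r) z = cre (f z).
    apply: filterS (near4 _ _ ww) => z hz.
    have [/has_dirE <- _ _ _] := FD z (d8 _ _ hz (zz z)).
    symmetry; apply: (@cauchy_formula _ F1 F2 z (d / 8)) => // z' hz'.
    have hz4 := d8 _ _ hz hz'; have [/has_dirE e1 /has_dirE e2 /has_dirE e3 /has_dirE e4] := FD z' hz4.
    by split; rewrite ?e1 ?e2 ?e3 ?e4//; [exact: CF1|exact: CF2].
  apply: C1_near H _; apply: C1Z; apply: circ_C1 => s _.
  by split; [exact: CF1|exact: CF2].
- have H : \forall z \near w, r^-1 * circ F2 (fun z => - F1 z) (rc r) z = cim (f z).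
    apply: filterS (near4 _ _ ww) => z hz.
    have [_ _ /has_dirE <- _] := FD z (d8 _ _ hz (zz z)).
    symmetry; apply: (@cauchy_formula _ F2 (fun z => - F1 z) z (d / 8)) => // z' hz'.
    have hz4 := d8 _ _ hz hz'.
    have [e1 e2 /has_dirE e3 /has_dirE e4] := FD z' hz4.
    have {}e1 := has_dirE (has_dirN e1); have {}e2 := has_dirE (has_dirN e2).
    by split; rewrite ?e1 ?e2 ?e3 ?e4 ?opprK//; [exact: CF2|apply: C1N; exact: CF1].
  apply: C1_near H _; apply: C1Z; apply: circ_C1 => s _.
  by split; [exact: CF2|apply: C1N; exact: CF1].
Qed.

Section MultiVariable.
Variables (V : normedModType (Cx R)) (f : V -> Cx R).

(** Cauchy's formula on the complex line through q with direction v. The radius r is the same for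
    all q near p, so that the formula can be differentiated in q. *)
Lemma holo_cauchy (p v : V) : (\forall q \near p, differentiable f q) ->
  exists2 r : R, (forall s, \forall q \near p + ee s *: (rc r *: v), differentiable f q) &
    \forall q \near p,
      dirderiv (fun z => cre (f z)) v q =
        r^-1 * circ (fun z => cre (f z)) (fun z => cim (f z)) (rc r *: v) q /\
      dirderiv (fun z => cim (f z)) v q =
        r^-1 * circ (fun z => cim (f z)) (fun z => - cre (f z)) (rc r *: v) q.
Proof.
move=> /near_near H.
have cm : {for (p, 0 : Cx R), continuous (fun m : V * Cx R => m.1 + m.2 *: v)}.
  apply: for_continuousD; first exact: for_continuous_fst.
  apply: (@cvgZ _ _ _ _ _ (fun m : V * Cx R => m.2) (fun=> v)); last exact: cvg_cst.
  exact: cvg_snd.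
have p0 : p = (p, 0 : Cx R).1 + (p, 0 : Cx R).2 *: v by rewrite /= scale0r addr0.
rewrite {1}p0 in H.
have [[A B] /= [Ap /nbhs_ballP[d' /= /gt0_rc[d d0 ->] dB]] AB] := cm _ H.
have {}AB q (z : Cx R) : A q -> `|z| < rc d -> \forall q' \near q + z *: v, differentiable f q'.
  move=> Aq zd; apply: (AB (q, z)); split=> //=; apply: dB.
  by rewrite /= sub0r normrN.
pose r := d / 2.
have rd : 0 < r < d by rewrite /r; lra.
exists r.
  move=> s; rewrite scalerA; apply: AB; first exact: nbhs_singleton Ap.
  by rewrite normrM norm_ee mul1r norm_rc lt_rc /r ger0_norm; lra.
apply: filterS Ap => q Aq.
pose g (z : Cx R) := f (q + z *: v).
have dg z : `|z| < rc d -> differentiable g z.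
  move=> zd; apply: (@differentiable_comp _ _ _ _ (fun z : Cx R => q + z *: v) f).
    apply: (@differentiableD _ _ _ (cst q) (fun z : Cx R => z *: v)).
      exact: differentiable_cst.
    by apply: differentiableZl; exact: ex_diff.
  exact: nbhs_singleton (AB q z Aq zd).
have near0 (z : Cx R) : `|z| < rc d -> \forall z' \near z, `|z'| < rc d.
  move=> h; apply/nbhs_ballP; exists (rc d - `|z|); first by rewrite /= subr_gt0.
  move=> z'; rewrite -ball_normE /= distrC => h'.
  rewrite -(subrK z z') (le_lt_trans (ler_normD _ _))//.
  by rewrite -ltrBrDr.
have cg z : `|z| < rc d -> C1 (fun z => cre (g z)) z /\ C1 (fun z => cim (g z)) z.
  by move=> zd; apply: holo_C1; apply: filterS (near0 z zd) => z'; exact: dg.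
have g0 : `|0 : Cx R| < rc d by rewrite normr0 -rc0 lt_rc.
have dirg (h : Cx R -> R) (l : R) : has_dir (fun z => h (g z)) (1 : Cx R) 0 l -> has_dir (fun z => h (f z)) v q l.
  move=> /has_dirP H1; apply/has_dirP => e e0; move: (H1 e e0); apply: filterS => t.
  by rewrite /g add0r scale0r addr0 -[rc t *: 1]/(rc t * 1) mulr1.
have circg (P Q : Cx R -> R) : circ (fun z => P (g z)) (fun z => Q (g z)) (rc r) 0 =
    circ (fun z => P (f z)) (fun z => Q (f z)) (rc r *: v) q.
  by apply: eq_I01 => s _; rewrite /g add0r scalerA.
have [cg1 cg2] := cg 0 g0.
split.
- rewrite (has_dirE (dirg cre _ (C1_dir (1 : Cx R) cg1))) -(circg cre cim).
  apply: (@cauchy_formula _ (fun z => cre (g z)) (fun z => cim (g z)) 0 d); last exact: rd.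
  move=> z; rewrite subr0 => zd; have [c1 c2] := cg z zd; have [e1 e2] := holo_CR (dg z zd).
  by split; [exact: c1|exact: c2|exact: e1|exact: e2].
- rewrite (has_dirE (dirg cim _ (C1_dir (1 : Cx R) cg2))) -(circg cim (fun z => - cre z)).
  apply: (@cauchy_formula _ (fun z => cim (g z)) (fun z => - cre (g z)) 0 d); last exact: rd.
  move=> z; rewrite subr0 => zd; have [c1 c2] := cg z zd; have [e1 e2] := holo_CR (dg z zd).
  rewrite (has_dirE (has_dirN (C1_dir (1 : Cx R) c1))) (has_dirE (has_dirN (C1_dir ('i : Cx R) c1))).
  by split; [exact: c2|exact: C1N c1|rewrite opprK e2|rewrite e1 opprK].
Qed.

(** Every directional derivative is a circle average of f itself, and averaging preserves both
    continuity and C1: continuity of f gives C1, which in turn gives C2. *)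
Lemma holo_smooth p : (\forall q \near p, differentiable f q) ->
  C2 (fun z => cre (f z)) p /\ C2 (fun z => cim (f z)) p.
Proof.
have cont q : differentiable f q ->
    {for q, continuous (fun z => cre (f z))} /\ {for q, continuous (fun z => cim (f z))}.
  move=> /differentiable_continuous cf; split.
    by apply: (@for_continuous_comp _ _ _ f cre) => //; exact: cre_continuous.
  by apply: (@for_continuous_comp _ _ _ f cim) => //; exact: cim_continuous.
have c1 q : (\forall q' \near q, differentiable f q') ->
    C1 (fun z => cre (f z)) q /\ C1 (fun z => cim (f z)) q.
  move=> /near_near H; split; apply: filterS H => {}q H;
    have dq := nbhs_singleton H; have [k1 k2] := cont q dq.
  - split=> // v; have [d1 d2] := diff_dir v dq; split; first exact: has_dir_derivable d1.
    have [r Hr Hq] := holo_cauchy v H.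
    apply: (@near_continuous _ _ (fun q => r^-1 * circ (fun z => cre (f z)) (fun z => cim (f z)) (rc r *: v) q)).
      by apply: filterS Hq => q' [-> _].
    apply: for_continuousMR; first exact: for_continuous_cst.
    by apply: circ_continuous => s _; apply: filterS (Hr s) => q'; exact: cont.
  - split=> // v; have [d1 d2] := diff_dir v dq; split; first exact: has_dir_derivable d2.
    have [r Hr Hq] := holo_cauchy v H.
    apply: (@near_continuous _ _ (fun q => r^-1 * circ (fun z => cim (f z)) (fun z => - cre (f z)) (rc r *: v) q)).
      by apply: filterS Hq => q' [_ ->].
    apply: for_continuousMR; first exact: for_continuous_cst.
    apply: circ_continuous => s _; apply: filterS (Hr s) => q' /cont[? ?].
    by split=> //; exact: for_continuousNR.
move=> H; have [a b] := c1 p H.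
split.
- split; first exact: a.
  move=> v; have [r Hr Hq] := holo_cauchy v H.
  apply: (@C1_near _ _ (fun q => r^-1 * circ (fun z => cre (f z)) (fun z => cim (f z)) (rc r *: v) q)).
    by apply: filterS Hq => q [-> _].
  by apply: C1Z; apply: circ_C1 => s _; exact: c1.
- split; first exact: b.
  move=> v; have [r Hr Hq] := holo_cauchy v H.
  apply: (@C1_near _ _ (fun q => r^-1 * circ (fun z => cim (f z)) (fun z => - cre (f z)) (rc r *: v) q)).
    by apply: filterS Hq => q [_ ->].
  apply: C1Z; apply: circ_C1 => s _; have [k1 k2] := c1 _ (Hr s).
  by split; [exact: k2|exact: C1N k1].
Qed.

End MultiVariable.
End Holomorphic.

(** * Locally conformally Kaehler potentials *)

Section ClosedForms.
Context {R : realType} {V : normedModType (Cx R)}.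
Variables (fr : frame V) (O : set V) (p0 : V).
Hypothesis oO : open O.
Hypothesis starO : forall p (t : R), O p -> 0 <= t <= 1 -> O (p0 + rc t *: (p - p0)).
Implicit Types (p q u v w : V) (s t : R).

Lemma star_const (F : V -> R) : (forall p v, O p -> has_dir F v p 0) ->
  forall p, O p -> F p = F p0.
Proof.
move=> H p Op; rewrite -{1}(subrK p0 p) addrC; apply: segment_const => t t01.
by apply: H; exact: starO.
Qed.

(** The primitive is the integral of th along the segment from p0; closedness turns the derivative
    of the integrand in a direction v into an exact derivative in t. *)
Lemma poincare (th : V -> V -> R) :
  (forall p v, O p -> C1 (th v) p) ->
  (forall p u v, O p -> th (u + v) p = th u p + th v p) ->
  (forall p t v, O p -> th (rc t *: v) p = t * th v p) ->
  (forall p u v, O p -> dirderiv (th u) v p = dirderiv (th v) u p) ->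
  exists F : V -> R, forall p, O p -> C1 F p /\ forall v, has_dir F v p (th v p).
Proof.
move=> thC thD thZ thc.
pose F p := I01 (fun t => th (p - p0) (p0 + rc t *: (p - p0))).
have FD p v : O p -> has_dir F v p (th v p).
  move=> Op.
  pose y s t := p0 + rc t *: (p - p0) + rc s *: (rc t *: v).
  have yE s t : p0 + rc t *: (p + rc s *: v - p0) = y s t.
    by rewrite /y addrAC scalerDr addrA scalerA mulrC -scalerA.
  have Oline : \forall s \near (0 : R), O (p + rc s *: v).
    by apply: near_line; apply: open_nbhs_nbhs; split.
  have Oy s t : O (p + rc s *: v) -> 0 <= t <= 1 -> O (y s t).
    by move=> Os t01; rewrite -yE; exact: starO.
  have O0 t : 0 <= t <= 1 -> O (y 0 t).
    by move=> t01; apply: Oy => //; rewrite rc0 scale0r addr0.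
  have y0 t : y 0 t = p0 + rc t *: (p - p0) by rewrite /y rc0 scale0r addr0.
  have cy s t : {for (s, t), continuous (fun z : R * R => y z.1 z.2)}.
    apply: for_continuousD; first apply: for_continuousD.
    - exact: for_continuous_cst.
    - by apply: for_continuous_rcZ; [exact: for_continuous_snd|exact: for_continuous_cst].
    - apply: for_continuous_rcZ; first exact: for_continuous_fst.
      by apply: for_continuous_rcZ; [exact: for_continuous_snd|exact: for_continuous_cst].
  (* The integrand of F at p + s v, split by linearity of th along (p - p0) + s v. *)
  pose f s t := th (p - p0) (y s t) + s * th v (y s t).
  pose f1 s t := t * dirderiv (th (p - p0)) v (y s t) + (th v (y s t) + s * (t * dirderiv (th v) v (y s t))).
  have cf1 s t : O (y s t) -> {for (s, t), continuous (fun z : R * R => f1 z.1 z.2)}.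
    move=> Ost; apply: for_continuousDR; first apply: for_continuousMR.
    - exact: for_continuous_snd.
    - apply: (@for_continuous_comp _ _ _ (fun z : R * R => y z.1 z.2) (dirderiv (th (p - p0)) v)).
        exact: cy.
      by apply: C1_dcont; exact: thC.
    - apply: for_continuousDR; last apply: for_continuousMR; last apply: for_continuousMR.
      + apply: (@for_continuous_comp _ _ _ (fun z : R * R => y z.1 z.2) (th v)); first exact: cy.
        by apply: C1_cont; exact: thC.
      + exact: for_continuous_fst.
      + exact: for_continuous_snd.
      + apply: (@for_continuous_comp _ _ _ (fun z : R * R => y z.1 z.2) (dirderiv (th v) v)).
          exact: cy.
        by apply: C1_dcont; exact: thC.
  have cyt s t : {for t, continuous (y s)}.
    apply: (@for_continuous_comp _ _ _ (fun t : R => (s, t)) (fun z : R * R => y z.1 z.2)); last exact: cy.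
    by apply: for_continuous_pair; [exact: for_continuous_cst|exact: cvg_id].
  have cf s : O (p + rc s *: v) -> cont01 (f s).
    move=> Os t t01; apply: for_continuousDR; last (apply: for_continuousMR; first exact: for_continuous_cst).
      apply: (@for_continuous_comp _ _ _ (y s) (th (p - p0))); first exact: cyt.
      by apply: C1_cont; apply: thC; exact: Oy.
    apply: (@for_continuous_comp _ _ _ (y s) (th v)); first exact: cyt.
    by apply: C1_cont; apply: thC; exact: Oy.
  have D (g : V -> R) s t : C1 g (y s t) -> is_derive s (1 : R) (fun s => g (y s t)) (t * dirderiv g v (y s t)).
    by move=> cg; rewrite -(dirderivZ fr _ _ cg); apply/has_dir_line; exact: C1_dir.
  have H1 : is_derive (0 : R) (1 : R) (fun s => I01 (f s)) (I01 (f1 0)).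
    apply: I01_derive.
    - by apply: filterS Oline => s; exact: cf.
    - apply: filterS Oline => s Os t t01; have Ost := Oy s t Os t01.
      have := is_deriveD (D _ s t (thC _ (p - p0) Ost)) (is_deriveM (is_derive_id s 1) (D _ s t (thC _ v Ost))).
      congr is_derive; rewrite /f1 /GRing.scale /=; congr (_ + _); rewrite addrC mulr1; congr (_ + _).
    - by move=> t t01; apply: cf1; exact: O0.
  have -> : th v p = I01 (f1 0).
    have c01 : cont01 (f1 0).
      move=> t t01; apply: (@for_continuous_comp _ _ _ (fun t : R => ((0 : R), t)) (fun z : R * R => f1 z.1 z.2)).
        by apply: for_continuous_pair; [exact: for_continuous_cst|exact: cvg_id].
      by apply: cf1; exact: O0.
    (* Here closedness enters: it exchanges the directions v and p - p0, and the latter is the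
       velocity of the segment. *)
    have dG t : 0 <= t <= 1 -> is_derive t (1 : R) (fun t => t * th v (p0 + rc t *: (p - p0))) (f1 0 t).
      move=> t01; have Ot := O0 t t01; rewrite /f1 mul0r addr0 y0 thc -?y0// y0.
      have h : is_derive t (1 : R) (fun t => th v (p0 + rc t *: (p - p0)))
          (dirderiv (th v) (p - p0) (p0 + rc t *: (p - p0))).
        by apply/has_dir_line; rewrite -y0; apply: C1_dir; exact: thC.
      have := is_deriveM (is_derive_id t 1) h.
      by congr is_derive; rewrite /GRing.scale /= mulr1.
    by rewrite (I01_FTC c01 dG) mul1r mul0r subr0 rc1 scale1r addrC subrK.
  move/is_derive_quotP : H1 => H1; apply/has_dirP => e e0.
  apply: filterS2 Oline (H1 e e0) => h Oh.
  have Ff s : O (p + rc s *: v) -> F (p + rc s *: v) = I01 (f s).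
    move=> Os; apply: eq_I01 => t t01; rewrite yE /f.
    have -> : p + rc s *: v - p0 = (p - p0) + rc s *: v by rewrite addrAC.
    by rewrite thD ?thZ//; exact: Oy.
  have <- : F p = I01 (f 0) by rewrite -Ff ?rc0 ?scale0r ?addr0.
  by rewrite add0r -Ff.
exists F => p Op; split=> [|v]; last exact: FD.
apply: (@C1_of_partials _ _ fr _ _ (fun k => th (fr_E k))).
have : \forall q \near p, O q by apply: open_nbhs_nbhs; split.
apply: filterS => q Oq k; split; first exact: FD.
by apply: C1_cont; exact: thC.
Qed.

End ClosedForms.

Section LCK.
Context {R : realType} {V : normedModType (Cx R)}.
Variables (fr : frame V) (O : set V) (p0 : V).
Hypothesis oO : open O.
Hypothesis starO : forall p (t : R), O p -> 0 <= t <= 1 -> O (p0 + rc t *: (p - p0)).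
Variable G : V -> V -> V -> R.
Hypothesis Gsym : forall p u v, O p -> G p u v = G p v u.
Hypothesis Glin : forall p (k : R) u v w, O p -> G p (rc k *: u + v) w = k * G p u w + G p v w.
Hypothesis GJ : forall p u v, O p -> G p (('i : Cx R) *: u) (('i : Cx R) *: v) = G p u v.
Hypothesis Gpos : forall p u, O p -> u != 0 -> 0 < G p u u.
Implicit Types (p q u v w : V) (s t : R) (rho F : V -> R).

Local Notation J := (fun u : V => ('i : Cx R) *: u).

Lemma JJ u : J (J u) = - u.
Proof. by rewrite /= scalerA -expr2 sqrCi scaleN1r. Qed.

Lemma GD p u v w : O p -> G p (u + v) w = G p u w + G p v w.
Proof. by move=> Op; have := Glin 1 u v w Op; rewrite rc1 scale1r mul1r. Qed.

Lemma G0l p w : O p -> G p 0 w = 0.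
Proof. by move=> Op; have := GD 0 0 w Op; rewrite addr0 => h; apply: (@addrI _ (G p 0 w)); rewrite addr0 -h. Qed.

Lemma GZ p t u w : O p -> G p (rc t *: u) w = t * G p u w.
Proof. by move=> Op; have := Glin t u 0 w Op; rewrite addr0 G0l// addr0. Qed.

Lemma GN p u w : O p -> G p (- u) w = - G p u w.
Proof. by move=> Op; rewrite -scaleN1r -rc1 -rcN GZ// mulN1r. Qed.

Lemma GDr p u v w : O p -> G p w (u + v) = G p w u + G p w v.
Proof. by move=> Op; rewrite !(Gsym w)// GD. Qed.

Lemma GZr p t u w : O p -> G p w (rc t *: u) = t * G p w u.
Proof. by move=> Op; rewrite !(Gsym w)// GZ. Qed.

Lemma GJl p u v : O p -> G p (J u) v = - G p u (J v).
Proof. by move=> Op; rewrite -GJ// JJ GN. Qed.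

Lemma GJu p u : O p -> G p (J u) u = 0.
Proof.
move=> Op; have h : G p (J u) u = - G p (J u) u by rewrite {1}GJl// Gsym.
by move: h; lra.
Qed.

Definition om rho u v q := expR (- rho q) * G q (J u) v.

Definition closed2 (o : V -> V -> V -> R) q := forall u v w,
  dirderiv (o v w) u q + dirderiv (o w u) v q + dirderiv (o u v) w q = 0.

(* [e^(-rho) G] is a Kaehler metric near [p]. *)
Definition lck_potential rho p := \forall q \near p, C2 rho q /\
  (forall u v, C1 (om rho u v) q) /\ closed2 (om rho) q.

(* The complex dimension is at least 2. *)
Hypothesis noncollinear : forall u, u != 0 -> exists w, forall c : Cx R, w != c *: u.

(** Gram-Schmidt against the real vectors u and J u; the result is nonzero because w is no complex
    multiple of u. *)
Lemma orthogonal_vector p u : O p -> u != 0 ->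
  exists2 v, v != 0 & G p u v = 0 /\ G p (J u) v = 0.
Proof.
move=> Op u0; have [w Hw] := noncollinear u0.
have Guu := Gpos Op u0; have Guu0 : G p u u != 0 by rewrite gt_eqF.
pose a := G p u w / G p u u; pose b := G p (J u) w / G p u u.
exists (w + (rc (- a) *: u + rc (- b) *: J u)).
  apply/negP; rewrite addr_eq0 => /eqP e.
  move: (Hw (rc a + rc b * 'i)); rewrite e; case/negP; apply/eqP.
  by rewrite opprD !rcN !scaleNr !opprK scalerDl scalerA.
split; rewrite !GDr// !GZr//.
  have -> : G p u (J u) = 0 by rewrite Gsym// GJu.
  by rewrite /a; field.
by rewrite GJu// GJ// /b; field.
Qed.

(* Two potentials differ by [eta] with [d eta /\ omega = 0]; evaluate this on
   [(u, v, J v)] with [v] orthogonal to the complex line of [u]. *)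
Lemma lck_unique rho rho' p u : O p -> lck_potential rho p -> lck_potential rho' p ->
  dirderiv rho u p = dirderiv rho' u p.
Proof.
move=> Op L L'; have [[cr _] [co clo]] := nbhs_singleton L.
have [[cr' _] [_ clo']] := nbhs_singleton L'.
have [->|u0] := eqVneq u 0.
  by rewrite -(scale0r 0) -rc0 !(dirderivZ fr)// !mul0r.
have [v v0 [v1 v2]] := orthogonal_vector Op u0.
pose eta q := rho q - rho' q.
have ceta : C1 eta p by exact: C1D cr (C1N cr').
have dom x y z : dirderiv (om rho' x y) z p =
    expR (eta p) * (dirderiv eta z p * om rho x y p + dirderiv (om rho x y) z p).
  have -> : om rho' x y = fun q => expR (eta q) * om rho x y q.
    by apply/funext => q; rewrite /om mulrA -expRD /eta addrAC subrr add0r.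
  have := has_dirM (has_dir_comp1 (C1_dir z ceta) (is_derive_expR _)) (C1_dir z (co x y)).
  by move/has_dirE => ->; ring.
have := clo' u v (J v); rewrite !dom -!mulrDr => /eqP.
rewrite mulf_eq0 gt_eqF ?expR_gt0//= => /eqP E.
have {}E : dirderiv eta u p * om rho v (J v) p + dirderiv eta v p * om rho (J v) u p
    + dirderiv eta (J v) p * om rho u v p = 0.
  by have := clo u v (J v); move: E; set A := dirderiv (om rho _ _) _ _;
     set B := dirderiv (om rho _ _) _ _; set C := dirderiv (om rho _ _) _ _; lra.
have o1 : om rho u v p = 0 by rewrite /om v2 mulr0.
have o2 : om rho (J v) u p = 0 by rewrite /om JJ GN// Gsym// v1 oppr0 mulr0.
have o3 : 0 < om rho v (J v) p by rewrite /om mulr_gt0 ?expR_gt0// GJ// Gpos.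
move: E; rewrite o1 o2 !mulr0 !addr0 => /eqP; rewrite mulf_eq0 (gt_eqF o3) orbF => /eqP.
have -> : dirderiv eta u p = dirderiv rho u p - dirderiv rho' u p.
  by apply: has_dirE; apply: has_dirB; exact: C1_dir.
by move=> /eqP; rewrite subr_eq0 => /eqP.
Qed.

End LCK.

(** * Integration of a closed 2-form over a cycle of the fibre *)

Section FibreIntegral.
Context {R : realType} {V : normedModType (Cx R)}.
Variables (fr : frame V) (O : set V) (p0 : V).
Hypothesis oO : open O.
Hypothesis Op0 : O p0.
Hypothesis starO : forall p (t : R), O p -> 0 <= t <= 1 -> O (p0 + rc t *: (p - p0)).
Implicit Types (p q u v w e : V) (s t : R).
Variable o : V -> V -> V -> R.
Hypothesis oC : forall p u v, O p -> C1 (o u v) p.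
Hypothesis oA : forall p u v, O p -> o u v p = - o v u p.
Hypothesis oD : forall p u v w, O p -> o w (u + v) p = o w u p + o w v p.
Hypothesis oZ : forall p t u w, O p -> o w (rc t *: u) p = t * o w u p.
Hypothesis oc : forall p, O p -> closed2 o p.
Variable e1 : V.
Hypothesis Oe1 : forall p t, O p -> O (p + rc t *: e1).
Hypothesis per1 : forall p u v, O p -> o u v (p + e1) = o u v p.

(** Contraction with e1 integrated over the cycle through p. The weights 1 and 0 make it an instance
    of [wavg], whose differentiation lemmas then apply. *)
Let tau v p := wavg (fun s => rc s *: e1) (fun=> 1) (fun=> 0) (o e1 v) (fun=> 0) p.

Let tauE v p : tau v p = I01 (fun s => o e1 v (p + rc s *: e1)).
Proof. by apply: eq_I01 => s _; rewrite mulr1 mulr0 addr0. Qed.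

Let curve : continuous (fun s : R => rc s *: e1).
Proof.
move=> s; suff : {for s, continuous (fun s : R => rc s *: e1)} by [].
by apply: for_continuous_rcZ; [exact: cvg_id|exact: for_continuous_cst].
Qed.

Let k_cont (k : R) : continuous (fun _ : R => k).
Proof. by move=> s; exact: cvg_cst. Qed.

Let tau_hyp v p : O p -> forall s : R, 0 <= s <= 1 ->
  C1 (o e1 v) (p + rc s *: e1) /\ C1 (fun=> 0) (p + rc s *: e1).
Proof. by move=> Op s _; split; [apply: oC; exact: Oe1|exact: C1_cst]. Qed.

Let tau_C1 v p : O p -> C1 (tau v) p.
Proof. by move=> Op; apply: wavg_C1; [exact: curve|exact: k_cont|exact: k_cont|exact: tau_hyp]. Qed.

Let cont_line (F : V -> R) p : (forall t, {for (p + rc t *: e1), continuous F}) ->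
  cont01 (fun s => F (p + rc s *: e1)).
Proof.
move=> cF s _; apply: (@for_continuous_comp _ _ _ (fun s : R => p + rc s *: e1) F); last exact: cF.
exact: line_continuous.
Qed.

Let tau_dir v u p : O p -> dirderiv (tau v) u p = I01 (fun s => dirderiv (o e1 v) u (p + rc s *: e1)).
Proof.
move=> Op.
have := @wavg_dir _ _ (fun s => rc s *: e1) (fun=> 1) (fun=> 0) curve (@k_cont 1) (@k_cont 0) _ _ p u (tau_hyp v Op).
move/has_dirE => ->; apply: eq_I01 => s _; rewrite mulr1.
by rewrite (has_dirE (has_dir_cst _ _ _)) mul0r addr0.
Qed.

(** By closedness of o the exterior derivative of the integrand is, up to sign, the derivative of o
    u v along e1, which integrates to 0 over a period. *)
Let tau_closed u v p : O p -> dirderiv (tau u) v p = dirderiv (tau v) u p.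
Proof.
move=> Op; rewrite (tau_dir u v Op) (tau_dir v u Op); apply/eqP; rewrite -subr_eq0; apply/eqP.
have cd x y z : cont01 (fun s => dirderiv (o x y) z (p + rc s *: e1)).
  by apply: cont_line => t; apply: C1_dcont; apply: oC; exact: Oe1.
rewrite -I01B//.
have -> : I01 (fun s => dirderiv (o e1 u) v (p + rc s *: e1) - dirderiv (o e1 v) u (p + rc s *: e1)) =
    I01 (fun s => -1 * dirderiv (o u v) e1 (p + rc s *: e1)).
  apply: eq_I01 => s _; have Os := Oe1 s Op; have := oc Os v e1 u.
  have -> : dirderiv (o v e1) u (p + rc s *: e1) = - dirderiv (o e1 v) u (p + rc s *: e1).
    apply: has_dirE; apply: (@has_dir_near _ _ (fun q => - o e1 v q)).
      by apply: filterS (open_nbhs_nbhs (conj oO Os)) => q Oq; rewrite (oA v e1 Oq).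
    by apply: has_dirN; apply: C1_dir; exact: oC.
  by move=> h; lra.
rewrite I01Z//.
have d s : 0 <= s <= 1 -> is_derive s (1 : R) (fun s => o u v (p + rc s *: e1)) (dirderiv (o u v) e1 (p + rc s *: e1)).
  by move=> _; apply/has_dir_line; apply: C1_dir; apply: oC; exact: Oe1.
by rewrite (I01_FTC (cd u v e1) d) rc1 rc0 scale1r scale0r addr0 per1// subrr mulr0.
Qed.

Lemma fibre_primitive : exists A : V -> R, forall p, O p -> C1 A p /\
  forall v, has_dir A v p (I01 (fun s => o e1 v (p + rc s *: e1))).
Proof.
have co x y p : O p -> cont01 (fun s => o x y (p + rc s *: e1)).
  by move=> Op; apply: cont_line => t; apply: C1_cont; apply: oC; exact: Oe1.
have [||||A HA] := @poincare R V fr O p0 oO starO tau.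
- by move=> p v Op; exact: tau_C1.
- move=> p u v Op; rewrite !tauE -I01D//; [|exact: co|exact: co].
  by apply: eq_I01 => s _; apply: oD; exact: Oe1.
- move=> p t v Op; rewrite !tauE -I01Z//; last exact: co.
  by apply: eq_I01 => s _; apply: oZ; exact: Oe1.
- by move=> p u v Op; exact: tau_closed.
exists A => p Op; have [cA dA] := HA p Op; split=> // v.
by rewrite -tauE.
Qed.

Section Periods.
Variable A : V -> R.
Hypothesis HA : forall p, O p -> C1 A p /\
  forall v, has_dir A v p (I01 (fun s => o e1 v (p + rc s *: e1))).

(** The derivative of A along e1 is the integral of o e1 e1, which antisymmetry makes 0. *)
Lemma fibre_period1 p : O p -> A (p + e1) = A p.
Proof.
move=> Op; apply: segment_const => t _; have [_ /(_ e1)] := HA (Oe1 t Op).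
have -> // : I01 (fun s => o e1 e1 (p + rc t *: e1 + rc s *: e1)) = 0.
rewrite -[RHS](I01_cst (R := R)); apply: eq_I01 => s _.
by have := oA e1 e1 (Oe1 s (Oe1 t Op)) => h; lra.
Qed.

Lemma has_dir_translate (F : V -> R) e v p (l : R) :
  has_dir F v (p + e) l -> has_dir (fun q => F (q + e)) v p l.
Proof.
move=> /has_dirP H; apply/has_dirP => r r0; move: (H r r0); apply: filterS => h.
by rewrite [p + rc h *: v + e]addrAC.
Qed.

Lemma translate_const (F : V -> R) e : (forall p, O p -> O (p + e)) ->
  (forall p v, O p -> exists2 l, has_dir F v p l & has_dir F v (p + e) l) ->
  forall p, O p -> F (p + e) = F p + (F (p0 + e) - F p0).
Proof.
move=> Oe H p Op.
have E : F (p + e) - F p = F (p0 + e) - F p0.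
  apply: (@star_const R V O p0 starO (fun q => F (q + e) - F q)) => // q v Oq.
  have [l l1 l2] := H q v Oq.
  by rewrite -(subrr l); apply: has_dirB => //; exact: has_dir_translate.
by rewrite -E addrCA subrr addr0.
Qed.

(** [sg] carries the sign of o e1 e2. By the mean value theorem the period is an integral of o e1 e2
    over some translated cycle, hence nonzero; it is the same at every p because the differential of
    A is e2-periodic and O is star-shaped. *)
Lemma fibre_period2 e2 (sg : R) :
  (forall p t, O p -> O (p + rc t *: e2)) ->
  (forall p u v, O p -> o u v (p + e2) = o u v p) ->
  (forall p, O p -> 0 < sg * o e1 e2 p) ->
  exists2 c : R, c != 0 & forall p, O p -> A (p + e2) = A p + c.
Proof.
move=> Oe2 per2 pos; have Oe p : O p -> O (p + e2).
  by move=> Op; have := Oe2 p 1 Op; rewrite rc1 scale1r.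
exists (A (p0 + e2) - A p0).
  have [|t t01 ->] := @seg_MVT R V A (fun t => I01 (fun s => o e1 e2 (p0 + rc t *: e2 + rc s *: e1))) p0 e2.
    by move=> t _; have [_] := HA (Oe2 p0 t Op0); apply.
  have co : cont01 (fun s => o e1 e2 (p0 + rc t *: e2 + rc s *: e1)).
    by apply: cont_line => s; apply: C1_cont; apply: oC; apply: Oe1; exact: Oe2.
  suff : 0 < sg * I01 (fun s => o e1 e2 (p0 + rc t *: e2 + rc s *: e1)).
    by apply: contraTneq => ->; rewrite mulr0 ltxx.
  rewrite -I01Z//; apply: I01_gt0.
    by move=> s s01; apply: for_continuousMR; [exact: for_continuous_cst|exact: co].
  by move=> s _; apply: pos; apply: Oe1; exact: Oe2.
apply: translate_const => // p v Op.
exists (I01 (fun s => o e1 v (p + rc s *: e1))); first by case: (HA Op).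
have [_ /(_ v)] := HA (Oe p Op); congr has_dir; apply: eq_I01 => s _.
by rewrite addrAC per2//; exact: Oe1.
Qed.

End Periods.
End FibreIntegral.

(** * Pullback of closed 2-forms under C2 maps *)

Section Pullback.
Context {R : realType} {V W : normedModType (Cx R)}.
Variables (fr : frame W) (Phi : V -> W) (dP : V -> V -> W) (N : set V) (M : set W).
Variable B : W -> W -> W -> R.
Hypothesis oN : open N.
Hypothesis NM : forall q, N q -> M (Phi q).
Hypothesis cPhi : forall q, N q -> {for q, continuous Phi}.
Hypothesis Phi2 : forall k q, N q -> C2 (fun q => fr_e (f:=fr) k (Phi q)) q.
Hypothesis PhiD : forall k q v, N q ->
  has_dir (fun q => fr_e (f:=fr) k (Phi q)) v q (fr_e (f:=fr) k (dP q v)).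
Hypothesis BD1 : forall x y w z, M z -> B (x + y) w z = B x w z + B y w z.
Hypothesis BZ1 : forall t x w z, M z -> B (rc t *: x) w z = t * B x w z.
Hypothesis BA : forall x y z, M z -> B x y z = - B y x z.
Hypothesis BC : forall x y z, M z -> C1 (B x y) z.
Hypothesis Bc : forall z, M z -> closed2 B z.
Implicit Types (p q u v w : V) (x y z : W).

Local Notation e := (fr_e (f:=fr)).
Local Notation E := (fr_E (f:=fr)).

Let nearN q : N q -> \forall q' \near q, N q'.
Proof. by move=> Nq; apply: open_nbhs_nbhs; split. Qed.

Let B0 (w : W) z : M z -> B 0 w z = 0.
Proof. by move=> Mz; have := BZ1 0 0 w Mz; rewrite rc0 scale0r mul0r. Qed.

Lemma form_suml (a : fr_I fr -> R) (w : W) z : M z ->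
  B (\sum_k rc (a k) *: E k) w z = \sum_k a k * B (E k) w z.
Proof.
move=> Mz; elim/big_ind2 : _ => [|x s y t h1 h2|k _]; first exact: B0.
  by rewrite BD1// h1 h2.
exact: BZ1.
Qed.

Lemma form_sumr (a : fr_I fr -> R) (w : W) z : M z ->
  B w (\sum_k rc (a k) *: E k) z = \sum_k a k * B w (E k) z.
Proof.
move=> Mz; rewrite BA// form_suml// -sumrN; apply: eq_bigr => k _.
by rewrite (BA w)// mulrN.
Qed.

Let BD2 x y (w : W) z : M z -> B w (x + y) z = B w x z + B w y z.
Proof. by move=> Mz; rewrite !(BA w)// BD1// opprD. Qed.

Definition pullback2 u v q := B (dP q u) (dP q v) (Phi q).

Lemma compose_dir (f : W -> R) q v : N q -> C1 f (Phi q) ->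
  has_dir (fun q => f (Phi q)) v q (dirderiv f (dP q v) (Phi q)).
Proof.
move=> Nq cf; have := @C1_chain _ _ fr f (fun t => Phi (q + rc t *: v)) (dP q v).
rewrite rc0 scale0r addr0; apply=> // k.
exact: (PhiD k v Nq).
Qed.

Lemma coord_C1 k v q : N q -> C1 (fun q => e k (dP q v)) q.
Proof.
move=> Nq; have [_ /(_ v)] := Phi2 k Nq; apply: C1_near.
by apply: filterS (nearN Nq) => q' Nq'; exact: (has_dirE (PhiD k v Nq')).
Qed.

Lemma compose_C1 (f : W -> R) q : N q -> C1 f (Phi q) -> C1 (fun q => f (Phi q)) q.
Proof.
move=> Nq cf.
have H : \forall q' \near q, N q' /\ C1 f (Phi q').
  apply: filterI; first exact: nearN.
  by have := cPhi Nq (C1_C1 cf).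
apply: (@C1_intro _ _ _ _ (fun v q => \sum_k e k (dP q v) * dirderiv f (E k) (Phi q))).
apply: filterS H => {Nq cf}q [Nq cf]; split.
  by apply: (@for_continuous_comp _ _ _ Phi f); [exact: cPhi|exact: C1_cont].
move=> v; split; first by rewrite -(dirderiv_frame fr _ cf); exact: compose_dir.
apply: for_continuous_sumR => k; apply: for_continuousMR.
  by apply: C1_cont; exact: coord_C1.
apply: (@for_continuous_comp _ _ _ Phi (dirderiv f (E k))); first exact: cPhi.
exact: C1_dcont.
Qed.

Lemma compose_C2 (f : W -> R) q : N q -> C2 f (Phi q) -> C2 (fun q => f (Phi q)) q.
Proof.
move=> Nq [cf c2]; split=> [|v]; first exact: compose_C1.
apply: (@C1_near _ _ (fun q => \sum_k e k (dP q v) * dirderiv f (E k) (Phi q))).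
  have H : \forall q' \near q, N q' /\ C1 f (Phi q').
    apply: filterI; first exact: nearN.
    by have := cPhi Nq (C1_C1 cf).
  apply: filterS H => q' [Nq' cf'].
  by rewrite (has_dirE (compose_dir v Nq' cf')) (dirderiv_frame fr _ cf').
apply: C1_sum => k; apply: C1M; first exact: coord_C1.
exact: compose_C1.
Qed.

Lemma pullback2_C1 u v q : N q -> C1 (pullback2 u v) q.
Proof.
move=> Nq.
apply: (@C1_near _ _ (fun q => \sum_k e k (dP q u) * (\sum_l e l (dP q v) * B (E k) (E l) (Phi q)))).
  apply: filterS (nearN Nq) => q' Nq'; have Mz := NM Nq'.
  rewrite /pullback2 {2}(fr_sum fr (dP q' u)) form_suml//; apply: eq_bigr => k _.
  by rewrite {2}(fr_sum fr (dP q' v)) form_sumr.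
apply: C1_sum => k; apply: C1M; first exact: coord_C1.
apply: C1_sum => l; apply: C1M; first exact: coord_C1.
by apply: compose_C1 => //; apply: BC; exact: NM.
Qed.

(** The second derivative of Phi in the directions u and w, as a vector of W; its symmetry is what
    makes d commute with pullback. *)
Definition second_dir w u q := \sum_k rc (dirderiv (fun q => e k (dP q u)) w q) *: E k.

Lemma second_dirC w u q : N q -> second_dir w u q = second_dir u w q.
Proof.
move=> Nq; apply: eq_bigr => k _; congr (rc _ *: _).
have d (x y : V) : dirderiv (fun q => e k (dP q x)) y q = dirderiv (dirderiv (fun q => e k (Phi q)) x) y q.
  apply/esym/has_dirE; apply: (@has_dir_near _ _ (fun q => e k (dP q x))).
    by apply: filterS (nearN Nq) => q' Nq'; rewrite (has_dirE (PhiD k x Nq')).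
  by apply: C1_dir; exact: coord_C1.
by rewrite !d; apply: schwarz; exact: Phi2.
Qed.

Lemma pullback2_dir u v w q : N q ->
  dirderiv (pullback2 u v) w q = dirderiv (B (dP q u) (dP q v)) (dP q w) (Phi q)
    + (B (second_dir w u q) (dP q v) (Phi q) + B (dP q u) (second_dir w v q) (Phi q)).
Proof.
move=> Nq; set x := dP q u; set y := dP q v.
(* The vectors dP q' u and dP q' v are expanded around their values x and y at q. The coefficients
   vanish at q, so the terms quadratic in them have derivative 0 there. *)
pose a k q' := e k (dP q' u) - e k x; pose c k q' := e k (dP q' v) - e k y.
have da k : has_dir (a k) w q (dirderiv (fun q => e k (dP q u)) w q).
  rewrite -[X in has_dir _ _ _ X]subr0; apply: has_dirB; last exact: has_dir_cst.
  by apply: C1_dir; exact: coord_C1.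
have dc k : has_dir (c k) w q (dirderiv (fun q => e k (dP q v)) w q).
  rewrite -[X in has_dir _ _ _ X]subr0; apply: has_dirB; last exact: has_dir_cst.
  by apply: C1_dir; exact: coord_C1.
have a0 k : a k q = 0 by rewrite /a subrr.
have c0 k : c k q = 0 by rewrite /c subrr.
have dB x' y' : has_dir (fun q => B x' y' (Phi q)) w q (dirderiv (B x' y') (dP q w) (Phi q)).
  by apply: compose_dir => //; apply: BC; exact: NM.
have expand : \forall q' \near q,
    B x y (Phi q') + (\sum_k a k q' * B (E k) y (Phi q') + (\sum_l c l q' * B x (E l) (Phi q')
      + \sum_k a k q' * (\sum_l c l q' * B (E k) (E l) (Phi q')))) = pullback2 u v q'.
  apply: filterS (nearN Nq) => q' Nq'; have Mz := NM Nq'.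
  have xE : dP q' u = x + \sum_k rc (a k q') *: E k.
    by rewrite {1}(frame_expand fr x (dP q' u)); under eq_bigr do rewrite fr_eB.
  have yE : dP q' v = y + \sum_k rc (c k q') *: E k.
    by rewrite {1}(frame_expand fr y (dP q' v)); under eq_bigr do rewrite fr_eB.
  rewrite /pullback2 xE yE BD1// !BD2// !form_suml// !form_sumr//.
  have -> : \sum_k a k q' * B (E k) (\sum_k0 rc (c k0 q') *: E k0) (Phi q') =
    \sum_k a k q' * (\sum_l c l q' * B (E k) (E l) (Phi q')).
    by apply: eq_bigr => k _; rewrite form_sumr.
  by ring.
apply: has_dirE; apply: has_dir_near expand _.
apply: has_dirD; first exact: dB.
rewrite /second_dir form_suml ?form_sumr; [|exact: NM|exact: NM].
apply: has_dirD.
  apply: has_dir_sum => k; have := has_dirM (da k) (dB (E k) y).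
  by rewrite a0 mul0r add0r mulrC.
rewrite -[X in has_dir _ _ _ X]addr0; apply: has_dirD.
  apply: has_dir_sum => k; have := has_dirM (dc k) (dB x (E k)).
  by rewrite c0 mul0r add0r mulrC.
have dg k : has_dir (fun q' => \sum_l c l q' * B (E k) (E l) (Phi q')) w q
    (\sum_l dirderiv (fun q => e l (dP q v)) w q * B (E k) (E l) (Phi q)).
  apply: has_dir_sum => l; have := has_dirM (dc l) (dB (E k) (E l)).
  by rewrite c0 mul0r add0r mulrC.
have Z : \sum_(k : fr_I fr) (0 : R) = 0 by rewrite big1.
rewrite -[X in has_dir _ _ _ X]Z.
apply: has_dir_sum => k; have := has_dirM (da k) (dg k).
by rewrite a0 mul0r add0r big1 ?mul0r// => l _; rewrite c0 mul0r.
Qed.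

(** In the cyclic sum the second order terms cancel in pairs, by symmetry of [second_dir] and
    antisymmetry of B. *)
Lemma pullback2_closed q : N q -> closed2 pullback2 q.
Proof.
move=> Nq u v w; rewrite !pullback2_dir//; have Mz := NM Nq.
rewrite (second_dirC v u Nq) (second_dirC w v Nq) (second_dirC w u Nq).
have := Bc Mz (dP q u) (dP q v) (dP q w).
rewrite (BA (dP q v) (second_dir u w q))// (BA (dP q w) (second_dir u v q))//.
rewrite (BA (dP q u) (second_dir v w q))//.
set x1 := dirderiv _ _ _; set x2 := dirderiv _ _ _; set x3 := dirderiv _ _ _ => h.
by rewrite -h; ring.
Qed.

End Pullback.

Lemma near_diff_val (K : numFieldType) (V W : normedModType K) (f g : V -> W) (p v : V) :
  (\forall q \near p, f q = g q) -> differentiable f p -> differentiable g p ->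
  'd f p v = 'd g p v.
Proof. by move=> fg df dg; rewrite -!deriveE//; exact: near_eq_derive. Qed.

Section CkPointwise.
Context {R : realType} {V : normedModType (Cx R)}.

Lemma Ck1_C1 (D : set V) (f : V -> R) (z : V) : Ck 1 D f -> (\forall z' \near z, D z') -> C1 f z.
Proof.
move=> [cf df]; apply: filterS => q Dq; split; first exact: cf.
by move=> v; have [d1 [d2 _]] := df v; split; [exact: d1|exact: d2].
Qed.

Lemma Ck2_C2 (D : set V) (f : V -> R) (z : V) : Ck 2 D f -> (\forall z' \near z, D z') -> C2 f z.
Proof.
move=> [cf df] Dz; split=> [|v]; last by apply: (Ck1_C1 _ Dz); case: (df v).
apply: (@Ck1_C1 D) => //; split=> // v; have [d1 [d2 _]] := df v.
by split.
Qed.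

End CkPointwise.

Lemma has_dir_frame (R : realType) (V W : normedModType (Cx R)) (fr : frame W) (S : V -> W)
    (k : fr_I fr) (q v : V) : differentiable S q ->
  has_dir (fun q => fr_e (f:=fr) k (S q)) v q (fr_e (f:=fr) k ('d S q v)).
Proof.
move=> dS; rewrite -deriveE//.
have D : (fun h : Cx R => h^-1 *: (S (h *: v + q) - S q)) @ (0 : Cx R)^' --> 'D_v S q.
  exact: (@diff_derivable _ _ _ S q v dS).
have Crc : rc @ (0 : R)^' --> (0 : Cx R)^'.
  move=> A; rewrite /dnbhs /within /= => HA.
  have : \forall h \near (0 : R), rc h != 0 -> A (rc h).
    have c := @rc_continuous R 0; rewrite /continuous_at rc0 in c.
    exact: (c (fun z => z != 0 -> A z) HA).
  by apply: filterS => h Hh h0; apply: Hh; rewrite -rc0; apply: contra_neq h0; exact: (congr1 cre).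
have C : {for 'D_v S q, continuous (fr_e (f:=fr) k)} by exact: fr_ec.
have H := continuous_cvg _ C (cvg_comp _ _ Crc D).
have H' : (fun h : R => h^-1 *: (((fun q => fr_e (f:=fr) k (S q)) \o real_line q v \o shift 0) (h *: 1)
    - ((fun q => fr_e (f:=fr) k (S q)) \o real_line q v) 0)) @ (0 : R)^' --> fr_e (f:=fr) k ('D_v S q).
  rewrite (_ : (fun h : R => _) = fun h : R => fr_e (f:=fr) k ((rc h)^-1 *: (S (rc h *: v + q) - S q)));
    first exact: H.
  apply/funext => h; rewrite /= real_line0 addr0 /real_line [q + _]addrC.
  rewrite -[h%:A]/(h * 1) mulr1 -fr_eB /GRing.scale /= -fr_eZ; congr (fr_e _ (_ *: _)).
  by rewrite /rc fmorphV.
by apply: DeriveDef; [apply: cvgP H'|apply: cvg_lim H'].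
Qed.

(** * Pullback of the metric along a real parametrization of X *)

Section ChartParam.
Variables (R : realType) (m : nat) (X : topologicalType).
Local Notation W := 'rV[Cx R]_m.
Variable SX : complex_structure X W.
Variable g : metric R m X.
Hypothesis hg : hermitian_on SX setT g.
Implicit Types (a b : chart X W).
Local Notation e := (fr_e (f := rV_frame m)).

(** Choosing one chart per point turns intrinsic quantities into plain functions; [pull_formE] then
    allows a fixed chart to be used on a neighbourhood. *)
Definition chart_at (x : X) : chart X W := s2val (cid2 (cs_cover SX x)).

Lemma chart_at_atlas x : atlas SX (chart_at x).
Proof. exact: s2valP (cid2 (cs_cover SX x)). Qed.

Lemma chart_at_dom x : chart_dom (chart_at x) x.
Proof. exact: s2valP' (cid2 (cs_cover SX x)). Qed.

Lemma rV_frame_eq (u v : W) : (forall k : fr_I (rV_frame m), e k u = e k v) -> u = v.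
Proof. by move=> E; rewrite (fr_sum (rV_frame m) u) (fr_sum (rV_frame m) v); apply: eq_bigr => k _; rewrite E. Qed.

Lemma holo_frame_C2 (V : normedModType (Cx R)) (f : V -> W) (q : V) (k : fr_I (rV_frame m)) :
  (\forall q' \near q, differentiable f q') -> C2 (fun q => e k (f q)) q.
Proof.
move=> df; have H j : \forall q' \near q, differentiable (fun q => f q 0 j) q'.
  apply: filterS df => q' df.
  exact: (@differentiable_comp _ _ _ _ f (fun M : W => M 0 j) q' df (differentiable_coord _ _ _)).
case: k => j b; have [h1 h2] := holo_smooth (H j).
by case: b; [exact: h1|exact: h2].
Qed.

Definition lck_on (U : set X) (f : X -> R) := exists gU : metric R m X,
  [/\ open U, kahler_on SX U gU, smooth_fun SX U f &
      forall a y, atlas SX a -> U y -> chart_dom a y ->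
        forall u v : W, g a y u v = expR (f y) * gU a y u v].

Section Param.
Variables (V : normedModType (Cx R)) (fr : frame V) (O : set V) (phi : V -> X).
Hypothesis oO : open O.
Hypothesis phi_c : forall p, O p -> {for p, continuous phi}.
Hypothesis phi2 : forall p a k, O p -> atlas SX a -> chart_dom a (phi p) ->
  C2 (fun q => e k (chart_map a (phi q))) p.
Implicit Types (p q u v w : V).

(** The real differential of phi read in the chart a. It is assembled from real derivatives because
    phi is only C2 and need not be holomorphic. *)
Definition dchart a p v : W := \row_j mkC
  (dirderiv (fun q => cre (chart_map a (phi q) 0 j)) v p)
  (dirderiv (fun q => cim (chart_map a (phi q) 0 j)) v p).

Lemma dchart_dir a p v k : O p -> atlas SX a -> chart_dom a (phi p) ->
  has_dir (fun q => e k (chart_map a (phi q))) v p (e k (dchart a p v)).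
Proof.
move=> Op aA ap; have [c1 _] := phi2 k Op aA ap; have := C1_dir v c1.
by case: k {c1} => j [] /=; rewrite /dchart mxE.
Qed.

Lemma dchart_unique a p v (x : W) :
  (forall k, has_dir (fun q => e k (chart_map a (phi q))) v p (e k x)) -> dchart a p v = x.
Proof.
move=> H; apply: rV_frame_eq => -[j b].
have := has_dirE (H (j, b)); case: b => /= <-; by rewrite /dchart mxE.
Qed.

Lemma near_dom p a (U : set X) : O p -> atlas SX a -> chart_dom a (phi p) -> open U -> U (phi p) ->
  \forall q \near p, [/\ O q, chart_dom a (phi q) & U (phi q)].
Proof.
move=> Op aA ap oU Up.
have h1 : \forall q \near p, O q by apply: open_nbhs_nbhs; split.
have h2 : \forall q \near p, (chart_dom a `&` U) (phi q).
  apply: phi_c => //; apply: open_nbhs_nbhs; split=> //.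
  by apply: openI => //; exact: cs_open_dom aA.
by apply: filterS2 h1 h2 => q Oq [].
Qed.

Let chart_cont a p : O p -> atlas SX a -> chart_dom a (phi p) ->
  {for p, continuous (fun q => chart_map a (phi q))}.
Proof.
move=> Op aA ap; apply: (@for_continuous_comp _ _ _ phi (chart_map a)); first exact: phi_c.
exact: cs_continuous_map aA _ ap.
Qed.

Lemma near_transition_diff a b x : atlas SX a -> atlas SX b -> chart_dom a x -> chart_dom b x ->
  \forall z \near chart_map a x, differentiable (transition a b) z.
Proof.
move=> aA bA ax bx.
have h1 : \forall z \near chart_map a x, chart_img a z.
  by apply: open_nbhs_nbhs; split; [exact: cs_open_img aA|exists x].
have az : chart_img a (chart_map a x) by exists x.
have h2 : \forall z \near chart_map a x, chart_dom b (chart_inv a z).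
  apply: (cs_continuous_inv aA az); apply: open_nbhs_nbhs; split; first exact: cs_open_dom bA.
  by rewrite (cs_mapK aA ax).
apply: filterS2 h1 h2 => _ [y ay <-]; rewrite (cs_mapK aA ay) => yb.
exact: cs_transition aA bA _ ay yb.
Qed.

Lemma dchart_transition p a b v : O p -> atlas SX a -> atlas SX b ->
  chart_dom a (phi p) -> chart_dom b (phi p) ->
  'd (transition a b) (chart_map a (phi p)) (dchart a p v) = dchart b p v.
Proof.
move=> Op aA bA ap bp; symmetry; apply: dchart_unique => k.
have dt := near_transition_diff aA bA ap bp.
have [cT _] := holo_frame_C2 k dt.
have D := has_dir_frame k (dchart a p v) (nbhs_singleton dt).
rewrite -(has_dirE D).
apply: (@has_dir_near _ _ (fun q => e k (transition a b (chart_map a (phi q))))).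
  apply: filterS (near_dom Op aA ap openT I) => q [Oq aq _].
  by rewrite /transition /= (cs_mapK aA aq).
have PhiD (k' : fr_I (rV_frame m)) q u : [set p] q ->
    has_dir (fun q => e k' (chart_map a (phi q))) u q (e k' (dchart a q u)).
  by move=> ->; exact: dchart_dir.
exact: (@compose_dir _ _ _ (rV_frame m) (fun q => chart_map a (phi q)) (dchart a) [set p] PhiD
  (fun z => e k (transition a b z)) p v (erefl p) cT).
Qed.

Lemma dchartD a p u v : O p -> atlas SX a -> chart_dom a (phi p) ->
  dchart a p (u + v) = dchart a p u + dchart a p v.
Proof.
move=> Op aA ap; apply: dchart_unique => k; rewrite fr_eD.
have [c1 _] := phi2 k Op aA ap.
by rewrite -!(has_dirE (dchart_dir _ k Op aA ap)) -(dirderivD fr _ _ c1); exact: C1_dir.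
Qed.

Lemma dchartZ a p t u : O p -> atlas SX a -> chart_dom a (phi p) ->
  dchart a p (rc t *: u) = rc t *: dchart a p u.
Proof.
move=> Op aA ap; apply: dchart_unique => k; rewrite fr_eZ.
have [c1 _] := phi2 k Op aA ap.
by rewrite -!(has_dirE (dchart_dir _ k Op aA ap)) -(dirderivZ fr _ _ c1); exact: C1_dir.
Qed.

(** The pullback of Omega(u, v) = g(J u, v), with J acting on the tangent vectors of X and not on
    those of V. *)
Definition pull_form p u v : R :=
  g (chart_at (phi p)) (phi p) (('i : Cx R) *: dchart (chart_at (phi p)) p u) (dchart (chart_at (phi p)) p v).

Lemma pull_formE p a u v : O p -> atlas SX a -> chart_dom a (phi p) ->
  pull_form p u v = g a (phi p) (('i : Cx R) *: dchart a p u) (dchart a p v).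
Proof.
move=> Op aA ap; rewrite /pull_form.
have cA := chart_at_atlas (phi p); have cd := chart_at_dom (phi p).
rewrite (herm_change hg cA aA I cd ap) linearZ /=.
by rewrite (dchart_transition u Op cA aA cd ap) (dchart_transition v Op cA aA cd ap).
Qed.

Let Gx (x : X) (u v : W) := g (chart_at x) x u v.
Let Gsym x (u v : W) : setT x -> Gx x u v = Gx x v u.
Proof. by move=> _; apply: (herm_sym hg) => //; [exact: chart_at_atlas|exact: chart_at_dom]. Qed.
Let Glin x (k : R) (u v w : W) : Gx x (rc k *: u + v) w = k * Gx x u w + Gx x v w.
Proof. by apply: (herm_linear hg) => //; [exact: chart_at_atlas|exact: chart_at_dom]. Qed.
Let GJ x (u v : W) : Gx x (('i : Cx R) *: u) (('i : Cx R) *: v) = Gx x u v.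
Proof. by apply: (herm_J hg) => //; [exact: chart_at_atlas|exact: chart_at_dom]. Qed.

Definition pom (F : V -> R) u v p := expR (- F p) * pull_form p u v.

Lemma pull_form_anti u v p : pull_form p u v = - pull_form p v u.
Proof.
rewrite /pull_form -/(Gx _ _ _) -/(Gx _ _ _); set x := phi p; set u' := dchart _ _ u; set v' := dchart _ _ v.
have G0 (w : W) : Gx x 0 w = 0.
  by have := Glin x 0 0 0 w; rewrite rc0 scaler0 addr0 mul0r add0r => h; have := Glin x 1 0 0 w;
     rewrite scaler0 addr0 mul1r; lra.
have GN (s t : W) : Gx x (- s) t = - Gx x s t.
  have := Glin x (-1) s 0 t; rewrite G0 rcN rc1 scaleN1r !addr0 mulN1r; exact.
by rewrite -GJ scalerA -expr2 sqrCi scaleN1r GN Gsym.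
Qed.

Lemma pull_formD u v w p : O p -> pull_form p w (u + v) = pull_form p w u + pull_form p w v.
Proof.
move=> Op; rewrite /pull_form dchartD//; [|exact: chart_at_atlas|exact: chart_at_dom].
rewrite -/(Gx _ _ _) -/(Gx _ _ _) -/(Gx _ _ _) Gsym// -[X in Gx _ (X + _)]scale1r -rc1 Glin mul1r.
by rewrite Gsym// (Gsym (dchart _ _ v)).
Qed.

Lemma pull_formZ t u w p : O p -> pull_form p w (rc t *: u) = t * pull_form p w u.
Proof.
move=> Op; rewrite /pull_form dchartZ//; [|exact: chart_at_atlas|exact: chart_at_dom].
rewrite -/(Gx _ _ _) -/(Gx _ _ _) Gsym//.
have := Glin (phi p) t (dchart (chart_at (phi p)) p u) 0 ('i *: dchart (chart_at (phi p)) p w).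
have := Glin (phi p) 1 0 0 ('i *: dchart (chart_at (phi p)) p w).
rewrite scaler0 !addr0 mul1r => h -> ; rewrite (Gsym (dchart _ _ u))//; lra.
Qed.

Lemma pull_form_pos p v : dchart (chart_at (phi p)) p v != 0 ->
  dchart (chart_at (phi p)) p (('i : Cx R) *: v) = ('i : Cx R) *: dchart (chart_at (phi p)) p v ->
  0 < pull_form p v (('i : Cx R) *: v).
Proof.
move=> v0 vi; rewrite /pull_form vi -/(Gx _ _ _) GJ.
by apply: (herm_pos hg) => //; [exact: chart_at_atlas|exact: chart_at_dom].
Qed.

Section Local.
Variables (U : set X) (f : X -> R) (a : chart X W) (gU : metric R m X).
Hypothesis aA : atlas SX a.
Hypothesis oU : open U.
Hypothesis kU : kahler_on SX U gU.
Hypothesis sf : smooth_fun SX U f.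
Hypothesis gf : forall b y, atlas SX b -> U y -> chart_dom b y ->
  forall u v : W, g b y u v = expR (f y) * gU b y u v.

Let N : set V := [set q | [/\ O q, chart_dom a (phi q) & U (phi q)]].
Let M : set W := [set z | chart_img a z /\ U (chart_inv a z)].
Let Phi := chart_map a \o phi.
Let B x y z := fundamental_form gU a x y z.

Let oN : open N.
Proof. by rewrite openE => q [Oq aq Uq]; exact: (near_dom Oq aA aq oU Uq). Qed.

Let oM : open M.
Proof.
rewrite openE => z [az Uz].
have h1 : \forall z' \near z, chart_img a z'.
  by apply: open_nbhs_nbhs; split=> //; exact: cs_open_img aA.
have h2 : \forall z' \near z, U (chart_inv a z').
  by apply: (cs_continuous_inv aA az); apply: open_nbhs_nbhs; split.
exact: (filterI h1 h2).
Qed.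

Let nearM z : M z -> \forall z' \near z, (chart_map a @` (U `&` chart_dom a)) z'.
Proof.
move=> Mz; apply: filterS (open_nbhs_nbhs (conj oM Mz)) => z' [[x ax <-] Ux].
by exists x => //; split=> //; rewrite (cs_mapK aA ax) in Ux.
Qed.

Let Mpt z : M z -> exists x, [/\ U x, chart_dom a x, chart_inv a z = x & z = chart_map a x].
Proof.
by move=> [[x ax <-] Ux]; exists x; rewrite (cs_mapK aA ax) in Ux *.
Qed.

Let NM q : N q -> M (Phi q).
Proof.
by move=> [Oq aq Uq]; split; [exists (phi q)|rewrite /Phi /= (cs_mapK aA aq)].
Qed.

Let cPhi q : N q -> {for q, continuous Phi}.
Proof. by move=> [Oq aq _]; exact: chart_cont. Qed.

Let Phi2 (k : fr_I (rV_frame m)) q : N q -> C2 (fun q => e k (Phi q)) q.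
Proof. by move=> [Oq aq _]; exact: phi2. Qed.

Let PhiD (k : fr_I (rV_frame m)) q v : N q -> has_dir (fun q => e k (Phi q)) v q (e k (dchart a q v)).
Proof. by move=> [Oq aq _]; exact: dchart_dir. Qed.

Let gU_herm := kU.1.

Let BD1 x y (w z : W) : M z -> B (x + y) w z = B x w z + B y w z.
Proof.
move=> /Mpt[x' [Ux ax e _]]; rewrite /B /fundamental_form e scalerDr.
have := herm_linear gU_herm aA Ux ax 1 (('i : Cx R) *: x) (('i : Cx R) *: y) w.
by rewrite -/(rc 1) rc1 scale1r mul1r.
Qed.

Let gU0 x (w : W) : U x -> chart_dom a x -> gU a x 0 w = 0.
Proof.
move=> Ux ax; have := herm_linear gU_herm aA Ux ax 1 0 0 w.
by rewrite -/(rc 1) rc1 scale1r mul1r addr0 => h; apply: (@addrI _ (gU a x 0 w)); rewrite addr0 -h.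
Qed.

Let BZ1 (t : R) x (w z : W) : M z -> B (rc t *: x) w z = t * B x w z.
Proof.
move=> /Mpt[x' [Ux ax e _]]; rewrite /B /fundamental_form e.
have -> : ('i : Cx R) *: (rc t *: x) = rc t *: (('i : Cx R) *: x) by rewrite !scalerA mulrC.
have := herm_linear gU_herm aA Ux ax t (('i : Cx R) *: x) 0 w.
by rewrite addr0 gU0// addr0.
Qed.

Let BA x y (z : W) : M z -> B x y z = - B y x z.
Proof.
move=> Mz; have [x' [Ux ax e _]] := Mpt Mz.
have neg (s t : W) : gU a x' (- s) t = - gU a x' s t.
  have := herm_linear gU_herm aA Ux ax (-1) s 0 t.
  by rewrite -/(rc (-1)) rcN rc1 scaleN1r addr0 gU0// addr0 mulN1r.
rewrite /B /fundamental_form e -(herm_J gU_herm aA Ux ax) scalerA -expr2 sqrCi scaleN1r neg.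
by rewrite (herm_sym gU_herm aA Ux ax).
Qed.

Let BC x y (z : W) : M z -> C1 (B x y) z.
Proof.
move=> Mz; apply: (Ck1_C1 _ (nearM Mz)).
exact: (herm_smooth gU_herm aA (('i : Cx R) *: x) y 1%N).
Qed.

Let Bc z : M z -> closed2 B z.
Proof.
move=> /Mpt[x [Ux ax _ e]] u v w; rewrite e.
exact: kU.2.
Qed.

(** The factor e^f in g cancels, so that e^(-f) times the pulled back form is the pullback of the
    Kaehler form of [gU]; its regularity and closedness come from the pullback lemmas. *)
Lemma potential_local_chart p : O p -> chart_dom a (phi p) -> U (phi p) ->
  [/\ C2 (f \o phi) p, forall u v, C1 (pom (f \o phi) u v) p & closed2 (pom (f \o phi)) p].
Proof.
move=> Op ap Up; have Np : N p by split.
have omE q u v : N q -> pom (f \o phi) u v q = pullback2 Phi (dchart a) B u v q.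
  move=> [Oq aq Uq]; rewrite /pom (pull_formE _ _ Oq aA aq) (gf aA Uq aq) mulrA -expRD addNr expR0 mul1r.
  by rewrite /pullback2 /B /fundamental_form /Phi /= (cs_mapK aA aq).
have nearom u v : \forall q \near p, pullback2 Phi (dchart a) B u v q = pom (f \o phi) u v q.
  by apply: filterS (open_nbhs_nbhs (conj oN Np)) => q Nq; rewrite omE.
have C u v : C1 (pullback2 Phi (dchart a) B u v) p.
  exact: (pullback2_C1 oN NM cPhi Phi2 PhiD BD1 BZ1 BA BC).
split.
- have : C2 (fun q => (f \o chart_inv a) (Phi q)) p.
    apply: (compose_C2 oN cPhi Phi2 PhiD Np).
    exact: (Ck2_C2 (sf aA 2%N) (nearM (NM Np))).
  move=> [h1 h2].
  have E : \forall q \near p, (f \o chart_inv a) (Phi q) = (f \o phi) q.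
    apply: filterS (open_nbhs_nbhs (conj oN Np)) => q [Oq aq Uq].
    by rewrite /Phi /= (cs_mapK aA aq).
  split; first exact: C1_near E h1.
  move=> v; apply: C1_near (h2 v).
  apply: filterS2 (near_near E) (C1_C1 h1) => q Eq cq.
  by rewrite (has_dirE (has_dir_near Eq (C1_dir v cq))).
- by move=> u v; exact: C1_near (nearom u v) (C u v).
- move=> u v w.
  have := pullback2_closed oN NM Phi2 PhiD BD1 BZ1 BA BC Bc Np u v w.
  have d x y z : dirderiv (pom (f \o phi) x y) z p = dirderiv (pullback2 Phi (dchart a) B x y) z p.
    by apply: has_dirE; apply: has_dir_near (nearom x y) _; apply: C1_dir; exact: C.
  by rewrite !d.
Qed.

End Local.

Lemma potential_local U f p : lck_on U f -> O p -> U (phi p) ->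
  [/\ C2 (f \o phi) p, forall u v, C1 (pom (f \o phi) u v) p & closed2 (pom (f \o phi)) p].
Proof.
move=> [gU [oU kU sf gf]] Op Up.
have aA := chart_at_atlas (phi p); have ad := chart_at_dom (phi p).
exact: (potential_local_chart aA oU kU sf gf Op ad Up).
Qed.

End Param.
End ChartParam.

(** * Periods and Cech classes *)

Section LatticeCoordinates.
Context {R : realType}.
Variables (w1 w2 : Cx R).
Hypothesis lat : forall a b : R, rc a * w1 + rc b * w2 = 0 -> a = 0 /\ b = 0.

Let det : R := cre w1 * cim w2 - cim w1 * cre w2.

Lemma lattice_det : det != 0.
Proof.
apply/eqP => d0.
have e1 : rc (cre w2) * w1 + rc (- cre w1) * w2 = 0.
  by apply: Cx_eqP; rewrite ?creD ?cimD ?creZ ?cimZ; [rewrite /cre /=; ring|];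
     rewrite -[RHS]oppr0 -d0 /det; ring.
have e2 : rc (cim w2) * w1 + rc (- cim w1) * w2 = 0.
  apply: Cx_eqP; rewrite ?creD ?cimD ?creZ ?cimZ.
    by rewrite -[RHS]d0 /det; ring.
  by rewrite -[RHS]/(0 : R); ring.
have [r2 r1] := lat e1; have [i2 i1] := lat e2.
have w10 : w1 = 0.
  apply: Cx_eqP; first by apply/eqP; rewrite -oppr_eq0 r1.
  by apply/eqP; rewrite -oppr_eq0 i1.
have [] := @lat 1 0; first by rewrite w10 mulr0 rc0 mul0r addr0.
by move=> /eqP; rewrite oner_eq0.
Qed.

(** Real coordinates in the basis (w1, w2), by Cramer's rule. *)
Definition lat1 (z : Cx R) : R := (cre z * cim w2 - cim z * cre w2) / det.
Definition lat2 (z : Cx R) : R := (cre w1 * cim z - cim w1 * cre z) / det.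

Lemma lat1D z z' : lat1 (z + z') = lat1 z + lat1 z'.
Proof. by rewrite /lat1 creD cimD; field; exact: lattice_det. Qed.
Lemma lat2D z z' : lat2 (z + z') = lat2 z + lat2 z'.
Proof. by rewrite /lat2 creD cimD; field; exact: lattice_det. Qed.
Lemma lat1Z t z : lat1 (rc t * z) = t * lat1 z.
Proof. by rewrite /lat1 creZ cimZ; field; exact: lattice_det. Qed.
Lemma lat2Z t z : lat2 (rc t * z) = t * lat2 z.
Proof. by rewrite /lat2 creZ cimZ; field; exact: lattice_det. Qed.
Lemma lat1_w1 : lat1 w1 = 1.
Proof. by rewrite /lat1 -[X in X / _]/det divff// lattice_det. Qed.
Lemma lat2_w1 : lat2 w1 = 0.
Proof. by rewrite /lat2 [cre w1 * cim w1]mulrC subrr mul0r. Qed.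
Lemma lat1_w2 : lat1 w2 = 0.
Proof. by rewrite /lat1 [cre w2 * cim w2]mulrC subrr mul0r. Qed.
Lemma lat2_w2 : lat2 w2 = 1.
Proof. by rewrite /lat2 -[X in X / _]/det divff// lattice_det. Qed.

Lemma latE z : z = rc (lat1 z) * w1 + rc (lat2 z) * w2.
Proof.
by apply: Cx_eqP; rewrite ?creD ?cimD !(creZ, cimZ) /lat1 /lat2 /det; field; exact: lattice_det.
Qed.

Lemma period_int (P : Cx R -> R) w : (forall z, P (z + w) = P z) ->
  forall (n : int) z, P (z + n%:~R * w) = P z.
Proof.
move=> Pw; have Pn n z : P (z + n%:R * w) = P z.
  elim: n z => [|n IH] z; first by rewrite mul0r addr0.
  by rewrite -addn1 natrD mulrDl mul1r addrA Pw.
move=> [n|n] z; first exact: Pn.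
by rewrite -[RHS](Pn n.+1) -[in RHS](subrK (n.+1%:R * w) z) NegzE rmorphN /= mulNr Pn.
Qed.

Lemma rc_int (n : int) : rc (n%:~R : R) = n%:~R.
Proof. by rewrite /rc rmorph_int. Qed.

(** Removing the integral parts of the two lattice coordinates brings every point into the image of
    the compact unit square. *)
Lemma biperiodic_bounded (P : Cx R -> R) : (forall z, {for z, continuous P}) ->
  (forall z, P (z + w1) = P z) -> (forall z, P (z + w2) = P z) ->
  has_ubound (range P).
Proof.
move=> cP P1 P2.
pose Q (t : R * R) := P (rc t.1 * w1 + rc t.2 * w2).
have cQ : continuous Q.
  move=> t; suff : {for t, continuous Q} by [].
  apply: (@for_continuous_comp _ _ _ (fun t : R * R => rc t.1 *: w1 + rc t.2 *: w2) P); last exact: cP.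
  apply: for_continuousD; apply: for_continuous_rcZ.
  - exact: for_continuous_fst.
  - exact: for_continuous_cst.
  - exact: for_continuous_snd.
  - exact: for_continuous_cst.
have cK : compact (`[0, 1]%classic `*` `[0, 1]%classic : set (R * R)).
  by apply: compact_setX; exact: segment_compact.
have := compact_bounded (continuous_compact (continuous_subspaceT cQ) cK).
move=> [M [_ HM]]; exists (M + 1) => _ [z _ <-].
pose x := lat1 z; pose y := lat2 z.
have -> : P z = Q (x - (Num.floor x)%:~R, y - (Num.floor y)%:~R).
  rewrite /Q /= !rcD !rcN !rc_int !mulrDl !mulNr.
  rewrite -[RHS](period_int P1 (Num.floor x)) -[RHS](period_int P2 (Num.floor y)).
  by congr P; rewrite {1}(latE z) -/x -/y; ring.
apply: (le_trans (ler_norm _)); apply: (HM (M + 1)); first by rewrite ltrDl.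
exists (x - (Num.floor x)%:~R, y - (Num.floor y)%:~R) => //.
have fl (r : R) : 0 <= r - (Num.floor r)%:~R <= 1.
  have /andP[h1 h2] := real_floor_itv (num_real r); rewrite rmorphD /= in h2.
  by rewrite subr_ge0 h1 lerBlDl ltW.
by split; rewrite /= in_itv /= fl.
Qed.

End LatticeCoordinates.

Lemma sup_range_shift (R : realType) (T : Type) (t0 : T) (P Q : T -> R) (s s' : T -> T) (k : R) :
  has_ubound (range P) -> (forall t, Q t = P (s t) + k) -> (forall t, s (s' t) = t) ->
  sup (range Q) = sup (range P) + k.
Proof.
move=> ubP QP ss'.
have neP : range P !=set0 by exists (P t0), t0.
have neQ : range Q !=set0 by exists (Q t0), t0.
have ubQ : ubound (range Q) (sup (range P) + k).
  move=> _ [t _ <-]; rewrite QP lerD2r; apply: ub_le_sup => //; by exists (s t).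
apply/eqP; rewrite eq_le; apply/andP; split; first exact: ge_sup.
rewrite -lerBrDr; apply: ge_sup => // _ [t _ <-]; rewrite lerBrDr.
have -> : P t + k = Q (s' t) by rewrite QP ss'.
apply: ub_le_sup; last by exists (s' t).
by exists (sup (range P) + k).
Qed.

(** * Coboundaries obtained from fibrewise suprema *)

Section Cech.
Context {R : realType} {B : topologicalType}.
Variables (w1 w2 : Cx R).
Hypothesis lat : forall a b : R, rc a * w1 + rc b * w2 = 0 -> a = 0 /\ b = 0.
Variables (z1 z2 : cocycle2 B int) (W : B -> set B) (H : B -> B -> B -> Cx R).
Hypothesis cW : point_cover W.
Hypothesis dH : forall i j k b, W i b -> W j b -> W k b ->
  H j k b - H i k b + H i j b =
    (submodule_val z1 i j k b)%:~R * w1 + (submodule_val z2 i j k b)%:~R * w2.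

Lemma real_relation (a b : R) :
  coboundary_on W (fun i j k y => a * (submodule_val z1 i j k y)%:~R
                                + b * (submodule_val z2 i j k y)%:~R) ->
  a *: H2_real R (H2_class z1) + b *: H2_real R (H2_class z2) = 0.
Proof.
move=> cob; rewrite !H2_real_class /H2_class.
have -> : a *: quot_class (is_coboundary2 (B := B) (K := R)) (cocycle2_real R z1) =
    quot_class _ (a *: cocycle2_real R z1) by rewrite quot_classZ.
have -> : b *: quot_class (is_coboundary2 (B := B) (K := R)) (cocycle2_real R z2) =
    quot_class _ (b *: cocycle2_real R z2) by rewrite quot_classZ.
rewrite -quot_classD.
have -> : (0 : H2 B R) = quot_class _ (0 : cocycle2 B R).
  by rewrite -[LHS](scale0r (quot_class _ (0 : cocycle2 B R))) -[LHS]quot_classZ scale0r.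
apply/eqP; rewrite quot_classP; apply/asboolP; exists W => //.
have [h [lh dh]] := cob; exists h; split=> // i j k y Wi Wj Wk.
by rewrite -(dh i j k y Wi Wj Wk) subr0.
Qed.

Variables (F : B -> B -> Cx R -> R) (a b : R).
Hypothesis cF : forall i y z, W i y -> {for z, continuous (F i y)}.
Hypothesis F1 : forall i y z, W i y -> F i y (z + w1) = F i y z + a.
Hypothesis F2 : forall i y z, W i y -> F i y (z + w2) = F i y z + b.
Let K i j y := F j y 0 - F i y (H i j y).
Hypothesis FH : forall i j y z, W i y -> W j y -> F j y z - F i y (z + H i j y) = K i j y.
Hypothesis lK : forall i j, locally_constant_on (W i `&` W j) (K i j).

Let l1 := lat1 w1 w2.
Let l2 := lat2 w1 w2.
Let lam z := a * l1 z + b * l2 z.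

Let lamD z z' : lam (z + z') = lam z + lam z'.
Proof. by rewrite /lam /l1 /l2 (lat1D lat) (lat2D lat); ring. Qed.

Let lam1 : lam w1 = a.
Proof. by rewrite /lam /l1 /l2 (lat1_w1 lat) lat2_w1; ring. Qed.

Let lam2 : lam w2 = b.
Proof. by rewrite /lam /l1 /l2 (lat2_w2 lat) lat1_w2; ring. Qed.

Let lamC : continuous lam.
Proof.
move=> z; suff : {for z, continuous lam} by [].
have c1 : {for z, continuous (cre : Cx R -> R)} by exact: cre_continuous.
have c2 : {for z, continuous (cim : Cx R -> R)} by exact: cim_continuous.
apply: for_continuousDR; (apply: for_continuousMR; first exact: for_continuous_cst).
- apply: for_continuousMR; last exact: for_continuous_cst.
  apply: for_continuousDR; first by apply: for_continuousMR => //; exact: for_continuous_cst.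
  by apply: for_continuousNR; apply: for_continuousMR => //; exact: for_continuous_cst.
- apply: for_continuousMR; last exact: for_continuous_cst.
  apply: for_continuousDR; first by apply: for_continuousMR => //; exact: for_continuous_cst.
  by apply: for_continuousNR; apply: for_continuousMR => //; exact: for_continuous_cst.
Qed.

Let P i y z := F i y z - lam z.
(* The supremum over a whole fibre is insensitive to the translations [H i j]. *)
Let u i y := sup (range (P i y)).

Let uH i j y : W i y -> W j y -> u j y = u i y + (K i j y + lam (H i j y)).
Proof.
move=> Wi Wj; apply: (@sup_range_shift R _ (0 : Cx R) _ _ (fun z => z + H i j y) (fun z => z - H i j y)).
- apply: (@biperiodic_bounded R w1 w2 lat (P i y)).
  + move=> z; apply: for_continuousDR; first exact: cF.
    by apply: for_continuousNR; exact: lamC.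
  + by move=> z; rewrite /P F1// lamD lam1; ring.
  + by move=> z; rewrite /P F2// lamD lam2; ring.
- by move=> z; rewrite /P -(FH z Wi Wj) lamD; ring.
- by move=> z; rewrite subrK.
Qed.

(** By [uH], lam (H i j y) is u j y - u i y - K i j y. In the alternating sum the u cancel
    pointwise, whatever their dependence on y, and the locally constant - K i j remains as
    primitive. *)
Lemma periods_coboundary :
  coboundary_on W (fun i j k y => a * (submodule_val z1 i j k y)%:~R
                                + b * (submodule_val z2 i j k y)%:~R).
Proof.
exists (fun i j y => - K i j y); split=> [i j y Wij|i j k y Wi Wj Wk].
  by have := lK Wij; apply: filterS => y' ->.
have <- : lam (H j k y - H i k y + H i j y) =
    a * (submodule_val z1 i j k y)%:~R + b * (submodule_val z2 i j k y)%:~R.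
  rewrite (dH Wi Wj Wk) -!rc_int lamD /lam /l1 /l2 !(lat1Z lat) !(lat2Z lat).
  by rewrite (lat1_w1 lat) (lat2_w2 lat) lat1_w2 lat2_w1; ring.
have N z : lam (- z) = - lam z.
  by apply/eqP; rewrite -addr_eq0 -lamD addNr /lam /l1 /l2 -(mul0r 0) -rc0 (lat1Z lat) (lat2Z lat); apply/eqP; ring.
rewrite !lamD N.
have := uH Wj Wk; have := uH Wi Wk; have := uH Wi Wj; lra.
Qed.

End Cech.

Lemma has_dir_coord (R : realType) (V : normedModType (Cx R)) (fr : frame V) (k : fr_I fr) (p v : V) :
  has_dir (fr_e (f:=fr) k) v p (fr_e (f:=fr) k v).
Proof.
apply/has_dirP => e e0; near=> h.
by rewrite fr_eD fr_eZ [fr_e k p + _]addrC addrK subrr normr0 mulr_ge0// ltW.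
Unshelve. all: by end_near. Qed.

(** * Uniqueness and existence of potentials *)

Section Uniqueness.
Variables (R : realType) (m : nat) (X : topologicalType).
Local Notation W := 'rV[Cx R]_m.
Variable SX : complex_structure X W.
Variable g : metric R m X.
Hypothesis hg : hermitian_on SX setT g.
Hypothesis noncollinear : forall u : W, u != 0 -> exists w : W, forall c : Cx R, w != c *: u.
Local Notation e := (fr_e (f := rV_frame m)).

Section InChart.
Variable a : chart X W.
Hypothesis aA : atlas SX a.
Let O := chart_img a.
Let phi := chart_inv a.
Let oO : open O. Proof. exact: cs_open_img aA. Qed.

Let phi_c p : O p -> {for p, continuous phi}.
Proof. exact: cs_continuous_inv aA p. Qed.

Let phi2 p b k : O p -> atlas SX b -> chart_dom b (phi p) -> C2 (fun q => e k (chart_map b (phi q))) p.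
Proof.
move=> [x ax <-] bA; rewrite /phi (cs_mapK aA ax) => bx.
exact: (holo_frame_C2 k (near_transition_diff aA bA ax bx)).
Qed.

Let phi_dom p : O p -> chart_dom a (phi p) /\ chart_map a (phi p) = p.
Proof. by move=> [x ax <-]; rewrite /phi (cs_mapK aA ax). Qed.

Let phi_d p v : O p -> dchart phi a p v = v.
Proof.
move=> Op; apply: dchart_unique => k.
apply: has_dir_near (has_dir_coord k p v).
by apply: filterS (open_nbhs_nbhs (conj oO Op)) => q Oq; rewrite (phi_dom Oq).2.
Qed.

Let G z u v := g a (chart_inv a z) u v.

Let pomE F q u v : O q -> pom SX g phi F u v q = om G F u v q.
Proof.
move=> Oq; rewrite /pom (pull_formE hg oO phi_c phi2 _ _ Oq aA (phi_dom Oq).1) /om.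
by rewrite !phi_d.
Qed.

Let lckG U f p : lck_on SX g U f -> O p -> U (phi p) -> lck_potential G (f \o phi) p.
Proof.
move=> L Op Up; have [gU [oU _ _ _]] := L.
have h1 : \forall q \near p, O q by apply: open_nbhs_nbhs; split.
have h2 : \forall q \near p, U (phi q) by apply: (phi_c Op); apply: open_nbhs_nbhs; split.
apply: filterS2 h1 h2 => q Oq Uq.
have [c2 c1 cl] := potential_local hg oO phi_c phi2 L Oq Uq.
have E u v : \forall q' \near q, pom SX g phi (f \o phi) u v q' = om G (f \o phi) u v q'.
  by apply: filterS (open_nbhs_nbhs (conj oO Oq)) => q' Oq'; exact: pomE.
split; first exact: c2.
split=> [u v|u v w]; first exact: C1_near (E u v) (c1 u v).
have d x y z : dirderiv (om G (f \o phi) x y) z q = dirderiv (pom SX g phi (f \o phi) x y) z q.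
  by apply: has_dirE; apply: has_dir_near (E x y) _; apply: C1_dir; exact: c1.
by rewrite !d.
Qed.

(** The inverse of the chart a serves as parametrization: its [dchart] is the identity, which turns
    [pom] into [om] and makes [lck_unique] available. *)
Lemma lck_on_unique U U' f f' x u : lck_on SX g U f -> lck_on SX g U' f' -> U x -> U' x ->
  chart_dom a x ->
  dirderiv (f \o chart_inv a) u (chart_map a x) = dirderiv (f' \o chart_inv a) u (chart_map a x).
Proof.
move=> L L' Ux U'x ax; have Op : O (chart_map a x) by exists x.
have px : phi (chart_map a x) = x by exact: cs_mapK aA _ ax.
have P : lck_potential G (f \o phi) (chart_map a x) by apply: lckG L Op _; rewrite px.
have P' : lck_potential G (f' \o phi) (chart_map a x) by apply: lckG L' Op _; rewrite px.
apply: (@lck_unique _ _ (rV_frame m) O G _ _ _ _ noncollinear _ _ _ u Op P P').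
- by move=> p s t Op'; apply: (herm_sym hg aA I (phi_dom Op').1).
- by move=> p k s t w Op'; apply: (herm_linear hg aA I (phi_dom Op').1).
- by move=> p s t Op'; apply: (herm_J hg aA I (phi_dom Op').1).
- by move=> p s Op'; apply: (herm_pos hg aA I (phi_dom Op').1).
Qed.

End InChart.

Section Param.
Variables (V : normedModType (Cx R)) (fr : frame V) (O : set V) (phi : V -> X).
Hypothesis oO : open O.
Hypothesis phi_c : forall p, O p -> {for p, continuous phi}.
Hypothesis phi2 : forall p a k, O p -> atlas SX a -> chart_dom a (phi p) ->
  C2 (fun q => e k (chart_map a (phi q))) p.
Hypothesis lckX : forall x, exists U f, lck_on SX g U f /\ U x.
Implicit Types (p q u v w : V).

Let near_U U f p : lck_on SX g U f -> O p -> U (phi p) -> \forall q \near p, O q /\ U (phi q).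
Proof.
move=> [gU [oU _ _ _]] Op Up.
have h1 : \forall q \near p, O q by apply: open_nbhs_nbhs; split.
have h2 : \forall q \near p, U (phi q) by apply: (phi_c Op); apply: open_nbhs_nbhs; split.
by apply: filterS2 h1 h2.
Qed.

(** [lck_unique] does not apply on V itself, since phi need not respect the complex structures. The
    chain rule transports the uniqueness proved in the charts of X. *)
Lemma pull_unique U U' f f' p u : lck_on SX g U f -> lck_on SX g U' f' -> O p -> U (phi p) -> U' (phi p) ->
  dirderiv (f \o phi) u p = dirderiv (f' \o phi) u p.
Proof.
move=> L L' Op Up U'p.
have aA := chart_at_atlas SX (phi p); have ad := chart_at_dom SX (phi p).
move: (chart_at _ _) aA ad => a aA ad.
have [gU [oU _ sf _]] := L; have [gU' [oU' _ sf' _]] := L'.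
have D (U1 : set X) f1 : open U1 -> smooth_fun SX U1 f1 -> U1 (phi p) ->
    dirderiv (f1 \o phi) u p = dirderiv (f1 \o chart_inv a) (dchart phi a p u) (chart_map a (phi p)).
  move=> oU1 sf1 U1p; apply: has_dirE.
  have ND := near_dom oO phi_c Op aA ad oU1 U1p.
  apply: (@has_dir_near _ _ (fun q => (f1 \o chart_inv a) (chart_map a (phi q)))).
    by apply: filterS ND => q [_ aq _]; rewrite /= (cs_mapK aA aq).
  have PhiD (k' : fr_I (rV_frame m)) q v : [set p] q ->
      has_dir (fun q => e k' (chart_map a (phi q))) v q (e k' (dchart phi a q v)).
    by move=> ->; exact: (dchart_dir phi2).
  apply: (@compose_dir _ _ _ (rV_frame m) (fun q => chart_map a (phi q)) (dchart phi a) [set p] PhiD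
    (f1 \o chart_inv a) p u (erefl p)).
  apply: (Ck1_C1 (sf1 a aA 1%N)).
  have N1 : \forall z \near chart_map a (phi p), chart_img a z.
    by apply: open_nbhs_nbhs; split; [exact: cs_open_img aA|exists (phi p)].
  have ai : chart_img a (chart_map a (phi p)) by exists (phi p).
  have N2 : \forall z \near chart_map a (phi p), U1 (chart_inv a z).
    apply: (cs_continuous_inv aA ai); apply: open_nbhs_nbhs; split=> //.
    by rewrite (cs_mapK aA ad).
  by apply: filterS2 N1 N2 => _ [y ay <-]; rewrite (cs_mapK aA ay) => Uy; exists y.
rewrite (D U f)// (D U' f')//.
exact: (lck_on_unique aA _ L L').
Qed.

(** A primitive of the pulled back Lee form, which is given locally by the differentials of the
    conformal factors f. *)
Definition potential (F : V -> R) := forall p, O p -> C1 F p /\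
  forall U f, lck_on SX g U f -> U (phi p) -> forall u, dirderiv F u p = dirderiv (f \o phi) u p.

Lemma potential_shift F p U f : potential F -> lck_on SX g U f -> O p -> U (phi p) ->
  \forall q \near p, F q = f (phi q) + (F p - f (phi p)).
Proof.
move=> HF L Op Up.
have : \forall q \near p, F q - f (phi q) = F p - f (phi p).
  apply: (@near_const _ _ (fun q => F q - f (phi q))).
  apply: filterS (near_U L Op Up) => q [Oq Uq] u.
  have [cF dF] := HF q Oq; have [[cr _] _ _] := potential_local hg oO phi_c phi2 L Oq Uq.
  have := has_dirB (C1_dir u cF) (C1_dir u cr).
  by rewrite (dF U f L Uq) subrr.
by apply: filterS => q <-; rewrite addrC subrK.
Qed.

Lemma pom_potential F p : potential F -> O p ->
  (forall u v, C1 (pom SX g phi F u v) p) /\ closed2 (pom SX g phi F) p.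
Proof.
move=> HF Op; have [U [f [L Up]]] := lckX (phi p).
have oE u v : \forall q \near p, expR (- (F p - f (phi p))) * pom SX g phi (f \o phi) u v q = pom SX g phi F u v q.
  apply: filterS (potential_shift HF L Op Up) => q Fq; rewrite /pom Fq mulrA -expRD.
  by congr (expR _ * _); rewrite /=; ring.
have [_ co clo] := potential_local hg oO phi_c phi2 L Op Up.
split=> [u v|u v w]; first exact: C1_near (oE u v) (C1Z _ (co u v)).
have d x y z : dirderiv (pom SX g phi F x y) z p =
    expR (- (F p - f (phi p))) * dirderiv (pom SX g phi (f \o phi) x y) z p.
  by apply: has_dirE; apply: has_dir_near (oE x y) _; apply: has_dirZ; apply: C1_dir; exact: co.
by rewrite !d -!mulrDr clo mulr0.
Qed.

Lemma potential_exists p0 : (forall p (t : R), O p -> 0 <= t <= 1 -> O (p0 + rc t *: (p - p0))) ->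
  exists F, potential F.
Proof.
move=> starO.
have [U /choice[f Hf]] := choice lckX.
(* The conformal factor is chosen separately at each point. By uniqueness th coincides near p with
   the differential of the single factor chosen at p, so it is C1 and closed. *)
pose th u p := dirderiv (f (phi p) \o phi) u p.
have L p : lck_on SX g (U (phi p)) (f (phi p)) by case: (Hf (phi p)).
have Up p : U (phi p) (phi p) by case: (Hf (phi p)).
have thE p u : O p -> \forall q \near p, dirderiv (f (phi p) \o phi) u q = th u q.
  by move=> Op; apply: filterS (near_U (L p) Op (Up p)) => q [Oq Uq]; exact: pull_unique (L p) (L q) Oq Uq (Up q).
have c2 p : O p -> C2 (f (phi p) \o phi) p.
  by move=> Op; have [] := potential_local hg oO phi_c phi2 (L p) Op (Up p).
have cth p u : O p -> C1 (th u) p.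
  by move=> Op; have [_ +] := c2 p Op; move=> /(_ u); apply: C1_near; exact: thE.
have [||||F HF] := @poincare R V fr O p0 oO starO th.
- by move=> p u Op; exact: cth.
- by move=> p u v Op; have [c _] := c2 p Op; exact: (dirderivD fr).
- by move=> p t v Op; have [c _] := c2 p Op; exact: (dirderivZ fr).
- move=> p u v Op.
  have e' x y : dirderiv (th x) y p = dirderiv (dirderiv (f (phi p) \o phi) x) y p.
    apply: has_dirE; apply: has_dir_near (thE p x Op) _; apply: C1_dir.
    by have [_] := c2 p Op; apply.
  by rewrite !e'; exact: schwarz (c2 p Op).
exists F => p Op; have [cF dF] := HF p Op; split=> // U' f' L' U'p u.
by rewrite (has_dirE (dF u)); exact: pull_unique (L p) L' Op (Up p) U'p.
Qed.

End Param.
End Uniqueness.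

Lemma has_dir_zero (R : realType) (V : normedModType (Cx R)) (f : V -> R) (p : V) (l : R) :
  has_dir f 0 p l -> l = 0.
Proof.
move=> /has_dirE <-; apply: has_dirE; apply/has_dirP => e e0; near=> h.
by rewrite scaler0 addr0 subrr mulr0 subrr normr0 mulr_ge0// ltW.
Unshelve. all: by end_near. Qed.

(** * Gluing patches of the form D * C *)

Section FibreModel.
Variables (R : realType) (m : nat) (X : topologicalType).
Local Notation W := 'rV[Cx R]_m.
Variables (SX : complex_structure X W) (g : metric R m X).
Hypothesis hg : hermitian_on SX setT g.
Hypothesis noncollinear : forall u : W, u != 0 -> exists w : W, forall c : Cx R, w != c *: u.
Hypothesis lckX : forall x, exists U f, lck_on SX g U f /\ U x.
Variables (W0 : normedModType (Cx R)) (fr0 : frame W0).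
Local Notation V0 := (W0 * Cx R)%type.
Let fr : frame V0 := prod_frame fr0 Cx_frame.
Variables w1 w2 : Cx R.
Hypothesis lat : forall a b : R, rc a * w1 + rc b * w2 = 0 -> a = 0 /\ b = 0.
Implicit Types (D : set W0) (w : W0) (phi : V0 -> X) (p q u v : V0) (F : V0 -> R).
Local Notation e := (fr_e (f := rV_frame m)).
Local Notation e0 := (fr_e (f := fr0)).
Local Notation eC := (fr_e (f := @Cx_frame R)).

Definition cyl D : set V0 := [set p | D p.1].

(** The map phi is complex linear to first order only along the fibres: [patch_lin] and
    [patch_immersed] concern vertical vectors, and together they make the pulled back form positive
    there. *)
Record patch D w0 phi : Prop := Patch {
  patch_open : open D;
  patch_center : D w0;
  patch_star : forall w (t : R), D w -> 0 <= t <= 1 -> D (w0 + rc t *: (w - w0));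
  patch_cont : forall p, cyl D p -> {for p, continuous phi};
  patch_C2 : forall p a k, cyl D p -> atlas SX a -> chart_dom a (phi p) ->
    C2 (fun q => e k (chart_map a (phi q))) p;
  patch_lin : forall p (z : Cx R), cyl D p ->
    dchart phi (chart_at SX (phi p)) p (0, 'i * z) =
    ('i : Cx R) *: dchart phi (chart_at SX (phi p)) p (0, z);
  patch_immersed : forall p, cyl D p -> dchart phi (chart_at SX (phi p)) p (0, w1) != 0;
  patch_per1 : forall w z, D w -> phi (w, z + w1) = phi (w, z);
  patch_per2 : forall w z, D w -> phi (w, z + w2) = phi (w, z) }.

Lemma cyl_open D : open D -> open (cyl D).
Proof. by move=> oD; apply: open_comp => // p _; exact: for_continuous_fst. Qed.

Lemma near_fst (P : W0 -> Prop) p : (\forall w \near p.1, P w) -> \forall q \near p, P q.1.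
Proof. by move=> H; exact: (@for_continuous_fst W0 (Cx R) p). Qed.

Lemma cyl_star D w0 phi : patch D w0 phi -> forall p (t : R), cyl D p -> 0 <= t <= 1 ->
  cyl D ((w0, 0) + rc t *: (p - (w0, 0))).
Proof. by move=> pt p t Dp t01; exact: (patch_star pt). Qed.

Lemma vertical_sum w (z : Cx R) : (w, z) = (w, 0) + (0, z) :> V0.
Proof. by congr pair; rewrite ?addr0 ?add0r. Qed.

Section OnePatch.
Variables (D : set W0) (w0 : W0) (phi : V0 -> X).
Hypothesis pt : patch D w0 phi.
Let oO := cyl_open (patch_open pt).
Variable F : V0 -> R.
Hypothesis HF : potential SX g (cyl D) phi F.

Let o := pom SX g phi F.
Let e1 : V0 := (0, w1).
Let e2 : V0 := (0, w2).

Let oC p u v : cyl D p -> C1 (o u v) p.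
Proof. by move=> Dp; have [+ _] := pom_potential hg oO (patch_cont pt) (patch_C2 pt) lckX HF Dp; exact. Qed.
Let oc p : cyl D p -> closed2 o p.
Proof. by move=> Dp; have [_ +] := pom_potential hg oO (patch_cont pt) (patch_C2 pt) lckX HF Dp; exact. Qed.
Let oA p u v : cyl D p -> o u v p = - o v u p.
Proof. by move=> _; rewrite /o /pom (pull_form_anti hg) mulrN. Qed.
Let oD p u v (w : V0) : cyl D p -> o w (u + v) p = o w u p + o w v p.
Proof. by move=> Dp; rewrite /o /pom (pull_formD hg fr (patch_C2 pt))// mulrDr. Qed.
Let oZ p (t : R) u (w : V0) : cyl D p -> o w (rc t *: u) p = t * o w u p.
Proof. by move=> Dp; rewrite /o /pom (pull_formZ hg fr (patch_C2 pt))// mulrCA. Qed.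

Definition fibre_form p v := I01 (fun s => pom SX g phi F (0, w1) v (p + rc s *: ((0, w1) : V0))).

Let Oe (z : Cx R) p (t : R) : cyl D p -> cyl D (p + rc t *: ((0, z) : V0)).
Proof. by move=> Dp; rewrite /cyl /= scaler0 addr0. Qed.

Lemma fibre_formZ p v (k : R) : cyl D p ->
  I01 (fun s => k * o e1 v (p + rc s *: e1)) = k * fibre_form p v.
Proof.
move=> Dp; apply: I01Z => s _.
apply: (@for_continuous_comp _ _ _ (fun s : R => p + rc s *: e1) (o e1 v)); first exact: line_continuous.
by apply: C1_cont; apply: oC; exact: Oe.
Qed.

Hypothesis per1 : forall p u v, cyl D p -> o u v (p + e1) = o u v p.
Hypothesis per2 : forall p u v, cyl D p -> o u v (p + e2) = o u v p.

(* [sg] is the orientation of the basis [(w1, w2)] of the lattice. *)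
Let sg_pos : exists sg : R, forall p, cyl D p -> 0 < sg * o e1 e2 p.
Proof.
have w10 : w1 != 0.
  apply/eqP => w10; have [|/eqP] := @lat 1 0; first by rewrite w10 mulr0 rc0 mul0r addr0.
  by rewrite oner_eq0.
(* Since w2 = c w1, antisymmetry gives o e1 e2 = Im c * o e1 (i e1), where the last factor is
   positive and Im c is nonzero. *)
pose c := w2 / w1; exists (cim c) => p Dp.
have e2E : e2 = rc (cre c) *: e1 + rc (cim c) *: (('i : Cx R) *: e1).
  rewrite /e2 /e1; congr pair; first by rewrite /= !scaler0 addr0.
  rewrite -[RHS]/(rc (cre c) * w1 + rc (cim c) * ('i * w1)) mulrA -mulrDl -CxE.
  by rewrite /c divfK.
have c0 : cim c != 0.
  apply/eqP => c0; have [|_ /eqP] := @lat (cre c) (-1); last by rewrite oppr_eq0 oner_eq0.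
  have := CxE c; rewrite c0 rc0 mul0r addr0 => <-.
  by rewrite divfK// rcN rc1 mulN1r subrr.
rewrite e2E oD// !oZ//.
have -> : o e1 e1 p = 0 by have := oA e1 e1 Dp; lra.
rewrite mulr0 add0r mulrA mulr_gt0//; first by rewrite -expr2 exprn_even_gt0.
rewrite /o /pom mulr_gt0 ?expR_gt0//; apply: (pull_form_pos hg); first exact: (patch_immersed pt).
have -> : ('i : Cx R) *: e1 = (0, 'i * w1) by rewrite /e1 -[LHS]/('i *: 0, 'i *: w1) scaler0.
exact: (patch_lin pt).
Qed.

Lemma fibre_potential : exists (A : V0 -> R) (c : R), [/\ c != 0,
  forall p, cyl D p -> C1 A p /\ forall v, has_dir A v p (fibre_form p v),
  forall p, cyl D p -> A (p + e1) = A p & forall p, cyl D p -> A (p + e2) = A p + c].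
Proof.
have [A HA] := fibre_primitive fr oO (cyl_star pt) oC oA oD oZ oc (Oe w1) per1.
have [sg Hsg] := sg_pos.
have Dp0 : cyl D (w0, 0) by exact: (patch_center pt).
have [c c0 Hc] := fibre_period2 Dp0 (cyl_star pt) oC (Oe w1) HA (Oe w2) per2 Hsg.
exists A, c; split; [exact: c0|exact: HA| |exact: Hc].
by move=> p Dp; exact: (fibre_period1 oA (Oe w1) HA Dp).
Qed.

End OnePatch.

Lemma fibre_const (K : V0 -> R) w : (forall z, \forall q \near ((w, z) : V0), K q = K (w, z)) ->
  forall z, K (w, z) = K (w, 0).
Proof.
move=> HK z; rewrite vertical_sum.
apply: segment_const => t _.
have -> : ((w, 0) : V0) + rc t *: ((0, z) : V0) = (w, rc t * z).
  by rewrite -[LHS]/(w + rc t *: 0, 0 + rc t *: z) scaler0 addr0 add0r.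
apply: (@has_dir_near _ _ (fun=> K (w, rc t * z))); last exact: has_dir_cst.
by apply: filterS (HK (rc t * z)) => q ->.
Qed.

Lemma near_base (P : V0 -> Prop) w : (\forall q \near ((w, 0) : V0), P q) -> \forall v \near w, P (v, 0).
Proof.
have c : {for w, continuous (fun v : W0 => (v, 0) : V0)}.
  by apply: for_continuous_pair; [exact: cvg_id|exact: for_continuous_cst].
exact: c.
Qed.

(** The transition between two patches: a change of base coordinates combined with a translation on
    every fibre. *)
Definition shear (T : W0 -> W0) (H : W0 -> Cx R) p : V0 := (T p.1, p.2 + H p.1).
Definition dshear (dT : W0 -> W0 -> W0) (dH : W0 -> W0 -> Cx R) p v : V0 :=
  (dT p.1 v.1, v.2 + dH p.1 v.1).

Record glued_at D phi D' phi' (T : W0 -> W0) (H : W0 -> Cx R) (dT : W0 -> W0 -> W0)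
    (dH : W0 -> W0 -> Cx R) w : Prop := GluedAt {
  glued_D' : D' w;
  glued_D : D (T w);
  glued_T : {for w, continuous T};
  glued_H : {for w, continuous H};
  glued_phi : forall z, phi' (w, z) = phi (T w, z + H w);
  glued_dT : forall (u : W0) k, has_dir (fun w => e0 k (T w)) u w (e0 k (dT w u));
  glued_dH : forall (u : W0) k, has_dir (fun w => eC k (H w)) u w (eC k (dH w u)) }.

Section Gluing.
Variables (D D' : set W0) (w0 w0' : W0) (phi phi' : V0 -> X).
Hypotheses (pt : patch D w0 phi) (pt' : patch D' w0' phi').
Variables (T : W0 -> W0) (H : W0 -> Cx R) (dT : W0 -> W0 -> W0) (dH : W0 -> W0 -> Cx R).
Local Notation S := (shear T H).
Local Notation dS := (dshear dT dH).
Let glued w := \forall v \near w, glued_at D phi D' phi' T H dT dH v.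

Lemma glued_near p : glued p.1 ->
  \forall q \near p, [/\ cyl D' q, cyl D (S q), {for q, continuous S} & phi' q = phi (S q)].
Proof.
move=> gl; have := near_fst gl; apply: filterS => q [D'q DTq cT cH E _ _]; split=> //.
  apply: for_continuous_pair.
    apply: (@for_continuous_comp _ _ _ fst T); first exact: for_continuous_fst.
    exact: cT.
  apply: for_continuousD; first exact: for_continuous_snd.
  apply: (@for_continuous_comp _ _ _ fst H); first exact: for_continuous_fst.
  exact: cH.
by rewrite -E -surjective_pairing.
Qed.

Lemma shear_dir p v k : glued p.1 -> has_dir (fun q => fr_e (f:=fr) k (S q)) v p (fr_e (f:=fr) k (dS p v)).
Proof.
move=> /nbhs_singleton[_ _ _ _ _ hT hH]; case: k => k.
  by apply/has_dirP => x x0; move/has_dirP: (hT v.1 k) => /(_ x x0).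
change (has_dir (fun q : V0 => eC k (q.2 + H q.1)) v p (eC k (v.2 + dH p.1 v.1))).
rewrite fr_eD.
have h1 : has_dir (fun q : V0 => eC k q.2) v p (eC k v.2) by exact: (has_dir_coord (fr := fr) (inr k)).
have h2 : has_dir (fun q : V0 => eC k (H q.1)) v p (eC k (dH p.1 v.1)).
  by apply/has_dirP => x x0; move/has_dirP: (hH v.1 k) => /(_ x x0).
have -> : (fun q : V0 => eC k (q.2 + H q.1)) = (fun q => eC k q.2 + eC k (H q.1)).
  by apply/funext => q; rewrite fr_eD.
exact: has_dirD.
Qed.

Lemma shear_vertical q (z : Cx R) : S (q + (0, z)) = S q + (0, z).
Proof.
case: q => w x; rewrite /shear -[LHS]/(T (w + 0), (x + z) + H (w + 0)).
by rewrite -[RHS]/(T w + 0, (x + H w) + z) !addr0 addrAC.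
Qed.

Lemma dshear_vertical p (z : Cx R) : glued p.1 -> dS p (0, z) = (0, z).
Proof.
move=> /nbhs_singleton[_ _ _ _ _ hT hH]; rewrite /dshear /=.
have frame0 (V : normedModType (Cx R)) (f : frame V) (x : V) : (forall k, fr_e (f := f) k x = 0) -> x = 0.
  by move=> x0; rewrite (fr_sum f x) big1// => k _; rewrite x0 rc0 scale0r.
have -> : dT p.1 0 = 0 by apply: (frame0 _ fr0) => k; exact: has_dir_zero (hT 0 k).
have -> : dH p.1 0 = 0 by apply: (frame0 _ Cx_frame) => k; exact: has_dir_zero (hH 0 k).
by rewrite addr0.
Qed.

Lemma glued_dchart a p v : glued p.1 -> atlas SX a -> chart_dom a (phi' p) ->
  dchart phi' a p v = dchart phi a (S p) (dS p v).
Proof.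
move=> gl aA ad; have gl' := glued_near gl.
have [D'p DSp cS E] := nbhs_singleton gl'; rewrite E in ad.
apply: dchart_unique => k.
apply: (@has_dir_near _ _ (fun q => e k (chart_map a (phi (S q))))).
  by apply: filterS gl' => q [_ _ _ ->].
rewrite -(has_dirE (dchart_dir (patch_C2 pt) (dS p v) k DSp aA ad)).
have [c1 _] := patch_C2 pt k DSp aA ad.
have PhiD (k' : fr_I fr) q u : [set p] q ->
    has_dir (fun q => fr_e (f:=fr) k' (S q)) u q (fr_e (f:=fr) k' (dS q u)).
  by move=> ->; exact: shear_dir.
exact: (@compose_dir _ _ _ fr S dS [set p] PhiD (fun q => e k (chart_map a (phi q))) p v (erefl p) c1).
Qed.

Lemma glued_form p u v x y : glued p.1 -> dS p u = x -> dS p v = y ->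
  pull_form SX g phi' p u v = pull_form SX g phi (S p) x y.
Proof.
move=> gl <- <-; have [D'p DSp cS E] := nbhs_singleton (glued_near gl).
have aA := chart_at_atlas SX (phi' p); have ad := chart_at_dom SX (phi' p).
move: (chart_at _ _) aA ad => a aA ad.
have ad' := ad; rewrite E in ad'.
rewrite (pull_formE hg (cyl_open (patch_open pt')) (patch_cont pt') (patch_C2 pt') u v D'p aA ad).
rewrite (pull_formE hg (cyl_open (patch_open pt)) (patch_cont pt) (patch_C2 pt) _ _ DSp aA ad').
by rewrite (glued_dchart u gl aA ad) (glued_dchart v gl aA ad) E.
Qed.

Variables (F F' : V0 -> R).
Hypotheses (HF : potential SX g (cyl D) phi F) (HF' : potential SX g (cyl D') phi' F').

(** Near p both F' and F composed with the shear are, up to constants, one and the same conformal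
    factor of X, read through phi' = phi o S. *)
Lemma glued_potential p : glued p.1 -> \forall q \near p, F' q - F (S q) = F' p - F (S p).
Proof.
move=> /glued_near gl; have [D'p DSp cS E] := nbhs_singleton gl.
have [U [f [L Up]]] := lckX (phi' p).
have N' := potential_shift hg (cyl_open (patch_open pt')) (patch_cont pt') (patch_C2 pt') HF' L D'p Up.
have Up' : U (phi (S p)) by rewrite -E.
have N := cS _ (potential_shift hg (cyl_open (patch_open pt)) (patch_cont pt) (patch_C2 pt) HF L DSp Up').
near=> q.
have -> : F' q = f (phi' q) + (F' p - f (phi' p)) by near: q; exact: N'.
have -> : F (S q) = f (phi (S q)) + (F (S p) - f (phi (S p))) by near: q; exact: N.
have -> : phi' q = phi (S q) by near: q; apply: filterS gl => q [].
by rewrite -E; ring.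
Unshelve. all: by end_near.
Qed.

Lemma glued_pom (k : R) p u v x y : glued p.1 -> F' p = F (S p) + k ->
  dS p u = x -> dS p v = y -> pom SX g phi' F' u v p = expR (- k) * pom SX g phi F x y (S p).
Proof.
move=> gl E hu hv; rewrite /pom E (glued_form gl hu hv) opprD expRD.
by rewrite [expR (- k) * _]mulrCA mulrA.
Qed.

Let K q := F' q - F (S q).

Lemma glued_potential_fibre w (z : Cx R) : glued w -> K (w, z) = K (w, 0).
Proof. by move=> gl; apply: fibre_const => z'; exact: glued_potential. Qed.

Lemma glued_potential_base w : glued w -> \forall v \near w, K (v, 0) = K (w, 0).
Proof. by move=> gl; apply: (near_base (P := fun q => K q = K (w, 0))); exact: glued_potential. Qed.

Variables (A A' : V0 -> R).
Hypothesis HA : forall p, cyl D p -> C1 A p /\ forall v, has_dir A v p (fibre_form phi F p v).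
Hypothesis HA' : forall p, cyl D' p -> C1 A' p /\ forall v, has_dir A' v p (fibre_form phi' F' p v).

(** K is constant on the fibre, so its exponential leaves the integral; the shear commutes with
    vertical translations and fixes vertical vectors, so it matches the two cycles. *)
Let glued_fibre_form p v : glued p.1 ->
  fibre_form phi' F' p v = expR (- K (p.1, 0)) * fibre_form phi F (S p) (dS p v).
Proof.
move=> gl; have [_ DSp _ _] := nbhs_singleton (glued_near gl).
have eE (s : R) : rc s *: ((0, w1) : V0) = (0, rc s * w1).
  by rewrite -[LHS]/(rc s *: 0, rc s *: w1) scaler0.
rewrite -(fibre_formZ pt HF _ _ DSp).
apply: eq_I01 => s _; rewrite eE.
have gl' : glued (p + (0, rc s * w1)).1 by rewrite /= addr0.
have HK : F' (p + (0, rc s * w1)) = F (S (p + (0, rc s * w1))) + K (p.1, 0).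
  rewrite -(glued_potential_fibre (p.2 + rc s * w1) gl) /K.
  have -> : p + (0, rc s * w1) = (p.1, p.2 + rc s * w1) by congr pair; rewrite /= addr0.
  by rewrite [RHS]addrC subrK.
have d1 : dS (p + (0, rc s * w1)) ((0, w1) : V0) = (0, w1) by exact: dshear_vertical.
have d2 : dS (p + (0, rc s * w1)) v = dS p v by rewrite /dshear /= addr0.
rewrite -shear_vertical; exact: (glued_pom gl' HK d1 d2).
Qed.

(** K is also locally constant in the base direction, so the exponential factor may be frozen at p
    and both terms have the same differential near p. *)
Lemma glued_fibre_potential p : glued p.1 ->
  \forall q \near p, A' q - expR (- K (p.1, 0)) * A (S q) = A' p - expR (- K (p.1, 0)) * A (S p).
Proof.
move=> gl; apply: (@near_const _ _ (fun q => A' q - expR (- K (p.1, 0)) * A (S q))).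
have n1 := near_fst (near_near gl).
have n2 := near_fst (glued_potential_base gl).
apply: filterS2 n1 n2 => q glq Kq v.
have [D'q DSq _ _] := nbhs_singleton (glued_near glq).
have [_ dA'] := HA' D'q; have [cA dA] := HA DSq.
rewrite -(subrr (fibre_form phi' F' q v)); apply: has_dirB; first exact: dA'.
rewrite (glued_fibre_form v glq) -Kq; apply: has_dirZ.
rewrite -(has_dirE (dA (dS q v))).
have PhiD (k' : fr_I fr) q' u : [set q] q' ->
    has_dir (fun q => fr_e (f:=fr) k' (S q)) u q' (fr_e (f:=fr) k' (dS q' u)).
  by move=> ->; exact: shear_dir.
exact: (@compose_dir _ _ _ fr S dS [set q] PhiD A q v (erefl q) cA).
Qed.

(** The difference in [glued_fibre_potential] is constant on the fibre; comparing it at 0 and at w2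
    relates the two periods. *)
Lemma glued_fibre_period (c c' : R) w : glued w ->
  (forall p, cyl D p -> A (p + (0, w2)) = A p + c) ->
  (forall p, cyl D' p -> A' (p + (0, w2)) = A' p + c') -> c' = expR (- K (w, 0)) * c.
Proof.
move=> gl Ac A'c'.
have E : forall z : Cx R, A' (w, z) - expR (- K (w, 0)) * A (S (w, z)) = A' (w, 0) - expR (- K (w, 0)) * A (S (w, 0)).
  move=> z; apply: (fibre_const (K := fun q => A' q - expR (- K (w, 0)) * A (S q))) => z'.
  exact: (@glued_fibre_potential (w, z')).
have [D'w DSw _ _] := nbhs_singleton (glued_near (p := (w, 0)) gl).
have := E w2; rewrite vertical_sum shear_vertical Ac// A'c'//.
by set x := expR _; lra.
Qed.

End Gluing.

Section Periods.
Variables (D : set W0) (w0 : W0) (phi : V0 -> X) (F : V0 -> R).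
Hypotheses (pt : patch D w0 phi) (HF : potential SX g (cyl D) phi F).
Variable z : Cx R.
Hypothesis per : forall w z', D w -> phi (w, z' + z) = phi (w, z').

Let shearE : shear id (fun=> z) = fun q => q + (0, z).
Proof. by apply/funext => q; congr pair; rewrite /= addr0. Qed.

(** Translation by a period glues the patch to itself, with T the identity and H constant; the
    gluing lemmas thus cover the behaviour under periods too. *)
Let self_glued w : D w -> \forall v \near w,
  glued_at D phi D phi id (fun=> z) (fun _ u : W0 => u) (fun _ _ => 0) v.
Proof.
move=> Dw; have : \forall v \near w, D v by apply: open_nbhs_nbhs; split=> //; exact: patch_open pt.
apply: filterS => v Dv; split; [exact: Dv|exact: Dv|exact: cvg_id|exact: for_continuous_cst| | |].
- by move=> z'; rewrite per.
- by move=> u k; exact: has_dir_coord.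
- by move=> u k; rewrite fr_e0; exact: has_dir_cst.
Qed.

Lemma potential_period : exists a : R, forall p, cyl D p -> F (p + (0, z)) = F p + a.
Proof.
exists (F ((w0, 0) + (0, z)) - F (w0, 0)) => p Dp.
have E : F p - F (p + (0, z)) = F (w0, 0) - F ((w0, 0) + (0, z)).
  apply: (@star_const R V0 (cyl D) (w0, 0) (cyl_star pt) (fun q => F q - F (q + (0, z)))) => // q v Dq.
  apply: (@has_dir_near _ _ (fun=> F q - F (q + (0, z)))); last exact: has_dir_cst.
  have := glued_potential pt pt HF HF (self_glued Dq); rewrite shearE.
  by apply: filterS => q' ->.
by move: E; lra.
Qed.

Lemma pom_period : (forall p, cyl D p -> F (p + (0, z)) = F p) -> forall p u v, cyl D p ->
  pom SX g phi F u v (p + (0, z)) = pom SX g phi F u v p.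
Proof.
move=> Fp p u v Dp; have gl := self_glued Dp.
have HK : F p = F (shear id (fun=> z) p) + 0 by rewrite addr0 shearE Fp.
have dE x : dshear (fun _ u : W0 => u) (fun _ _ => 0) p x = x by case: x => x y; rewrite /dshear /= addr0.
have := glued_pom pt pt gl HK (dE u) (dE v).
by rewrite shearE oppr0 expR0 mul1r => ->.
Qed.

End Periods.
End FibreModel.

(** * Liouville's theorem and biperiodic entire functions *)

Section Liouville.
Context {R : realType}.
Implicit Types (u : Cx R -> Cx R) (z w : Cx R).

Let entire_C1 u : (forall z, differentiable u z) ->
  forall z, C1 (fun w => cre (u w)) z /\ C1 (fun w => cim (u w)) z.
Proof. by move=> du z; apply: holo_C1; near=> q; exact: du. Unshelve. all: by end_near. Qed.

(** Cauchy's estimate: on the circle of radius r the formula bounds the derivative by 2 M / r, for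
    every r. *)
Let derivative_re u (M : R) : (forall z, differentiable u z) ->
  (forall z, `|cre (u z)| <= M) -> (forall z, `|cim (u z)| <= M) ->
  forall w, dirderiv (fun z => cre (u z)) 1 w = 0.
Proof.
move=> du bP bQ w; set P := fun z => cre (u z); set Q := fun z => cim (u z).
have M0 : 0 <= M by exact: le_trans (bP 0).
have c1 : forall s, `|cc s| <= 1 :> R by move=> s; rewrite ler_norml cos_geN1 cos_le1.
have s1 : forall s, `|ss s| <= 1 :> R by move=> s; rewrite ler_norml sin_geN1 sin_le1.
have H (r : R) : 0 < r -> `|dirderiv P 1 w| <= r^-1 * (M + M).
  move=> r0; rewrite (@cauchy_formula _ P Q w (r + 1) _ r); last 2 first.
  - by move=> z _; have [h1 h2] := entire_C1 du z; have [h3 h4] := holo_CR (du z); split.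
  - by rewrite r0 /= ltrDl ltr01.
  have ri : 0 <= r^-1 by rewrite invr_ge0 ltW.
  rewrite normrM (ger0_norm ri); apply: ler_wpM2l => //.
  have cont : cont01 (fun s => P (w + ee s *: rc r) * cc s + Q (w + ee s *: rc r) * ss s).
    move=> s _.
    have ce : {for s, continuous (fun s : R => w + ee s *: rc r)}.
      apply: for_continuousD; first exact: for_continuous_cst.
      by apply: (@cvgZ _ _ _ _ _ ee (fun=> rc r)); [exact: ee_continuous|exact: cvg_cst].
    have [h1 h2] := entire_C1 du (w + ee s *: rc r).
    apply: for_continuousDR; apply: for_continuousMR.
    - by apply: (@for_continuous_comp _ _ _ (fun s : R => w + ee s *: rc r) P) ce _; exact: C1_cont.
    - exact: cc_continuous.
    - by apply: (@for_continuous_comp _ _ _ (fun s : R => w + ee s *: rc r) Q) ce _; exact: C1_cont.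
    - exact: ss_continuous.
  apply: (I01_norm cont) => s _.
  rewrite (le_trans (ler_normD _ _))// lerD// normrM -[M]mulr1 ler_pM//.
    exact: bP.
  exact: bQ.
apply/eqP; rewrite -normr_eq0; apply/negPn/negP => n0.
have d0 : 0 < `|dirderiv P 1 w| by rewrite lt_neqAle eq_sym n0 normr_ge0.
have M1 : 0 < M + M + 1 by lra.
(* At the radius (2 M + 1) / |P'| the estimate reads |P'| (2 M + 1) <= 2 M |P'|. *)
have := H _ (divr_gt0 M1 d0); rewrite invf_div mulrAC ler_pdivlMr// mulrDr mulr1.
by move: d0; lra.
Qed.

Lemma liouville u (M : R) : (forall z, differentiable u z) ->
  (forall z, `|cre (u z)| <= M) -> (forall z, `|cim (u z)| <= M) -> forall z, u z = u 0.
Proof.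
move=> du bP bQ.
have P1 := derivative_re du bP bQ.
have Q1 w : dirderiv (fun z => cim (u z)) 1 w = 0.
  (* Multiplication by - i turns the imaginary part into the real part. *)
  have du' z : differentiable (fun z => - 'i * u z : Cx R) z.
    have dc : differentiable (fun z : Cx R => - 'i : Cx R) z by exact: differentiable_cst.
    exact: differentiableM dc (du z).
  have e1 z : cre (- 'i * u z) = cim (u z) by rewrite creM creN cimN cre_i cim_i; ring.
  have e2 z : cim (- 'i * u z) = - cre (u z) by rewrite cimM creN cimN cre_i cim_i; ring.
  have := @derivative_re (fun z => - 'i * u z) M du' _ _ w.
  rewrite (_ : (fun z => cre (- 'i * u z)) = fun z => cim (u z)); last by apply/funext.
  by apply=> z; rewrite ?e1 ?e2 ?normrN.
have D w v : dirderiv (fun z => cre (u z)) v w = 0 /\ dirderiv (fun z => cim (u z)) v w = 0.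
  have [h1 h2] := entire_C1 du w; have [h3 h4] := holo_CR (du w).
  have E (f : Cx R -> R) : C1 f w -> dirderiv f v w = cre v * dirderiv f 1 w + cim v * dirderiv f 'i w.
    by move=> cf; rewrite (dirderiv_frame Cx_frame v cf) big_bool.
  by rewrite !E// P1 Q1 h3 h4 P1 Q1 !(mulr0, oppr0, addr0).
move=> z; rewrite -[z in LHS]add0r; apply: Cx_eqP.
  apply: (@segment_const _ _ (fun z => cre (u z))) => t _; have [<- _] := D (0 + rc t *: z) z.
  exact: C1_dir (entire_C1 du _).1.
apply: (@segment_const _ _ (fun z => cim (u z))) => t _; have [_ <-] := D (0 + rc t *: z) z.
exact: C1_dir (entire_C1 du _).2.
Qed.

Lemma biperiodic_entire_const (w1 w2 : Cx R) u :
  (forall a b : R, rc a * w1 + rc b * w2 = 0 -> a = 0 /\ b = 0) ->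
  (forall z, differentiable u z) -> (forall z, u (z + w1) = u z) -> (forall z, u (z + w2) = u z) ->
  forall z, u z = u 0.
Proof.
move=> lat du u1 u2.
have cu (f : Cx R -> R) : (forall z, {for z, continuous f}) -> forall z, {for z, continuous (f \o u)}.
  move=> cf z; apply: (@for_continuous_comp _ _ _ u f); last exact: cf.
  exact: differentiable_continuous.
have bound (f : Cx R -> R) : (forall z, {for z, continuous f}) -> exists M, forall z, `|f (u z)| <= M.
  move=> cf.
  have [||M1 H1] := biperiodic_bounded lat (cu f cf); [by move=> z; rewrite /= u1|by move=> z; rewrite /= u2|].
  have cNf z : {for z, continuous (fun z => - f z)} by exact: for_continuousNR.
  have [||M2 H2] := biperiodic_bounded lat (cu _ cNf); [by move=> z; rewrite /= u1|by move=> z; rewrite /= u2|].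
  exists (`|M1| + `|M2|) => z; rewrite ler_norml; apply/andP; split.
    have := H2 (- f (u z)) (ex_intro2 _ _ z I erefl).
    by have := ler_norm M2; have := normr_ge0 M1; lra.
  have := H1 (f (u z)) (ex_intro2 _ _ z I erefl).
  by have := ler_norm M1; have := normr_ge0 M2; lra.
have [M1 H1] := bound cre (@cre_continuous R); have [M2 H2] := bound cim (@cim_continuous R).
apply: (@liouville u (`|M1| + `|M2|)) => // z.
  by apply: le_trans (H1 z) _; have := ler_norm M1; have := normr_ge0 M2; lra.
by apply: le_trans (H2 z) _; have := ler_norm M2; have := normr_ge0 M1; lra.
Qed.

End Liouville.

Lemma near_differentiable (K : numFieldType) (V W : normedModType K) (f g : V -> W) (x : V) :
  (\forall y \near x, f y = g y) -> differentiable f x -> differentiable g x.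
Proof.
move=> fg /diff_locallyP[cd E].
have N : \forall h \near (0 : V), f (h + x) = g (h + x).
  have c : (fun h : V => h + x) @ (0 : V) --> x.
    by rewrite -[X in _ --> X]add0r; apply: cvgD; [exact: cvg_id|exact: cvg_cst].
  exact: (c _ fg).
have gE : g \o shift x = cst (g x) + 'd f x +o_ (0 : V) id.
  apply/eqaddoP => e e0; have /eqaddoP/(_ e e0) := E.
  apply: filterS2 N => h; rewrite /= => fgh; congr (`|_| <= _).
  change (f (h + x) - (f x + 'd f x h) = g (h + x) - (g x + 'd f x h)).
  by rewrite fgh (nbhs_singleton fg).
by apply/diff_locallyP; rewrite (diff_unique cd gE).
Qed.

Lemma diff_translate (K : numFieldType) (V : normedModType K) (c p v : V) :
  differentiable (fun q : V => q + c) p -> 'd (fun q : V => q + c) p v = v.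
Proof.
move=> dS; apply: (etrans (esym (deriveE v dS))); rewrite -[RHS](@derive_id _ _ p v) /derive.
have -> // : (fun h : K => h^-1 *: (((fun q : V => q + c) \o shift p) (h *: v) - (p + c))) =
    (fun h : K => h^-1 *: ((id \o shift p) (h *: v) - id p)).
by apply/funext => h; rewrite /= opprD addrACA subrr addr0.
Qed.

(** * The action of the elliptic curve *)

Section Flow.
Variables (R : realType) (m n : nat) (X B : topologicalType)
  (SX : complex_structure X 'rV[Cx R]_m)
  (SB : complex_structure B 'rV[Cx R]_n)
  (E : elliptic_curve R) (P : elliptic_bundle SX SB E).
Local Notation W := 'rV[Cx R]_m.
Local Notation w1 := (ec_w1 E).
Local Notation w2 := (ec_w2 E).
Local Notation proj := (ec_proj E).
Local Notation e := (fr_e (f := rV_frame m)).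
Implicit Types (z : Cx R) (x y : X) (a b : chart X W).

Lemma lat : forall s t : R, rc s * w1 + rc t * w2 = 0 -> s = 0 /\ t = 0.
Proof. exact: ec_lattice. Qed.

Lemma proj0 : proj 0 = 0.
Proof. by apply: (@addrI _ (proj 0)); rewrite -ec_projD !addr0. Qed.

Lemma proj_w1 : proj w1 = 0.
Proof. by apply/ec_proj_ker; exists 1, 0; rewrite mul1r mul0r addr0. Qed.

Lemma proj_w2 : proj w2 = 0.
Proof. by apply/ec_proj_ker; exists 0, 1; rewrite mul1r mul0r add0r. Qed.

(** The action of E lifted to C, so that orbits become maps defined on the whole plane with the
    lattice as periods. *)
Definition flow z x := eb_act P (proj z) x.

Lemma flow0 x : flow 0 x = x.
Proof. by rewrite /flow proj0 eb_act0. Qed.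

Lemma flowD z z' x : flow (z + z') x = flow z (flow z' x).
Proof. by rewrite /flow ec_projD eb_actD. Qed.

Lemma flow_w1 z x : flow (z + w1) x = flow z x.
Proof. by rewrite /flow ec_projD proj_w1 addr0. Qed.

Lemma flow_w2 z x : flow (z + w2) x = flow z x.
Proof. by rewrite /flow ec_projD proj_w2 addr0. Qed.

Lemma proj_continuous z : {for z, continuous proj}.
Proof. by have [] := @ec_proj_holo R E z I. Qed.

Lemma flow_continuous (q : Cx R * X) : {for q, continuous (fun q : Cx R * X => flow q.1 q.2)}.
Proof.
apply: (@for_continuous_comp _ _ _ (fun q : Cx R * X => (proj q.1, q.2)) (fun p : E * X => eb_act P p.1 p.2)).
  apply: for_continuous_pair; last exact: for_continuous_snd.
  by apply: (@for_continuous_comp _ _ _ fst proj); [exact: for_continuous_fst|exact: proj_continuous].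
by have [] := @eb_act_holo _ _ _ _ _ _ _ _ P (proj q.1, q.2) I.
Qed.

Lemma flow_continuous_r z x : {for x, continuous (flow z)}.
Proof.
apply: (@for_continuous_comp _ _ _ (fun x => (z, x)) (fun q : Cx R * X => flow q.1 q.2)).
  by apply: for_continuous_pair; [exact: for_continuous_cst|exact: cvg_id].
exact: flow_continuous.
Qed.

Lemma flow_continuous_l z x : {for z, continuous (fun z => flow z x)}.
Proof.
apply: (@for_continuous_comp _ _ _ (fun z => (z, x)) (fun q : Cx R * X => flow q.1 q.2)).
  by apply: for_continuous_pair; [exact: cvg_id|exact: for_continuous_cst].
exact: flow_continuous.
Qed.

Lemma flow_diff z x a b : atlas SX a -> atlas SX b -> chart_dom a x -> chart_dom b (flow z x) ->
  differentiable (fun q : Cx R * W => chart_map b (flow q.1 (chart_inv a q.2))) (z, chart_map a x).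
Proof.
move=> aA bA ax bx.
have [c cA cd] := cs_cover (ec_str E) (proj z).
have pA : prod_atlas (ec_str E) SX (prod_chart c a) by exists c, a.
have d1 := (eb_act_holo P (x := (proj z, x)) I).2 (prod_chart c a) b pA bA (conj cd ax) bx.
have d2 : differentiable (fun z => chart_map c (proj z)) z.
  exact: ((@ec_proj_holo R E z I).2 (Chart setT id id) c erefl cA I cd).
have dfst : differentiable (fst : Cx R * W -> Cx R) (z, chart_map a x).
  by apply: linear_differentiable => q; exact: cvg_fst.
have dsnd : differentiable (snd : Cx R * W -> W) (z, chart_map a x).
  by apply: linear_differentiable => q; exact: cvg_snd.
have d3 : differentiable (fun q : Cx R * W => (chart_map c (proj q.1), q.2)) (z, chart_map a x).
  apply: differentiable_pair; last exact: dsnd.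
  exact: (@differentiable_comp _ _ _ _ fst (fun z => chart_map c (proj z)) _ dfst d2).
have d4 := differentiable_comp d3 d1.
apply: near_differentiable d4.
have N : \forall q \near ((z, chart_map a x) : Cx R * W), chart_dom c (proj q.1).
  have ct : {for (z, chart_map a x), continuous (fun q : Cx R * W => proj q.1)}.
    by apply: (@for_continuous_comp _ _ _ fst proj); [exact: for_continuous_fst|exact: proj_continuous].
  by apply: ct; apply: open_nbhs_nbhs; split; [exact: cs_open_dom cA|].
by apply: filterS N => q cq; rewrite /= (cs_mapK cA cq).
Qed.

Lemma orbit_diff z x b : atlas SX b -> chart_dom b (flow z x) ->
  differentiable (fun z => chart_map b (flow z x)) z.
Proof.
move=> bA bx.
have [a aA ax] := cs_cover SX x.
have d1 := flow_diff aA bA ax bx.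
have d2 : differentiable (fun z => (z, chart_map a x)) z.
  apply: differentiable_pair; first by exact: ex_diff.
  exact: differentiable_cst.
have := @differentiable_comp _ _ _ _ (fun z => (z, chart_map a x)) _ z d2 d1.
apply: near_differentiable; near=> z'.
by rewrite /= (cs_mapK aA ax).
Unshelve. all: by end_near. Qed.

Lemma translate_diff z x a b : atlas SX a -> atlas SX b -> chart_dom a x -> chart_dom b (flow z x) ->
  differentiable (fun y : W => chart_map b (flow z (chart_inv a y))) (chart_map a x).
Proof.
move=> aA bA ax bx.
have d1 := flow_diff aA bA ax bx.
have d2 : differentiable (fun y : W => (z, y)) (chart_map a x).
  apply: differentiable_pair; first exact: differentiable_cst.
  by exact: ex_diff.
exact: (@differentiable_comp _ _ _ _ (fun y : W => (z, y)) _ _ d2 d1).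
Qed.

Let fixed x := forall z, flow z x = x.

Lemma flow_int (p q : int) z x : flow (z + (p%:~R * w1 + q%:~R * w2)) x = flow z x.
Proof.
have -> : flow (z + (p%:~R * w1 + q%:~R * w2)) x = flow z (flow (p%:~R * w1 + q%:~R * w2) x) by rewrite flowD.
congr (flow z _); rewrite /flow; have -> : proj (p%:~R * w1 + q%:~R * w2) = 0.
  by apply/ec_proj_ker; exists p, q.
exact: eb_act0.
Qed.

Let cell (s t : R) : Cx R := rc s * w1 + rc t * w2.

Lemma flow_cell z : exists s t : R, [/\ 0 <= s <= 1, 0 <= t <= 1 & forall x, flow z x = flow (cell s t) x].
Proof.
pose s := lat1 w1 w2 z; pose t := lat2 w1 w2 z.
have fl (r : R) : 0 <= r - (Num.floor r)%:~R <= 1.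
  have /andP[h1 h2] := real_floor_itv (num_real r); rewrite rmorphD /= in h2.
  by rewrite subr_ge0 h1 lerBlDl ltW.
exists (s - (Num.floor s)%:~R), (t - (Num.floor t)%:~R); split; [exact: fl|exact: fl|move=> x].
rewrite -[RHS](flow_int (Num.floor s) (Num.floor t)); congr flow.
by rewrite /cell {1}(latE lat z) -/s -/t !rcD !rcN !rc_int; ring.
Qed.

(* By the tube lemma the orbits of the points near [x] stay in one chart, where
   they are bounded, hence constant by Liouville. *)
Lemma fixed_near x : fixed x -> \forall y \near x, fixed y.
Proof.
move=> fx; have [a aA ax] := cs_cover SX x.
have cell_cont (q : R * R) : {for q, continuous (fun q : R * R => cell q.1 q.2)}.
  apply: (@for_continuousD _ (Cx R) _ (fun q : R * R => rc q.1 *: w1) (fun q : R * R => rc q.2 *: w2)).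
    by apply: for_continuous_rcZ; [exact: for_continuous_fst|exact: for_continuous_cst].
  by apply: for_continuous_rcZ; [exact: for_continuous_snd|exact: for_continuous_cst].
(* Two nested tubes, one for each coordinate of the compact period cell. *)
have N : \forall y \near x, forall s : R, 0 <= s <= 1 -> forall t : R, 0 <= t <= 1 ->
    chart_dom a (flow (cell s t) y).
  apply: near_tube => s _.
  suff : \forall q \near (x, s), forall t : R, 0 <= t <= 1 -> chart_dom a (flow (cell q.2 t) q.1) by [].
  apply: near_tube => t _.
  have ct : {for ((x, s), t), continuous (fun r : (X * R) * R => flow (cell r.1.2 r.2) r.1.1)}.
    apply: (@for_continuous_comp _ _ _ (fun r : (X * R) * R => (cell r.1.2 r.2, r.1.1))
      (fun q : Cx R * X => flow q.1 q.2)); last exact: flow_continuous.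
    have c1 : {for ((x, s), t), continuous (fun r : (X * R) * R => r.1.1)}.
      by apply: (@for_continuous_comp _ _ _ fst fst); exact: for_continuous_fst.
    have c2 : {for ((x, s), t), continuous (fun r : (X * R) * R => r.1.2)}.
      by apply: (@for_continuous_comp _ _ _ fst snd); [exact: for_continuous_fst|exact: for_continuous_snd].
    apply: for_continuous_pair; last exact: c1.
    apply: (@for_continuous_comp _ _ _ (fun r : (X * R) * R => (r.1.2, r.2)) (fun q : R * R => cell q.1 q.2)).
      by apply: for_continuous_pair; [exact: c2|exact: for_continuous_snd].
    exact: cell_cont.
  have : \forall r \near ((x, s), t), chart_dom a (flow (cell r.1.2 r.2) r.1.1).
    by apply: ct; apply: open_nbhs_nbhs; split; [exact: cs_open_dom aA|rewrite /= fx].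
  by [].
apply: filterS N => y Hy.
have ady z : chart_dom a (flow z y) by have [s [t [s01 t01 ->]]] := flow_cell z; exact: Hy.
have ay : chart_dom a y by rewrite -(flow0 y).
move=> z; rewrite -(cs_mapK aA (ady z)) -[RHS](cs_mapK aA ay); congr (chart_inv a _).
apply/rowP => j; rewrite -[in RHS](flow0 y).
apply: (@biperiodic_entire_const R w1 w2 (fun z => chart_map a (flow z y) 0 j) lat).
- move=> z'.
  exact: (@differentiable_comp _ _ _ _ (fun z => chart_map a (flow z y)) (fun M : W => M 0 j) z'
    (orbit_diff aA (ady z')) (differentiable_coord _ _ _)).
- by move=> z'; rewrite flow_w1.
- by move=> z'; rewrite flow_w2.
Qed.

Hypothesis cX : connected [set: X].

(** A trivialization shows that the points t (b, e) move. To reach an arbitrary x, the fixed set is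
    shown to be open, by [fixed_near], and closed, as X is Hausdorff: by connectedness one fixed
    point would make all points fixed. *)
Lemma not_fixed x : ~ fixed x.
Proof.
move=> fx.
have oF : open [set y | fixed y] by rewrite openE => y; exact: fixed_near.
have cF : closed [set y | fixed y].
  rewrite -[X in closed X]setCK; apply: open_closedC; rewrite openE => y /= nfy.
  have [z nz] : exists z, flow z y <> y.
    by apply: contrapT => /forallNP H; apply: nfy => z; apply: contrapT; exact: H.
  have := cs_hausdorff SX; rewrite open_hausdorff => /(_ (flow z y) y).
  move=> /(_ (introN eqP nz))[[A C]] /= [Az Cy] [oA oC /eqP AC].
  have h1 : \forall y' \near y, A (flow z y').
    by apply: (flow_continuous_r (z := z)); apply: open_nbhs_nbhs; split=> //; exact: set_mem Az.
  have h2 : \forall y' \near y, C y' by apply: open_nbhs_nbhs; split=> //; exact: set_mem Cy.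
  apply: filterS2 h1 h2 => y' Ay' Cy' fy'.
  by have : (A `&` C) y' by [split=> //; rewrite -(fy' z)]; rewrite AC.
have all : [set y | fixed y] = [set: X].
  by apply: cX; [exists x|exists [set y | fixed y] => //; rewrite setTI|exists [set y | fixed y] => //; rewrite setTI].
have [U [t [t' [[oU Ux] _ _ [tK _] tD]]]] := eb_locally_trivial P (eb_proj P x).
have : [set y | fixed y] (t (eb_proj P x, 0)) by rewrite all.
(* The half period acts on t (b, 0) as the translation by its image in E, which is not 0 since 1 / 2
   is not an integer. *)
move=> /(_ (rc 2^-1 * w1)); rewrite /flow -tD// addr0 => E0.
have [_ h1] := tK _ (proj (rc 2^-1 * w1)) Ux; have [_ h2] := tK _ 0 Ux.
have : proj (rc 2^-1 * w1) = 0 by have := h1; rewrite E0 h2 => -[].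
move=> /ec_proj_ker[p [q pq]].
have [|h _] := @lat (2^-1 - p%:~R) (- q%:~R).
  by rewrite rcD !rcN !rc_int mulrDl pq; ring.
have h2p : ((p * 2)%:~R : R) = 1%:~R.
  have pE : p%:~R = 2^-1 :> R by lra.
  by rewrite intrM pE -[2%:~R]/(2%:R : R) mulVf// pnatr_eq0.
by move/eqP: h2p; rewrite eqr_int => /eqP; lia.
Qed.

(** A zero of the derivative at z0 spreads along the orbit, because the translation by z1 - z0 is
    holomorphic and carries the orbit to itself. The orbit would then be constant and x fixed. *)
Lemma orbit_immersed z0 x b : atlas SX b -> chart_dom b (flow z0 x) ->
  'd (fun z => chart_map b (flow z x)) z0 1 != 0.
Proof.
move=> bA bx; apply/eqP => d0; apply: (@not_fixed x) => z.
have D c z1 : atlas SX c -> chart_dom c (flow z1 x) -> 'd (fun z => chart_map c (flow z x)) z1 1 = 0.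
  move=> cA cx.
  have E' z' : flow z' x = flow (z1 - z0) (flow (z' + (z0 - z1)) x).
    by rewrite -flowD; congr flow; ring.
  have cx' : chart_dom c (flow (z1 - z0) (flow z0 x)) by rewrite -flowD subrK.
  have dt := translate_diff bA cA bx cx'.
  have dsh : differentiable (fun z' : Cx R => z' + (z0 - z1)) z1.
    apply: (@differentiableD _ _ _ id (cst (z0 - z1))); first by exact: ex_diff.
    exact: differentiable_cst.
  have e0 : z1 + (z0 - z1) = z0 by ring.
  have db : differentiable (fun z => chart_map b (flow z x)) (z1 + (z0 - z1)) by rewrite e0; exact: orbit_diff.
  have dbs := differentiable_comp dsh db.
  have dt' : differentiable (fun y : W => chart_map c (flow (z1 - z0) (chart_inv b y)))
      (((fun z => chart_map b (flow z x)) \o (fun z' : Cx R => z' + (z0 - z1))) z1) by rewrite /= e0.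
  have N : \forall z' \near z1,
      ((fun y : W => chart_map c (flow (z1 - z0) (chart_inv b y))) \o
       ((fun z => chart_map b (flow z x)) \o (fun z' : Cx R => z' + (z0 - z1)))) z' = chart_map c (flow z' x).
    have ct : {for z1, continuous (fun z' => flow (z' + (z0 - z1)) x)}.
      apply: (@for_continuous_comp _ _ _ (fun z' => z' + (z0 - z1)) (fun z => flow z x)).
        by apply: for_continuousD; [exact: cvg_id|exact: for_continuous_cst].
      exact: flow_continuous_l.
    have N1 : \forall z' \near z1, chart_dom b (flow (z' + (z0 - z1)) x).
      by apply: ct; apply: open_nbhs_nbhs; split; [exact: cs_open_dom bA|rewrite e0].
    by apply: filterS N1 => z' bz'; rewrite /= (cs_mapK bA bz') -E'.
  rewrite -(near_diff_val (1 : Cx R) N (differentiable_comp dbs dt') (orbit_diff cA cx)).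
  have d1 := diff_translate (1 : Cx R) dsh.
  have d2 : 'd ((fun z => chart_map b (flow z x)) \o (fun z' : Cx R => z' + (z0 - z1))) z1 (1 : Cx R) = 0.
    rewrite (diff_comp dsh db) [LHS]/comp d1 e0.
    exact: d0.
  by rewrite (diff_comp dbs dt') [LHS]/comp d2 linear0.
(* A real valued indicator of the return to x: it is locally constant, so [segment_const] applies to
   it without any reference to charts. *)
pose chi z := if pselect (flow z x = x) then 1 else 0 : R.
have chi_loc z1 : \forall z' \near z1, chi z' = chi z1.
  suff : \forall z' \near z1, flow z' x = flow z1 x by apply: filterS => z' E'; rewrite /chi E'.
  have [c cA cx] := cs_cover SX (flow z1 x).
  have N : \forall z' \near z1, chart_dom c (flow z' x).
    by apply: flow_continuous_l; apply: open_nbhs_nbhs; split; [exact: cs_open_dom cA|].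
  have K k : \forall z' \near z1, e k (chart_map c (flow z' x)) = e k (chart_map c (flow z1 x)).
    apply: (@near_const _ _ (fun z' => e k (chart_map c (flow z' x)))).
    apply: filterS N => z' cz' v.
    have dv : 'd (fun z => chart_map c (flow z x)) z' v = 0.
      by rewrite -[X in 'd _ _ X]mulr1 -[v * 1]/(v *: (1 : Cx R)) linearZ /= D// scaler0.
    by have := has_dir_frame k v (orbit_diff cA cz'); rewrite dv fr_e0.
  have K' : \forall z' \near z1, forall k, e k (chart_map c (flow z' x)) = e k (chart_map c (flow z1 x)).
    exact: (@filter_forall _ _ (fun k z' => e k (chart_map c (flow z' x)) = e k (chart_map c (flow z1 x)))
      (nbhs z1) (nbhs_filter z1) K).
  apply: filterS2 N K' => z' cz' Kz'.
  by rewrite -(cs_mapK cA cz') -(cs_mapK cA cx) (rV_frame_eq Kz').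
have : chi (0 + z) = chi 0.
  apply: segment_const => t _; apply: (@has_dir_near _ _ (fun=> chi (0 + rc t *: z))); last exact: has_dir_cst.
  by apply: filterS (chi_loc (0 + rc t *: z)) => q ->.
rewrite add0r /chi flow0; case: pselect => // nz; case: pselect => // xx /eqP.
by rewrite eq_sym oner_eq0.
Qed.

End Flow.

Section C2Lemmas.
Context {R : realType} {V : normedModType (Cx R)}.

Lemma C2_near (f g : V -> R) (p : V) : (\forall q \near p, f q = g q) -> C2 f p -> C2 g p.
Proof.
move=> fg [h1 h2]; split; first exact: C1_near fg h1.
move=> v; apply: C1_near (h2 v).
apply: filterS2 (near_near fg) (C1_C1 h1) => q Eq cq.
by rewrite (has_dirE (has_dir_near Eq (C1_dir v cq))).
Qed.

Lemma C2_coord (fr : frame V) (k : fr_I fr) (p : V) : C2 (fr_e (f:=fr) k) p.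
Proof.
have dE v : dirderiv (fr_e (f:=fr) k) v = fun=> fr_e (f:=fr) k v.
  by apply/funext => q; exact: has_dirE (has_dir_coord k q v).
split; last by move=> v; rewrite dE; exact: C1_cst.
apply: (@C1_intro _ _ _ _ (fun v _ => fr_e (f:=fr) k v)); near=> q; split; first exact: fr_ec.
by move=> v; split; [exact: has_dir_coord|exact: cvg_cst].
Unshelve. all: by end_near. Qed.

Variable W0 : normedModType (Cx R).

Lemma C1_fst (f : W0 -> R) (p : W0 * V) : C1 f p.1 -> C1 (fun q : W0 * V => f q.1) p.
Proof.
move=> cf; have N : \forall q \near p, D1 f q.1 by exact: (@for_continuous_fst W0 V p) cf.
apply: filterS N => q [c1 d1]; split.
  by apply: (@for_continuous_comp _ _ _ fst f); [exact: for_continuous_fst|exact: c1].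
move=> v; have [h1 h2] := d1 v.1; split; first exact: h1.
by apply: (@for_continuous_comp _ _ _ fst (dirderiv f v.1)); [exact: for_continuous_fst|exact: h2].
Qed.

Lemma C2_fst (f : W0 -> R) (p : W0 * V) : C2 f p.1 -> C2 (fun q : W0 * V => f q.1) p.
Proof. by move=> [h1 h2]; split=> [|v]; [exact: C1_fst|exact: C1_fst (h2 v.1)]. Qed.

Lemma star_ball (N : set V) (p0 : V) : open N -> N p0 -> exists D : set V,
  [/\ open D, D p0, D `<=` N &
    forall p (t : R), D p -> 0 <= t <= 1 -> D (p0 + rc t *: (p - p0))].
Proof.
move=> oN Np0; have /nbhs_ballP[r /= r0 rN] := open_nbhs_nbhs (conj oN Np0).
exists (ball p0 r); split; [exact: ball_open|exact: ballxx|exact: rN|move=> p t].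
rewrite -ball_normE /= => pr /andP[t0 t1].
rewrite opprD addrA subrr sub0r normrN normrZ norm_rc.
apply: le_lt_trans pr; rewrite distrC -[leRHS]mul1r ler_wpM2r// -rc1 le_rc.
by rewrite ger0_norm.
Qed.

End C2Lemmas.

(** * Patches swept out by smooth sections *)

Section SectionPatch.
Variables (R : realType) (m n : nat) (X B : topologicalType)
  (SX : complex_structure X 'rV[Cx R]_m)
  (SB : complex_structure B 'rV[Cx R]_n)
  (E : elliptic_curve R) (P : elliptic_bundle SX SB E).
Hypothesis cX : connected [set: X].
Local Notation W := 'rV[Cx R]_m.
Local Notation W0 := 'rV[Cx R]_n.
Local Notation V0 := (W0 * Cx R)%type.
Local Notation e := (fr_e (f := rV_frame m)).
Local Notation e0 := (fr_e (f := rV_frame n)).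
Local Notation flow := (flow P).
Local Notation frI := (prod_frame (@Cx_frame R) (rV_frame m)).
Local Notation fr := (prod_frame (rV_frame n) (@Cx_frame R)).
Implicit Types (z : Cx R) (x y : X) (a b : chart X W) (p q v : V0) (w : W0).

Section Tau.
Variables (D : set W0) (tau : W0 -> X).
Hypothesis oD : open D.
Hypothesis tau_c : forall w, D w -> {for w, continuous tau}.
Hypothesis tau2 : forall w a k, D w -> atlas SX a -> chart_dom a (tau w) ->
  C2 (fun w => e k (chart_map a (tau w))) w.

(* Sections need not take values in the trivialized part of [X], so the patches
   are built from the flow rather than from local trivializations. *)
Definition swept p := flow p.2 (tau p.1).

Lemma swept_continuous p : D p.1 -> {for p, continuous swept}.
Proof.
move=> Dp; apply: (@for_continuous_comp _ _ _ (fun p : V0 => (p.2, tau p.1)) (fun q : Cx R * X => flow q.1 q.2)).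
  apply: for_continuous_pair; first exact: for_continuous_snd.
  by apply: (@for_continuous_comp _ _ _ fst tau); [exact: for_continuous_fst|exact: tau_c].
exact: flow_continuous.
Qed.

(** [swept] is the holomorphic flow composed with Phi, which is only real C2 because tau is; the two
    regularities are combined by [compose_C2]. *)
Lemma swept_C2 p a k : D p.1 -> atlas SX a -> chart_dom a (swept p) ->
  C2 (fun q => e k (chart_map a (swept q))) p.
Proof.
move=> Dp aA ap; have [a0 a0A a0p] := cs_cover SX (tau p.1).
pose N : set V0 := [set q | D q.1 /\ chart_dom a0 (tau q.1)].
have tau_near w : D w -> chart_dom a0 (tau w) -> \forall w' \near w, D w' /\ chart_dom a0 (tau w').
  move=> Dw aw.
  have h1 : \forall w' \near w, D w' by apply: open_nbhs_nbhs; split.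
  have h2 : \forall w' \near w, chart_dom a0 (tau w').
    by apply: (tau_c Dw); apply: open_nbhs_nbhs; split=> //; exact: cs_open_dom a0A.
  by apply: filterS2 h1 h2.
have oN : open N.
  by rewrite openE => q [Dq aq]; exact: (@for_continuous_fst W0 (Cx R) q) (tau_near q.1 Dq aq).
pose Phi q : (Cx R * W)%type := (q.2, chart_map a0 (tau q.1)).
pose dP q v : (Cx R * W)%type := (v.2, dchart tau a0 q.1 v.1).
have cPhi q : N q -> {for q, continuous Phi}.
  move=> [Dq aq]; apply: for_continuous_pair; first exact: for_continuous_snd.
  apply: (@for_continuous_comp _ _ _ (fun q : V0 => tau q.1) (chart_map a0)).
    by apply: (@for_continuous_comp _ _ _ fst tau); [exact: for_continuous_fst|exact: tau_c].
  exact: cs_continuous_map a0A _ aq.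
have Phi2 (k' : fr_I frI) q : N q -> C2 (fun q => fr_e (f:=frI) k' (Phi q)) q.
  move=> [Dq aq]; case: k' => k'; first exact: (C2_coord (fr := fr) (inr k')).
  by apply: (@C2_fst R (Cx R) W0 (fun w => e k' (chart_map a0 (tau w))) q); exact: tau2.
have PhiD (k' : fr_I frI) q v : N q ->
    has_dir (fun q => fr_e (f:=frI) k' (Phi q)) v q (fr_e (f:=frI) k' (dP q v)).
  move=> [Dq aq]; case: k' => k'; first exact: (has_dir_coord (fr := fr) (inr k')).
  apply/has_dirP => r r0.
  by have /has_dirP/(_ r r0) := dchart_dir tau2 v.1 k' Dq a0A aq.
apply: (@C2_near _ _ (fun q => e k (chart_map a (flow (Phi q).1 (chart_inv a0 (Phi q).2))))).
  apply: filterS (open_nbhs_nbhs (conj oN (conj Dp a0p))) => q [Dq aq].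
  by rewrite /Phi /= (cs_mapK a0A aq).
apply: (compose_C2 oN cPhi Phi2 PhiD (f := fun x : Cx R * W => e k (chart_map a (flow x.1 (chart_inv a0 x.2))))) => //.
apply: (@holo_frame_C2 _ _ _ (fun x : Cx R * W => chart_map a (flow x.1 (chart_inv a0 x.2)))).
have N1 : \forall x \near Phi p, chart_img a0 x.2.
  apply: (@for_continuous_snd (Cx R) W (Phi p)); apply: open_nbhs_nbhs; split; first exact: cs_open_img a0A.
  by exists (tau p.1).
have N2 : \forall x \near Phi p, chart_dom a (flow x.1 (chart_inv a0 x.2)).
  have ct : {for Phi p, continuous (fun x : Cx R * W => flow x.1 (chart_inv a0 x.2))}.
    apply: (@for_continuous_comp _ _ _ (fun x : Cx R * W => (x.1, chart_inv a0 x.2)) (fun q : Cx R * X => flow q.1 q.2));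
      last exact: flow_continuous.
    apply: for_continuous_pair; first exact: for_continuous_fst.
    apply: (@for_continuous_comp _ _ _ snd (chart_inv a0)); first exact: for_continuous_snd.
    by apply: (cs_continuous_inv a0A); exists (tau p.1).
  apply: ct; apply: open_nbhs_nbhs; split; first exact: cs_open_dom aA.
  by rewrite /Phi /= (cs_mapK a0A a0p).
apply: filterS2 N1 N2 => -[z _] /= [y ay <-]; rewrite (cs_mapK a0A ay) => az.
exact: flow_diff.
Qed.

Lemma swept_vertical p a z : D p.1 -> atlas SX a -> chart_dom a (swept p) ->
  dchart swept a p ((0, z) : V0) = 'd (fun z : Cx R => chart_map a (flow z (tau p.1))) (p.2) z.
Proof.
move=> Dp aA ap; apply: dchart_unique => k.
have H := has_dir_frame k z (orbit_diff aA ap).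
apply/has_dirP => r r0; move/has_dirP: H => /(_ r r0); apply: filterS => h.
rewrite /swept; have -> : (p + rc h *: ((0, z) : V0)).1 = p.1 by rewrite /= scaler0 addr0.
by [].
Qed.

Lemma swept_lin p a z : D p.1 -> atlas SX a -> chart_dom a (swept p) ->
  dchart swept a p ((0, 'i * z) : V0) = ('i : Cx R) *: dchart swept a p ((0, z) : V0).
Proof. by move=> Dp aA ap; rewrite !swept_vertical// -linearZ. Qed.

Lemma swept_immersed p a z : D p.1 -> atlas SX a -> chart_dom a (swept p) -> z != 0 ->
  dchart swept a p ((0, z) : V0) != 0.
Proof.
move=> Dp aA ap z0; rewrite swept_vertical//.
have -> : 'd (fun z : Cx R => chart_map a (flow z (tau p.1))) (p.2) z =
    z *: 'd (fun z => chart_map a (flow z (tau p.1))) (p.2) 1.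
  by rewrite -linearZ /=; congr ('d _ _ _); rewrite -[RHS]/(z * 1) mulr1.
by rewrite scaler_eq0 negb_or z0; exact: orbit_immersed.
Qed.

Lemma swept_patch w0 : D w0 -> (forall w (t : R), D w -> 0 <= t <= 1 -> D (w0 + rc t *: (w - w0))) ->
  patch SX (ec_w1 E) (ec_w2 E) D w0 swept.
Proof.
move=> Dw0 starD; split=> //.
- by move=> p; exact: swept_continuous.
- by move=> p a k; exact: swept_C2.
- by move=> p z Dp; apply: swept_lin => //; [exact: chart_at_atlas|exact: chart_at_dom].
- move=> p Dp; apply: swept_immersed => //; [exact: chart_at_atlas|exact: chart_at_dom|].
  apply/eqP => w10; have [|/eqP] := @lat R E 1 0; first by rewrite w10 mulr0 rc0 mul0r addr0.
  by rewrite oner_eq0.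
- by move=> w z Dw; rewrite /swept /= flow_w1.
- by move=> w z Dw; rewrite /swept /= flow_w2.
Qed.

(** The differential of the projection kills the orbit direction o, which is nonzero, and sends the
    derivative s of the section to dl, nonzero as n > 0. Hence the tangent space of X is not a
    single complex line. *)
Lemma swept_noncollinear w (b : chart B W0) : (0 < n)%N -> D w -> atlas SB b ->
  chart_dom b (eb_proj P (tau w)) ->
  (\forall w' \near w, chart_map b (eb_proj P (tau w')) = w') ->
  forall u : W, u != 0 -> exists u' : W, forall c : Cx R, u' != c *: u.
Proof.
move=> n0 Dw bA bw sec u u0.
have [a aA aw] := cs_cover SX (tau w).
pose h (y : W) : W0 := chart_map b (eb_proj P (chart_inv a y)).
have hd y : chart_dom a y -> chart_dom b (eb_proj P y) -> differentiable h (chart_map a y).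
  by move=> ay bY; exact: ((eb_proj_holo P (x := y) I).2 a b aA bA ay bY).
have dh := hd _ aw bw.
have near_h : \forall y \near chart_map a (tau w), differentiable h y.
  have ai : chart_img a (chart_map a (tau w)) by exists (tau w).
  have N1 : \forall y \near chart_map a (tau w), chart_img a y.
    by apply: open_nbhs_nbhs; split=> //; exact: cs_open_img aA.
  have N2 : \forall y \near chart_map a (tau w), chart_dom b (eb_proj P (chart_inv a y)).
    have ct : {for chart_map a (tau w), continuous (fun y : W => eb_proj P (chart_inv a y))}.
      apply: (@for_continuous_comp _ _ _ (chart_inv a) (eb_proj P)); first exact: (cs_continuous_inv aA).
      by have [] := eb_proj_holo P (x := chart_inv a (chart_map a (tau w))) I.
    apply: ct; apply: open_nbhs_nbhs; split; first exact: cs_open_dom bA.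
    by rewrite (cs_mapK aA aw).
  by apply: filterS2 N1 N2 => _ [y ay <-]; rewrite (cs_mapK aA ay); exact: hd.
pose dl : W0 := delta_mx 0 (Ordinal n0).
have dl0 : dl != 0.
  by apply/eqP => /matrixP/(_ 0 (Ordinal n0)); rewrite !mxE !eqxx => /eqP; rewrite oner_eq0.
pose s := dchart tau a w dl.
have hs : 'd h (chart_map a (tau w)) s = dl.
  apply: rV_frame_eq => k.
  have [c1 _] := holo_frame_C2 k near_h.
  rewrite -(has_dirE (has_dir_frame k s dh)).
  have PhiD (k' : fr_I (rV_frame m)) w' (v : W0) : [set w] w' ->
      has_dir (fun w' => e k' (chart_map a (tau w'))) v w' (e k' (dchart tau a w' v)).
    by move=> ->; exact: (dchart_dir tau2).
  have H := @compose_dir _ _ _ (rV_frame m) (fun w => chart_map a (tau w)) (dchart tau a) [set w] PhiD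
    (fun y : W => e0 k (h y)) w dl (erefl w) c1.
  rewrite -(has_dirE H); apply: has_dirE; apply: has_dir_near (has_dir_coord k w dl).
  have N3 : \forall w' \near w, chart_dom a (tau w').
    by apply: (tau_c Dw); apply: open_nbhs_nbhs; split=> //; exact: cs_open_dom aA.
  by apply: filterS2 sec N3 => w' sw aw'; rewrite /h (cs_mapK aA aw') sw.
have aw0 : chart_dom a (flow 0 (tau w)) by rewrite flow0.
pose o := 'd (fun z => chart_map a (flow z (tau w))) 0 1.
have o0 : o != 0 by exact: orbit_immersed.
have ho : 'd h (chart_map a (tau w)) o = 0.
  have dor := orbit_diff aA aw0.
  have dh' : differentiable h ((fun z => chart_map a (flow z (tau w))) 0) by rewrite /= flow0.
  pose k0 := chart_map b (eb_proj P (tau w)).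
  have N : \forall z \near (0 : Cx R), (h \o (fun z => chart_map a (flow z (tau w)))) z = (cst k0) z.
    have N3 : \forall z \near (0 : Cx R), chart_dom a (flow z (tau w)).
      by apply: flow_continuous_l; apply: open_nbhs_nbhs; split=> //; exact: cs_open_dom aA.
    by apply: filterS N3 => z az; rewrite /h /= (cs_mapK aA az) /flow eb_proj_act.
  have c1 : 'd (h \o (fun z => chart_map a (flow z (tau w)))) (0 : Cx R) 1 = 'd h (chart_map a (flow 0 (tau w))) o.
    exact: (congr1 (fun f => f (1 : Cx R)) (diff_comp dor dh')).
  have c2 : 'd (cst k0) (0 : Cx R) 1 = 0 by rewrite diff_cst.
  have c3 := near_diff_val (1 : Cx R) N (differentiable_comp dor dh') (differentiable_cst k0 0).
  by move: c1; rewrite flow0 => <-; rewrite c3 c2.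
apply: contrapT => /forallNP H.
have col (u' : W) : exists c, u' = c *: u.
  have /existsNP[c /negP] := H u'; rewrite negbK => /eqP ->; by exists c.
have [c oE] := col o; have [d sE] := col s.
have c0 : c != 0 by apply: contra_neq o0 => c0; rewrite oE c0 scale0r.
have hu : 'd h (chart_map a (tau w)) u = 0.
  by apply/eqP; have /eqP := ho; rewrite oE linearZ scaler_eq0 (negPf c0).
by move/eqP: hs; rewrite sE linearZ /= hu scaler0 eq_sym (negPf dl0).
Qed.

End Tau.
End SectionPatch.

Lemma connected_locally_constant (T : topologicalType) (A : Type) (f : T -> A) :
  connected [set: T] -> (forall x, \forall y \near x, f y = f x) -> forall x y, f x = f y.
Proof.
move=> cT lf x y.
have op (Q : A -> Prop) : open [set z | Q (f z)].
  by rewrite openE => z Qz; apply: filterS (lf z) => z' zz; rewrite /= zz.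
have E : [set z | f x = f z] = [set: T].
  apply: cT; first by exists x.
    by exists [set z | f x = f z]; [exact: (op (fun c => f x = c))|rewrite setTI].
  exists [set z | f x = f z]; last by rewrite setTI.
  rewrite -[X in closed X]setCK; apply: open_closedC.
  exact: (op (fun c => ~ f x = c)).
by have : [set z | f x = f z] y by rewrite E.
Qed.

Lemma lck_metric_on (R : realType) (m : nat) (X : topologicalType) (SX : complex_structure X 'rV[Cx R]_m)
  (g : metric R m X) : lck_metric SX g -> forall x, exists U f, lck_on SX g U f /\ U x.
Proof.
move=> [_ H] x; have [U [gU [f [oU Ux kU sf gf]]]] := H x.
by exists U, f; split=> //; exists gU; split.
Qed.

(** * The contradiction *)

Section Discrete.
Variables (R : realType) (B : topologicalType) (SB : complex_structure B 'rV[Cx R]_0).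

Lemma dim0_open_point (i : B) : open [set i].
Proof.
have [a aA ai] := cs_cover SB i.
have -> : [set i] = chart_dom a; last exact: cs_open_dom aA.
apply/seteqP; split=> [_ -> //|y ay].
rewrite -(cs_mapK aA ay) -(cs_mapK aA ai) /=; congr (chart_inv a _).
by apply/rowP => -[].
Qed.

Lemma dim0_H2 (z1 z2 : cocycle2 B int) (a b : R) :
  a *: H2_real R (H2_class z1) + b *: H2_real R (H2_class z2) = 0.
Proof.
apply: (@real_relation R B z1 z2 (fun i => [set i])).
  by move=> i; split; [exact: dim0_open_point|].
(* On the cover by singletons all indices equal y, and the cochain is its own primitive: x = x - x +
   x. *)
exists (fun i j y => a * (submodule_val z1 y y y y)%:~R + b * (submodule_val z2 y y y y)%:~R).
split=> [i j y [-> ij]|i j k y -> <- <-]; last by ring.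
by apply: filterS (open_nbhs_nbhs (conj (dim0_open_point i) erefl)) => y' ->.
Qed.

End Discrete.

(** Dividing by the periods ci and cj removes the factor x that relates the two patches. *)
Lemma proportional_shift (R : realFieldType) (ci cj x a a' b b' : R) : ci != 0 -> cj != 0 ->
  cj = x * ci -> a - x * b = a' - x * b' -> cj^-1 * a - ci^-1 * b = cj^-1 * a' - ci^-1 * b'.
Proof.
move=> ci0 cj0 cE E; have x0 : x != 0 by apply: contra_neq cj0 => x0; rewrite cE x0 mul0r.
have -> : ci^-1 = cj^-1 * x by rewrite cE invfM mulrAC mulVf// mul1r.
by rewrite -!mulrA -!mulrBr E.
Qed.

Section Main.
Variables (R : realType) (m n : nat) (X B : topologicalType)
  (SX : complex_structure X 'rV[Cx R]_m)
  (SB : complex_structure B 'rV[Cx R]_n)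
  (E : elliptic_curve R) (P : elliptic_bundle SX SB E).
Hypothesis cX : connected [set: X].
Hypothesis cB : connected [set: B].
Variable g : metric R m X.
Hypothesis lckg : lck_metric SX g.
Local Notation W := 'rV[Cx R]_m.
Local Notation W0 := 'rV[Cx R]_n.
Local Notation V0 := (W0 * Cx R)%type.
Local Notation e := (fr_e (f := rV_frame m)).
Local Notation e0 := (fr_e (f := rV_frame n)).
Local Notation w1 := (ec_w1 E).
Local Notation w2 := (ec_w2 E).
Variables (U : B -> set B) (s : B -> B -> X) (h : B -> B -> B -> Cx R) (z1 z2 : cocycle2 B int).
Hypothesis cU : point_cover U.
Hypothesis hs : forall i, smooth_map SB SX (U i) (s i) /\ forall b, U i b -> eb_proj P (s i b) = b.
Hypothesis hh : forall i j, smooth_Cfun SB (U i `&` U j) (h i j) /\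
  forall b, U i b -> U j b -> s j b = eb_act P (ec_proj E (h i j b)) (s i b).
Hypothesis dh : forall i j k b, U i b -> U j b -> U k b ->
  h j k b - h i k b + h i j b =
    (submodule_val z1 i j k b)%:~R * w1 + (submodule_val z2 i j k b)%:~R * w2.
Hypothesis indep : linearly_independent2 (H2_real R (H2_class z1)) (H2_real R (H2_class z2)).

Let be i : chart B W0 := chart_at SB i.
Let beA i : atlas SB (be i). Proof. exact: chart_at_atlas. Qed.

Let chart_near i b : chart_dom (be i) b -> (\forall b' \near b, U i b') ->
  \forall w \near chart_map (be i) b, chart_img (be i) w /\ U i (chart_inv (be i) w).
Proof.
move=> ib Ub; have ibw : chart_img (be i) (chart_map (be i) b) by exists b.
have N1 : \forall w \near chart_map (be i) b, chart_img (be i) w.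
  by apply: open_nbhs_nbhs; split=> //; exact: cs_open_img (beA i).
have N2 : \forall w \near chart_map (be i) b, U i (chart_inv (be i) w).
  by apply: (cs_continuous_inv (beA i) ibw); rewrite /= (cs_mapK (beA i) ib).
by apply: filterS2 N1 N2.
Qed.

(** A ball in the chart at i lying over U i: being star-shaped, it makes the Poincare lemma
    available on its product with C. *)
Let ball_ex i : exists D : set W0, [/\ open D, D (chart_map (be i) i),
  D `<=` [set w | chart_img (be i) w /\ U i (chart_inv (be i) w)] &
  forall w (t : R), D w -> 0 <= t <= 1 -> D (chart_map (be i) i + rc t *: (w - chart_map (be i) i))].
Proof.
have [oU Ui] := cU i; apply: star_ball.
  rewrite openE => _ [[b ib <-] Ub]; rewrite (cs_mapK (beA i) ib) in Ub.
  by apply: chart_near => //; apply: open_nbhs_nbhs; split.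
have ii : chart_dom (be i) i by exact: chart_at_dom.
by split; [exists i|rewrite (cs_mapK (beA i) ii)].
Qed.

Let D i : set W0 := projT1 (cid (ball_ex i)).
Let HD i := projT2 (cid (ball_ex i)).

Let D_point i w : D i w -> exists b, [/\ chart_dom (be i) b, U i b, w = chart_map (be i) b & chart_inv (be i) w = b].
Proof.
move=> Dw; have [_ _ /(_ w Dw) [[b ib <-] Ub] _] := HD i.
by exists b; rewrite (cs_mapK (beA i) ib) in Ub *.
Qed.

(** The cover U refined to coordinate balls; relations in the limit over covers may be tested on
    it. *)
Let V i : set B := [set b | chart_dom (be i) b /\ D i (chart_map (be i) b)].

Let cV : point_cover V.
Proof.
move=> i; have [oD Di _ _] := HD i; split; last by split; [exact: chart_at_dom|].
rewrite openE => b [ib Db].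
have N1 : \forall b' \near b, chart_dom (be i) b'.
  by apply: open_nbhs_nbhs; split=> //; exact: cs_open_dom (beA i).
have N2 : \forall b' \near b, D i (chart_map (be i) b').
  by apply: (cs_continuous_map (beA i) ib); apply: open_nbhs_nbhs; split.
by apply: filterS2 N1 N2.
Qed.

Let VU i b : V i b -> U i b.
Proof. by move=> [ib /D_point[b' [_ Ub' _ E']]]; rewrite -(cs_mapK (beA i) ib) E'. Qed.

Let tau i (w : W0) : X := s i (chart_inv (be i) w).

Let tau_c i w : D i w -> {for w, continuous (tau i)}.
Proof.
move=> /D_point[b [ib Ub -> Eb]].
apply: (@for_continuous_comp _ _ _ (chart_inv (be i)) (s i)).
  by apply: (cs_continuous_inv (beA i)); exists b.
by rewrite Eb; exact: (hs i).1.1.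
Qed.

Let tau2 i w a k : D i w -> atlas SX a -> chart_dom a (tau i w) ->
  C2 (fun w => e k (chart_map a (tau i w))) w.
Proof.
move=> Dw aA aw.
have N : \forall w' \near w, (chart_map (be i) @` ((U i `&` s i @^-1` chart_dom a) `&` chart_dom (be i))) w'.
  have N1 : \forall w' \near w, D i w' by apply: open_nbhs_nbhs; split=> //; have [] := HD i.
  have N2 : \forall w' \near w, chart_dom a (tau i w').
    by apply: (tau_c Dw); apply: open_nbhs_nbhs; split=> //; exact: cs_open_dom aA.
  apply: filterS2 N1 N2 => w' /D_point[b [ib Ub -> Eb]]; rewrite /tau Eb => ab.
  by exists b.
case: k => j b; have [h1 h2] := (hs i).1.2 a aA j.
case: b; first exact: (Ck2_C2 (h1 (be i) (beA i) 2%N) N).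
exact: (Ck2_C2 (h2 (be i) (beA i) 2%N) N).
Qed.

Let phi i : V0 -> X := swept P (tau i).

Let pt i : patch SX w1 w2 (D i) (chart_map (be i) i) (phi i).
Proof. by have [oD Di _ star] := HD i; exact: (swept_patch P cX oD (@tau_c i) (@tau2 i) Di star). Qed.

Let T i j (w : W0) : W0 := chart_map (be i) (chart_inv (be j) w).
Let H i j (w : W0) : Cx R := h i j (chart_inv (be j) w).
(** T is holomorphic and has a complex differential; H is merely smooth, so its differential is
    assembled from real derivatives. *)
Let dT i j (w u : W0) : W0 := 'd (T i j) w u.
Let dH i j (w u : W0) : Cx R :=
  mkC (dirderiv (fun w => cre (H i j w)) u w) (dirderiv (fun w => cim (H i j w)) u w).

Let glued_point i j b : V i b -> V j b ->
  glued_at (rV_frame n) (D i) (phi i) (D j) (phi j) (T i j) (H i j) (dT i j) (dH i j) (chart_map (be j) b).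
Proof.
move=> Vi Vj; have [ib Di] := Vi; have [jb Dj] := Vj.
have dTT : differentiable (T i j) (chart_map (be j) b) by exact: (cs_transition (beA j) (beA i) jb ib).
have N : \forall w \near chart_map (be j) b, (chart_map (be j) @` ((U i `&` U j) `&` chart_dom (be j))) w.
  have jbw : chart_img (be j) (chart_map (be j) b) by exists b.
  have N1 : \forall w \near chart_map (be j) b, chart_img (be j) w.
    by apply: open_nbhs_nbhs; split=> //; exact: cs_open_img (beA j).
  have N2 : \forall w \near chart_map (be j) b, (V i `&` V j) (chart_inv (be j) w).
    apply: (cs_continuous_inv (beA j) jbw); apply: open_nbhs_nbhs; split.
      by apply: openI; [exact: (cV i).1|exact: (cV j).1].
    by rewrite /= (cs_mapK (beA j) jb).
  apply: filterS2 N1 N2 => _ [b' jb' <-]; rewrite (cs_mapK (beA j) jb') => -[Vi' Vj'].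
  by exists b' => //; split=> //; split; exact: VU.
have [[sr si] hact] := hh i j.
have cr : C1 (fun w => cre (H i j w)) (chart_map (be j) b) by exact: (Ck1_C1 (sr (be j) (beA j) 1%N) N).
have ci : C1 (fun w => cim (H i j w)) (chart_map (be j) b) by exact: (Ck1_C1 (si (be j) (beA j) 1%N) N).
split.
- exact: Dj.
- by rewrite /T (cs_mapK (beA j) jb).
- exact: differentiable_continuous.
- apply: (@near_continuous _ _ (fun w => rc (cre (H i j w)) *: 1 + rc (cim (H i j w)) *: 'i)).
    near=> w; rewrite [RHS]CxE -[X in X + _]/(rc (cre (H i j w)) * 1) mulr1; congr (_ + _).
  apply: (@for_continuousD _ (Cx R) _ (fun w => rc (cre (H i j w)) *: 1) (fun w => rc (cim (H i j w)) *: 'i)).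
    by apply: for_continuous_rcZ; [exact: C1_cont cr|exact: for_continuous_cst].
  by apply: for_continuous_rcZ; [exact: C1_cont ci|exact: for_continuous_cst].
- move=> z; rewrite /phi /swept /tau /T /H /= (cs_mapK (beA j) jb) (cs_mapK (beA i) ib).
  by rewrite (hact b (VU Vi) (VU Vj)) flowD.
- by move=> u k; exact: has_dir_frame.
- by move=> u []; [exact: (C1_dir u cr)|exact: (C1_dir u ci)].
Unshelve. all: by end_near. Qed.

Let glued i j b : V i b -> V j b -> \forall w \near chart_map (be j) b,
  glued_at (rV_frame n) (D i) (phi i) (D j) (phi j) (T i j) (H i j) (dT i j) (dH i j) w.
Proof.
move=> Vi Vj; have [jb _] := Vj.
have jbw : chart_img (be j) (chart_map (be j) b) by exists b.
have N1 : \forall w \near chart_map (be j) b, chart_img (be j) w.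
  by apply: open_nbhs_nbhs; split=> //; exact: cs_open_img (beA j).
have N2 : \forall w \near chart_map (be j) b, (V i `&` V j) (chart_inv (be j) w).
  apply: (cs_continuous_inv (beA j) jbw); apply: open_nbhs_nbhs; split.
    by apply: openI; [exact: (cV i).1|exact: (cV j).1].
  by rewrite /= (cs_mapK (beA j) jb).
apply: filterS2 N1 N2 => _ [b' jb' <-]; rewrite (cs_mapK (beA j) jb') => -[Vi' Vj'].
exact: glued_point.
Qed.

Let shearE i j b z : V i b -> V j b ->
  shear (T i j) (H i j) (chart_map (be j) b, z) = (chart_map (be i) b, z + h i j b).
Proof. by move=> _ [jb _]; rewrite /shear /T /H /= (cs_mapK (beA j) jb). Qed.

(** Serves twice: with the potentials F i, and with the fibre potentials A i divided by their
    periods c i. *)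
Lemma periods_relation (Phi : B -> V0 -> R) (a b : R) :
  (forall i p, cyl (D i) p -> {for p, continuous (Phi i)}) ->
  (forall i p, cyl (D i) p -> Phi i (p + (0, w1)) = Phi i p + a) ->
  (forall i p, cyl (D i) p -> Phi i (p + (0, w2)) = Phi i p + b) ->
  (forall i j y z, V i y -> V j y -> \forall q \near ((chart_map (be j) y, z) : V0),
    Phi j q - Phi i (shear (T i j) (H i j) q) =
    Phi j (chart_map (be j) y, z) - Phi i (shear (T i j) (H i j) (chart_map (be j) y, z))) ->
  a *: H2_real R (H2_class z1) + b *: H2_real R (H2_class z2) = 0.
Proof.
move=> cP P1 P2 PG; apply: (real_relation cV).
pose F i y z := Phi i (chart_map (be i) y, z).
have fibre i j y z : V i y -> V j y ->
    F j y z - F i y (z + h i j y) = F j y 0 - F i y (h i j y).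
  move=> Vi Vj.
  have := @fibre_const R W0 (fun q => Phi j q - Phi i (shear (T i j) (H i j) q)) (chart_map (be j) y)
    (fun z => PG i j y z Vi Vj) z.
  by rewrite !shearE// add0r.
apply: (@periods_coboundary R B w1 w2 (@lat R E) z1 z2 V h _ F a b).
- by move=> i j k y Vi Vj Vk; apply: dh; exact: VU.
- move=> i y z Vi; apply: (@for_continuous_comp _ _ _ (fun z => (chart_map (be i) y, z)) (Phi i)).
    by apply: for_continuous_pair; [exact: for_continuous_cst|exact: cvg_id].
  by apply: cP; case: Vi.
- by move=> i y z [_ Di]; rewrite /F -(P1 i (_, z))//; congr Phi; congr pair; rewrite /= addr0.
- by move=> i y z [_ Di]; rewrite /F -(P2 i (_, z))//; congr Phi; congr pair; rewrite /= addr0.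
- exact: fibre.
- move=> i j y [Vi Vj].
  have N := near_base (PG i j y 0 Vi Vj).
  have [jy _] := Vj.
  have N1 : \forall y' \near y, (V i `&` V j) y'.
    by apply: open_nbhs_nbhs; split=> //; apply: openI; [exact: (cV i).1|exact: (cV j).1].
  have N2 := cs_continuous_map (beA j) jy N.
  apply: filterS2 N1 N2 => y' [Vi' Vj'] /=.
  by rewrite !shearE// !add0r.
Qed.

Hypothesis n0 : (0 < n)%N.

Let lckX := lck_metric_on lckg.
Let hg := lckg.1.

Let noncollinear (i : B) : forall u : W, u != 0 -> exists u' : W, forall c : Cx R, u' != c *: u.
Proof.
have ii : chart_dom (be i) i by exact: chart_at_dom.
have [oD Di sub _] := HD i; have Ui := (cU i).2.
apply: (swept_noncollinear (P := P) cX (@tau_c i) (@tau2 i) n0 Di (beA i)).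
  by rewrite /tau (cs_mapK (beA i) ii) ((hs i).2 i Ui).
have := open_nbhs_nbhs (conj oD Di); apply: filterS => w /D_point[b [ib Ub -> Eb]].
by rewrite /tau Eb ((hs i).2 b Ub).
Qed.

Let F_ex i : exists F, potential SX g (cyl (D i)) (phi i) F.
Proof.
exact: (potential_exists hg (noncollinear i) (prod_frame (rV_frame n) Cx_frame) (cyl_open (patch_open (pt i)))
  (patch_cont (pt i)) (patch_C2 (pt i)) lckX (cyl_star (pt i))).
Qed.

Let gluedK i j y z (F G : V0 -> R) (K : R) : V i y -> V j y ->
  F (chart_map (be j) y, z) - G (shear (T i j) (H i j) (chart_map (be j) y, z)) = K ->
  F (chart_map (be j) y, z) - G (chart_map (be i) y, z + h i j y) = K.
Proof. by move=> Vi Vj <-; rewrite shearE. Qed.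

Section Potentials.
Variable F : B -> V0 -> R.
Hypothesis HF : forall i, potential SX g (cyl (D i)) (phi i) (F i).

Let F_fibre i j y z : V i y -> V j y ->
  F j (chart_map (be j) y, z) - F i (chart_map (be i) y, z + h i j y) =
  F j (chart_map (be j) y, 0) - F i (chart_map (be i) y, h i j y).
Proof.
move=> Vi Vj.
have K := glued_potential_fibre hg lckX (pt i) (pt j) (@HF i) (@HF j) z (glued Vi Vj).
apply: (gluedK Vi Vj); rewrite -[in RHS](add0r (h i j y)).
by symmetry; apply: (gluedK Vi Vj); symmetry; exact: K.
Qed.

Let F_glued i j y z : V i y -> V j y -> \forall q \near ((chart_map (be j) y, z) : V0),
  F j q - F i (shear (T i j) (H i j) q) =
  F j (chart_map (be j) y, z) - F i (shear (T i j) (H i j) (chart_map (be j) y, z)).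
Proof.
move=> Vi Vj; exact: (glued_potential hg lckX (pt i) (pt j) (@HF i) (@HF j) (p := (_, z)) (glued Vi Vj)).
Qed.

(** On a common fibre F j and the translated F i differ by a constant, so their periods agree; the
    period is thus locally constant in the index, and B is connected. *)
Let period_const (z : Cx R) (a : B -> R) : (forall i p, cyl (D i) p -> F i (p + (0, z)) = F i p + a i) ->
  forall i j, a i = a j.
Proof.
move=> Ha i j; apply: connected_locally_constant => // {}i.
apply: filterS (open_nbhs_nbhs (cV i)) => {}j Vi.
have Vj := (cV j).2; have [_ Di] := Vi; have [_ Dj] := Vj.
have add (w : W0) (x x' : Cx R) : (w, x + x') = (w, x') + (0, x) :> V0 by congr pair; rewrite ?addr0// addrC.
have := F_fibre z Vi Vj.
rewrite -{1}(addr0 z) add (Ha j (chart_map (be j) j, 0) Dj).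
by rewrite add (Ha i (chart_map (be i) j, h i j j) Di); lra.
Qed.

Lemma potentials_periodic :
  (forall i p, cyl (D i) p -> F i (p + (0, w1)) = F i p) /\
  (forall i p, cyl (D i) p -> F i (p + (0, w2)) = F i p).
Proof.
have [a Ha] := choice (fun i => potential_period hg lckX (rV_frame n) (pt i) (@HF i) (patch_per1 (pt i))).
have [b Hb] := choice (fun i => potential_period hg lckX (rV_frame n) (pt i) (@HF i) (patch_per2 (pt i))).
have zero i : a i = 0 /\ b i = 0.
  apply: indep; apply: (@periods_relation F (a i) (b i)); last exact: F_glued.
  - by move=> j p Dp; have [c _] := HF Dp; exact: C1_cont c.
  - by move=> j p Dp; rewrite (Ha j p Dp) (period_const Ha j i).
  - by move=> j p Dp; rewrite (Hb j p Dp) (period_const Hb j i).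
by split=> i p Dp; rewrite ?(Ha i p Dp) ?(Hb i p Dp); have [a0 b0] := zero i; rewrite ?a0 ?b0 addr0.
Qed.

Variables (A : B -> V0 -> R) (c : B -> R).
Hypothesis c0 : forall i, c i != 0.
Hypothesis HA : forall i p, cyl (D i) p ->
  C1 (A i) p /\ forall v, has_dir (A i) v p (fibre_form SX g w1 (phi i) (F i) p v).
Hypothesis A1 : forall i p, cyl (D i) p -> A i (p + (0, w1)) = A i p.
Hypothesis A2 : forall i p, cyl (D i) p -> A i (p + (0, w2)) = A i p + c i.

Lemma fibre_potentials_contradiction : False.
Proof.
(* The normalized functions A i / c i have periods 0 and 1, so the relation makes the second class
   vanish. *)
have : 0 = 0 :> R /\ 1 = 0 :> R; last by move=> [_ /eqP]; rewrite oner_eq0.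
apply: indep; apply: (@periods_relation (fun i p => (c i)^-1 * A i p) 0 1).
- by move=> i p Dp; have [cA _] := HA Dp; exact: C1_cont (C1Z _ cA).
- by move=> i p Dp; rewrite (A1 Dp) addr0.
- by move=> i p Dp; rewrite (A2 Dp) mulrDr mulVf.
move=> i j y z Vi Vj; have gl := glued Vi Vj.
have cE := glued_fibre_period hg lckX (pt i) (pt j) (@HF i) (@HF j) (@HA i) (@HA j) gl (@A2 i) (@A2 j).
have N := glued_fibre_potential hg lckX (pt i) (pt j) (@HF i) (@HF j) (@HA i) (@HA j) (p := (_, z)) gl.
by apply: filterS N => q; exact: (proportional_shift (c0 i) (c0 j) cE).
Qed.

End Potentials.

Lemma lck_contradiction : False.
Proof.
have [F HF] := choice F_ex.
have [p1 p2] := potentials_periodic HF.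
have /choice[Ac HAc] i : exists Ac : (V0 -> R) * R, [/\ Ac.2 != 0,
  forall p, cyl (D i) p -> C1 Ac.1 p /\ forall v, has_dir Ac.1 v p (fibre_form SX g w1 (phi i) (F i) p v),
  forall p, cyl (D i) p -> Ac.1 (p + (0, w1)) = Ac.1 p &
  forall p, cyl (D i) p -> Ac.1 (p + (0, w2)) = Ac.1 p + Ac.2].
  have per1 p u v Dp := pom_period hg (rV_frame n) (pt i) (patch_per1 (pt i)) (p1 i) (p := p) u v Dp.
  have per2 p u v Dp := pom_period hg (rV_frame n) (pt i) (patch_per2 (pt i)) (p2 i) (p := p) u v Dp.
  have [A [c HA]] := fibre_potential hg lckX (rV_frame n) (@lat R E) (pt i) (HF i) per1 per2.
  by exists (A, c).
by apply: (@fibre_potentials_contradiction F HF (fun i => (Ac i).1) (fun i => (Ac i).2)) => i; have [] := HAc i.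
Qed.

End Main.

Theorem theorem1 (R : realType) (m n : nat) (X B : topologicalType)
    (SX : complex_structure X 'rV[Cx R]_m)
    (SB : complex_structure B 'rV[Cx R]_n)
    (E : elliptic_curve R) (P : elliptic_bundle SX SB E)
    (c1 c2 : H2 B int) :
  compact [set: X] -> connected [set: X] ->
  compact [set: B] -> connected [set: B] ->
  chern_classes P c1 c2 ->
  linearly_independent2 (H2_real R c1) (H2_real R c2) ->
  ~ (exists g : metric R m X, lck_metric SX g).
Proof.
move=> _ cX _ cB [U [s [h [z1 [z2 [cU hs hh dh [-> ->]]]]]]] indep [g lckg].
(* A tangent direction of the base is available only for n > 0; for n = 0 the base is discrete and
   every relation between the classes holds. *)
have [n0|] := ltnP 0 n.
  exact: (lck_contradiction cX cB lckg cU hs hh dh indep n0).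
rewrite leqn0 => /eqP n0; subst n.
have [_ /eqP] := indep 0 1 (dim0_H2 SB z1 z2 0 1).
by rewrite oner_eq0.
Qed.
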